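(* Let $d\ge 2$ and let $(\sigma_v, v\in\mathbb{Z}^d)$ be a translation invariant Markov random field taking finitely many, strictly positive values. If this Markov random field satisfies the HN condition (defined in the context), then, for the (site version) first-passage percolation model with $t(v)=\sigma_v$, $v\in\mathbb{Z}^d$, there is a constant $C>0$ such that for all $v\in\mathbb{Z}^d$ with $|v|\ge2$, $$\operatorname{Var}(T(0,v))\le C\,\frac{|v|}{\log|v|}.$$ The analog of this result holds for the edge version of the model: if $(\sigma_e,e\in E)$ is a translation invariant Markov random field on the edges of $\mathbb{Z}^d$ taking finitely many, strictly positive values and satisfying the edge version of the HN condition, then the same conclusion holds for the bond-version passage times with $t(e)=\sigma_e$.
   Context: For $v=(v_1,\dots,v_d)\in\mathbb{Z}^d$ put $|v|=\sum_{i=1}^d|v_i|$. $\mathbb{Z}^d$ is regarded as the cubic lattice graph (vertices at $|\cdot|$-distance $1$ are joined by an edge) and $E$ is its edge set. A path from $v$ to $w$ is a finite alternating sequence $v_0=v,e_1,v_1,\dots,e_n,v_n=w$ with $e_i$ an edge between $v_{i-1}$ and $v_i$. Passage times. Site version: given nonnegative values $t(v)$, $v\in\mathbb{Z}^d$, $T(\pi)=\sum_{v\in\pi}t(v)$ (sum over the vertices of $\pi$). Bond version: given nonnegative values $t(e)$, $e\in E$, $T(\pi)=\sum_{e\in\pi}t(e)$ (sum over the edges of $\pi$). In both cases $T(v,w)=\inf_{\pi:v\to w}T(\pi)$, the infimum over all paths $\pi$ from $v$ to $w$. Markov random field and HN condition. Let $W$ be a finite set (here $W\subset(0,\infty)$)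 and write $\partial v$ for the set of the $2d$ nearest neighbours of $v\in\mathbb{Z}^d$. A $W$-valued random field $(\sigma_v,v\in\mathbb{Z}^d)$ is a Markov random field if for each $v$ the conditional distribution of $\sigma_v$ given $(\sigma_u,u\ne v)$ depends only on $\sigma_{\partial v}=(\sigma_u,u\in\partial v)$; it comes with conditional probabilities $\mathbb{P}(\sigma_v=w\mid\sigma_{\partial v}=\eta)$ specified for all $w\in W$, $\eta\in W^{\partial v}$, and it is translation invariant if its distribution and these conditional probabilities are invariant under translations of $\mathbb{Z}^d$. For $w\in W$ put $$\gamma_w=\min_{\eta\in W^{\partial v}}\mathbb{P}(\sigma_v=w\mid\sigma_{\partial v}=\eta),\qquad \gamma=\sum_{w\in W}\gamma_w,$$ which do not depend on $v$. The field satisfies the HN (high-noise) condition if $$\gamma>\frac{2d-1}{2d}.$$ Edge version: vertices are replaced by edges, the neighbourhood $\partial e$ of an edge $e$ is the set of the $4d-2$ other edges sharing an endpoint with $e$, and the HN condition becomes $\gamma>\frac{4d-3}{4d-2}$, where $\gamma=\sum_{w}\min_{\eta\in W^{\partial e}}\mathbb{P}(\sigma_e=w\mid\sigma_{\partial e}=\eta)$, required for every edge $e$. *)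

(* Defs.v *)
From HB Require Import structures.
From mathcomp Require Import all_boot all_order all_algebra finmap.
From mathcomp Require Import zify.
From mathcomp Require Import all_classical all_reals all_analysis.

Set Implicit Arguments.
Unset Strict Implicit.
Unset Printing Implicit Defensive.

Import Order.TTheory GRing.Theory Num.Theory.

Local Open Scope classical_set_scope.
Local Open Scope ring_scope.

Section Lattice.
Variable d : nat.

Definition vertex := 'rV[int]_d.

Definition l1norm (v : vertex) : nat := (\sum_(i < d) `|v ord0 i|)%N.

Definition unitv (i : 'I_d) : vertex := delta_mx ord0 i.

(* The pair (x, i) encodes the unoriented edge {x, x + e_i}. *)
Definition edge := (vertex * 'I_d)%type.

Definition endpoints (e : edge) : {fset vertex} :=
  [fset e.1; (e.1 + unitv e.2)%R]%fset.

Definition vertex_nbrs (v : vertex) : {fset vertex} :=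
  ([fset (v + unitv i)%R | i in 'I_d] `|` [fset (v - unitv i)%R | i in 'I_d])%fset.

Definition incident_edges (v : vertex) : {fset edge} :=
  ([fset (v, i) | i in 'I_d] `|` [fset ((v - unitv i)%R, i) | i in 'I_d])%fset.

Definition edge_nbrs (e : edge) : {fset edge} :=
  ((incident_edges e.1 `|` incident_edges (e.1 + unitv e.2)%R) `\ e)%fset.

Definition vertex_shift (z : vertex) (v : vertex) : vertex := v + z.

Definition edge_shift (z : vertex) (e : edge) : edge := (e.1 + z, e.2).

(* The alternating sequence v, e_1, v_1, ..., e_n, v_n is represented by its
   start v and the list of the steps (e_k, v_k). *)
Fixpoint is_path (v : vertex) (p : seq (edge * vertex)) (w : vertex) : bool :=
  if p is (e, x) :: p' then
    (endpoints e == [fset v; x]%fset) && is_path x p' w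
  else v == w.

End Lattice.

Lemma l1norm1 d (v : vertex d) : l1norm v = 1%N <-> exists i, v = unitv i \/ v = - unitv i.
Proof.
split.
  move=> h. have [i hi] : exists i, v ord0 i != 0.
    apply/existsP; apply: contra_eqT h; rewrite negb_exists => /forallP h.
    by rewrite /l1norm big1 // => i _; move/negPn/eqP: (h i) => ->.
  move: h; rewrite /l1norm (bigD1 i) //= => h.
  rewrite -absz_gt0 in hi; move: h hi; set a := absz _; set b := (X in (a + X)%N) => h hi.
  have h1 : a = 1%N by lia.
  have h0 : b = 0%N by lia.
  have hz j : j != i -> v ord0 j = 0.
    move=> ji; move/eqP: h0; rewrite sum_nat_eq0 => /forallP/(_ j); by rewrite ji /= absz_eq0 => /eqP.
  exists i; have [hp|hp] : v ord0 i = 1 \/ v ord0 i = -1 by move: h1; rewrite /a; move: (v ord0 i) => c; lia.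
  - left; apply/rowP => j; rewrite !mxE /=; have [->|ji] := eqVneq j i; [by rewrite hp|exact: hz].
  - right; apply/rowP => j; rewrite !mxE /=; have [->|ji] := eqVneq j i; first by rewrite hp.
    by rewrite hz // oppr0.
case=> i [] ->; rewrite /l1norm (bigD1 i) //= big1 ?addn0 => [|j ji]; rewrite !mxE ?eqxx ?(negbTE ji) //=.
Qed.

Lemma vertex_nbrsP d (v u : vertex d) : reflect (l1norm (u - v) = 1%N) (u \in vertex_nbrs v).
Proof.
apply: (iffP idP).
  rewrite inE => /orP[] /imfsetP [i _ ->] /=; apply/l1norm1; exists i; [left|right]; by rewrite addrC addKr.
move=> /l1norm1 [i hi]; rewrite inE; apply/orP; case: hi => h; [left|right]; apply/imfsetP; exists i => //=; rewrite -h; by rewrite addrC subrK.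
Qed.

Lemma unitv_inj d (i j : 'I_d) : unitv i = unitv j -> i = j.
Proof. by move/rowP/(_ i); rewrite !mxE !eqxx /=; case: eqP. Qed.

Lemma unitv_opp d (i j : 'I_d) : unitv i <> - unitv j.
Proof. move/rowP/(_ i); rewrite !mxE !eqxx /=; case: (i == j) => //. Qed.
Lemma unitv_neq0 d (i : 'I_d) : unitv i != 0.
Proof. by apply/eqP => /rowP/(_ i); rewrite !mxE !eqxx. Qed.

Lemma card_fset_image (I: finType) (K : choiceType) (f : I -> K) : injective f -> #|` [fset f i | i in I]%fset| = #|I|.
Proof. move=> fi; rewrite card_imfset //= -cardE //. Qed.

Lemma vertex_nbrs_card d (v : vertex d) : #|` vertex_nbrs v| = (2 * d)%N.
Proof.
rewrite cardfsU !card_fset_image; first 1 last.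
- by move=> i j /addrI/oppr_inj/unitv_inj.
- by move=> i j /addrI/unitv_inj.
rewrite !card_ord (_ : (_ `&` _)%fset = fset0) ?cardfs0; first lia.
apply/fsetP => x; rewrite !inE; apply/negP => /andP[/imfsetP[i _ ->] /imfsetP[j _ /=]].
by move=> /addrI/unitv_opp.
Qed.

Lemma incident_edgesP d (v : vertex d) e : (e \in incident_edges v) = (v \in endpoints e).
Proof.
apply/idP/idP.
 rewrite !inE => /orP[] /imfsetP [i _ ->] /=; first by rewrite eqxx.
 by rewrite subrK eqxx orbT.
case: e => x i; rewrite !inE /= => /orP[] /eqP ->; apply/orP; [left|right]; apply/imfsetP; exists i => //=.
by rewrite addrK.
Qed.

Lemma edge_nbrsP d (e f : edge d) :
 (f \in edge_nbrs e) = (f != e) && (endpoints e `&` endpoints f != fset0)%fset.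
Proof.
rewrite /edge_nbrs in_fsetD1 inE !incident_edgesP; congr andb.
apply/idP/fset0Pn.
 by move=> /orP [] h; [exists e.1|exists (e.1 + unitv e.2)]; rewrite inE h /endpoints !inE eqxx ?orbT.
by case=> x; rewrite inE /endpoints 1!inE => /andP[]; rewrite !inE => /orP[]/eqP-> ->; rewrite ?orbT.
Qed.

Lemma endpoints_exists d (v w : vertex d) :
 l1norm (w - v) = 1%N <-> exists e, endpoints e = [fset v; w]%fset.
Proof.
split.
  move=> /l1norm1 [i [] h].
    by exists (v, i); rewrite /endpoints /= -h addrC subrK.
  exists (w, i); rewrite /endpoints /= fsetUC; congr (fsetU (fset1 _) _). 
  by rewrite -[unitv i]opprK -h opprB addrC subrK.
case=> [[x i]] h; apply/l1norm1; exists i.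
have h1 : v != w.
  apply/eqP => vw; subst w; have /fsetP /(_ (x + unitv i)) := h; have /fsetP /(_ x) := h.
  rewrite /endpoints !inE !eqxx !orbb orbT /= => /esym/eqP-> /esym/eqP.
  by move=> /(canRL (addKr _)); rewrite addNr => /eqP; rewrite (negbTE (unitv_neq0 i)).
have /fsetP /(_ v) := h; have /fsetP /(_ w) := h; rewrite /endpoints !inE !eqxx ?orbT /=.
move=> /orP[] /eqP a /orP[] /eqP b; subst; rewrite ?eqxx // in h1 *.
- by right; rewrite opprD addrA subrr add0r.
- by left; rewrite addrC addKr.
Qed.

Lemma endpoints_inj d : injective (@endpoints d).
Proof.
move=> [x i] [y j] h.
have /fsetP /(_ x) := h; have /fsetP /(_ (x + unitv i)) := h; rewrite /endpoints !inE !eqxx ?orbT /=.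
have nz (z : vertex d) k : (z + unitv k = z) -> False.
  by move/eqP; rewrite -subr_eq0 addrC addKr (negbTE (unitv_neq0 _)).
move=> /esym/orP[] /eqP a /esym/orP[] /eqP b.
- by rewrite b in a; case: (nz _ _ a).
- move: a; rewrite b -addrA => /(canRL (addKr _)); rewrite addNr => /eqP; rewrite addr_eq0 => /eqP /unitv_opp //.
- by rewrite b in a *; move/addrI: a => /unitv_inj ->.
- by rewrite b in a; case: (nz _ _ a).
Qed.

Lemma incident_edges_card d (v : vertex d) : #|` incident_edges v| = (2 * d)%N.
Proof.
rewrite cardfsU !card_fset_image; first 1 last.
- by move=> i j [].
- by move=> i j [].
rewrite !card_ord (_ : (_ `&` _)%fset = fset0) ?cardfs0; first lia.
apply/fsetP => x; rewrite !inE; apply/negP => /andP[/imfsetP[i _ ->] /imfsetP[j _ /= [/eqP + _]]].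
by rewrite -subr_eq0 opprB addrC subrK (negbTE (unitv_neq0 _)).
Qed.

Lemma edge_nbrs_card d (e : edge d) : #|` edge_nbrs e| = (4 * d - 2)%N.
Proof.
rewrite /edge_nbrs cardfsD cardfsU !incident_edges_card.
have -> : (incident_edges e.1 `&` incident_edges (e.1 + unitv e.2)%R = [fset e])%fset.
  apply/fsetP => f; rewrite in_fsetI in_fset1.
  rewrite !incident_edgesP; apply/idP/eqP => [|->]; last by rewrite /endpoints !inE !eqxx orbT.
  move=> h; apply: endpoints_inj; apply/esym/eqP; rewrite eqEfcard; apply/andP; split.
    apply/fsubsetP => x; rewrite /endpoints !inE; case/andP: h => a b.
    by move=> /orP[]/eqP->; [move: a|move: b]; rewrite /endpoints !inE.
  have hc (g : edge d) : #|` endpoints g| = 2%N.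
    by rewrite /endpoints cardfs2 -subr_eq0 opprD addrA subrr add0r oppr_eq0 unitv_neq0.
  by rewrite !hc.
rewrite cardfs1 (_ : (_ `&` [fset e])%fset = [fset e]%fset) ?cardfs1; first lia.
apply/fsetIidPr; rewrite fsub1set inE !incident_edgesP /endpoints !inE eqxx //.
Qed.

Section PassageTimes.
Variables (R : realType) (d : nat).

Definition site_path_time (t : vertex d -> R) (v : vertex d)
    (p : seq (edge d * vertex d)) : R :=
  t v + \sum_(s <- p) t s.2.

Definition bond_path_time (t : edge d -> R) (p : seq (edge d * vertex d)) : R :=
  \sum_(s <- p) t s.1.

Definition site_time (t : vertex d -> R) (v w : vertex d) : R :=
  inf [set site_path_time t v p | p in [set p | is_path v p w]].

Definition bond_time (t : edge d -> R) (v w : vertex d) : R :=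
  inf [set bond_path_time t p | p in [set p | is_path v p w]].

End PassageTimes.

Section ConditionalProbability.
Context (disp : measure_display) (Omega : measurableType disp) (R : realType).
Variable P : probability Omega R.

(* f is a version of the conditional probability of B given the
   sigma-algebra G. *)
Definition is_cond_prob (G : set (set Omega)) (B : set Omega) (f : Omega -> R) : Prop :=
  (forall Y : set R, measurable Y -> G (f @^-1` Y)) /\
  (forall A : set Omega, G A -> P (A `&` B) = (\int[P]_(x in A) (f x)%:E)%E).

End ConditionalProbability.

Section MarkovField.
Context (disp : measure_display) (Omega : measurableType disp) (R : realType).
Variables (P : probability Omega R) (W : finType).
(* The field is indexed by I, with neighbourhoods nbrs; in the applications
   I is the set of vertices or the set of edges. *)
Variables (I : choiceType) (nbrs : I -> {fset I}).

Definition local_config (i : I) := {ffun nbrs i -> W}.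

Definition restrict (i : I) (x : I -> W) : local_config i :=
  [ffun j => x (val j)].

(* q i eta w stands for P(sigma_i = w | sigma_(nbrs i) = eta); it is given for
   all eta, including those of probability zero. *)
Definition specification := forall i : I, local_config i -> W -> R.

Definition random_field (sigma : I -> Omega -> W) : Prop :=
  forall i w, measurable (sigma i @^-1` [set w]).

Definition outer_sigma_algebra (sigma : I -> Omega -> W) (i : I) : set (set Omega) :=
  <<s [set A | exists j w, j <> i /\ A = sigma j @^-1` [set w]] >>.

Definition markov_random_field (sigma : I -> Omega -> W) (q : specification) :
    Prop :=
  [/\ random_field sigma,
      forall i eta w, 0 <= q i eta w,
      forall i eta, \sum_(w : W) q i eta w = 1 &
      forall i w,
        is_cond_prob P (outer_sigma_algebra sigma i) (sigma i @^-1` [set w])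
          (fun x => q i (restrict i (sigma ^~ x)) w)].

Definition cylinder_sigma_algebra : set (set (I -> W)) :=
  <<s [set B | exists i w, B = [set x | x i = w]] >>.

Definition field_law (sigma : I -> Omega -> W) (B : set (I -> W)) : \bar R :=
  P [set x | B (sigma ^~ x)].

(* In the second clause x \o shift z is the configuration x translated by - z;
   every pair of local configurations that are translates of one another
   arises from such x. *)
Definition translation_invariant (Z : Type) (shift : Z -> I -> I)
    (sigma : I -> Omega -> W) (q : specification) : Prop :=
  (forall z B, cylinder_sigma_algebra B ->
     field_law (sigma \o shift z) B = field_law sigma B) /\
  (forall z i (x : I -> W) w,
     q (shift z i) (restrict (shift z i) x) w = q i (restrict i (x \o shift z)) w).

(* The default value 1 of the minimum is immaterial for probabilities. *)
Definition gamma_at (q : specification) (i : I) (w : W) : R :=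
  \big[Num.min/1]_(eta : local_config i) q i eta w.

Definition gamma (q : specification) (i : I) : R :=
  \sum_(w : W) gamma_at q i w.

End MarkovField.

Arguments specification R W {I} nbrs.

Section HighNoise.
Variables (R : realType) (W : finType) (d : nat).

Definition site_HN (q : specification R W (@vertex_nbrs d)) : Prop :=
  forall v, ((2 * d)%:R - 1) / (2 * d)%:R < gamma q v.

Definition edge_HN (q : specification R W (@edge_nbrs d)) : Prop :=
  forall e, ((4 * d)%:R - 3) / ((4 * d)%:R - 2) < gamma q e.

End HighNoise.

(* Main.v *)
Require Import Defs.
From mathcomp Require Import all_boot all_order all_algebra finmap.
From mathcomp Require Import zify ring lra.
From mathcomp Require Import all_classical all_reals all_analysis.

Set Implicit Arguments.
Unset Strict Implicit.
Unset Printing Implicit Defensive.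

Import Order.TTheory GRing.Theory Num.Theory.

Local Open Scope ring_scope.

(** The logarithmic gain comes from an inequality of Talagrand's type: if every
    single-site influence on a function is small in [L^1], its variance is smaller
    than the sum of the squared [L^2] influences by a factor that is logarithmic in
    the [L^1] bound. For independent variables, Falik and Samorodnitsky derive this
    from the logarithmic Sobolev inequality, applied to the increments of a
    martingale. Under the high-noise condition the argument survives for the Gibbs
    measures of the field in a finite box. Write [D] for the number of neighbours
    and [beta] for [1 - gamma]; the condition says [D * beta < 1], and [beta] bounds
    the influence of one neighbour on a conditional distribution.

    Logarithmic Sobolev inequality. Relative entropy is the entropy of one marginal
    plus the entropies given the value at that site. Averaging this chain rule over
    the site revealed first, and inducting on the number of free sites, reduces
    [entropy_tensorization] to bounding the entropies of the marginals by those of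
    the single-site conditional distributions. Dobrushin's comparison
    ([controls_bound], [bound_sqr_limit]) bounds the distances of the marginals by
    the effects of resampling single sites, in mean square over the sites. Distances
    and entropies are exchanged by Pinsker's inequality and, in the other direction,
    by a lower bound for the positive atoms of the marginals ([pinned_marginal]).

    Talagrand's inequality. Conditional expectations at nonadjacent sites commute, so
    that averaging over the sites of one colour of a proper colouring, one after the
    other, gives a martingale whose increments have controlled energy; this is
    [falik_samorodnitsky]. Averaging over a whole colour class contracts the
    oscillations of a function, so the variances lost in this way, over all the
    colours, add up to a fixed fraction of the variance ([colour_gap]), and
    [talagrand] follows. The field itself is approximated by Gibbs measures in large
    boxes: by Dobrushin's comparison the influence of the boundary decays
    geometrically with its distance ([box_comparison], [field_variance]).

    First-passage percolation. Following Benjamini, Kalai and Schramm, [T(0, v)] is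
    replaced by the average [F] of the passage times from [z] to [z + v], with [z] in
    an [m] by [m] square and [m] of order [|v|^(1/4)]; this costs [O(m)] pointwise. A
    site influences [F] through the translated geodesics that visit it. A geodesic
    has [O(|v|)] sites, so the influences add up to [O(|v|)]. By translation
    invariance the influence of one site is [m^(-2)] times the expected number of
    visits of a geodesic to an [m] by [m] square, and a geodesic visits a set of
    diameter [m] at most [O(m)] times ([geodesic_visits]), since it could go straight
    from the first visit to the last. All influences are thus [O(1/m)], and
    [passage_variance] gains the factor [log m], which is of order [log |v|]. The site
    and bond versions are two instances of one notion of [path_system]. *)

(** * Finite Gibbs systems *)

Section Configurations.
Context {V W : finType}.
Implicit Types (x : {ffun V -> W}) (i j : V) (w : W).

Definition upd x i w : {ffun V -> W} := [ffun j => if j == i then w else x j].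

Lemma upd_at x i w : upd x i w i = w.
Proof. by rewrite ffunE eqxx. Qed.

Lemma upd_off x i w j : j != i -> upd x i w j = x j.
Proof. by rewrite ffunE => /negbTE ->. Qed.

Lemma upd_upd x i w w' : upd (upd x i w) i w' = upd x i w'.
Proof. by apply/ffunP => j; rewrite !ffunE; case: eqP. Qed.

Lemma upd_self x i : upd x i (x i) = x.
Proof. by apply/ffunP => j; rewrite !ffunE; case: eqP => // ->. Qed.

Lemma updC x i j w w' : i != j -> upd (upd x i w) j w' = upd (upd x j w') i w.
Proof.
move=> ij; apply/ffunP => l; rewrite !ffunE.
by case: eqP => // ->; rewrite eq_sym (negbTE ij).
Qed.

(** The map that exchanges a symbol [w] with the one that [x] has at [i] is an
    involution of the pairs [(x, w)]. *)
Lemma sum_upd_swap (R : nmodType) i (G : {ffun V -> W} -> W -> {ffun V -> W} -> R) :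
  \sum_x \sum_w G x w (upd x i w) = \sum_x \sum_w G (upd x i w) (x i) x.
Proof.
rewrite !pair_big /=.
rewrite (reindex_inj (h := fun xw : {ffun V -> W} * W => (upd xw.1 i xw.2, xw.1 i))) /=.
  by apply: eq_bigr => -[x w] _ /=; rewrite upd_upd upd_self.
apply: (can_inj (g := fun xw : {ffun V -> W} * W => (upd xw.1 i xw.2, xw.1 i))).
by move=> [x w] /=; rewrite upd_upd upd_self upd_at.
Qed.

End Configurations.

Section Expectation.
Context {R : realType} {T : finType}.
Implicit Types (f g : T -> R).

Record distribution (mu : T -> R) : Prop := {
  distr_ge0 : forall x, 0 <= mu x;
  distr_sum : \sum_x mu x = 1
}.

Definition ex (mu : T -> R) f := \sum_x mu x * f x.

Lemma exD mu f g : ex mu (fun x => f x + g x) = ex mu f + ex mu g.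
Proof. by rewrite /ex -big_split; apply: eq_bigr => x _; rewrite mulrDr. Qed.

Lemma exB mu f g : ex mu (fun x => f x - g x) = ex mu f - ex mu g.
Proof. by rewrite /ex -sumrB; apply: eq_bigr => x _; rewrite mulrBr. Qed.

Lemma exZ mu c f : ex mu (fun x => c * f x) = c * ex mu f.
Proof. by rewrite /ex mulr_sumr; apply: eq_bigr => x _; rewrite mulrCA. Qed.

Lemma ex_sum mu (I : Type) (r : seq I) (f : I -> T -> R) :
  ex mu (fun x => \sum_(i <- r) f i x) = \sum_(i <- r) ex mu (f i).
Proof.
by rewrite /ex exchange_big; apply: eq_bigr => x _; rewrite mulr_sumr.
Qed.

Lemma eq_ex mu f g : f =1 g -> ex mu f = ex mu g.
Proof. by move=> e; apply: eq_bigr => x _; rewrite e. Qed.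

Section Distribution.
Variables (mu : T -> R) (mu_distr : distribution mu).

Lemma le_ex f g : (forall x, f x <= g x) -> ex mu f <= ex mu g.
Proof. by move=> fg; apply: ler_sum => x _; rewrite ler_wpM2l ?distr_ge0. Qed.

Lemma ex_ge0 f : (forall x, 0 <= f x) -> 0 <= ex mu f.
Proof. by move=> f0; apply: sumr_ge0 => x _; apply: mulr_ge0 => //; exact: distr_ge0. Qed.

Lemma ex_cst c : ex mu (fun=> c) = c.
Proof. by rewrite /ex -mulr_suml distr_sum // mul1r. Qed.

Lemma ex_norm f : `|ex mu f| <= ex mu (fun x => `|f x|).
Proof.
apply: le_trans (ler_norm_sum _ _ _) _; apply: ler_sum => x _.
by rewrite normrM ger0_norm ?distr_ge0.
Qed.

(** The expectation of [(s f - t g)^2] is a nonnegative quadratic form in [(s, t)]. *)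
Lemma ex_CauchySchwarz f g :
  ex mu (fun x => f x * g x) ^+ 2 <=
  ex mu (fun x => f x ^+ 2) * ex mu (fun x => g x ^+ 2).
Proof.
set a := ex mu (fun x => g x ^+ 2); set b := ex mu (fun x => f x * g x).
set c := ex mu (fun x => f x ^+ 2).
have q s t : 0 <= s ^+ 2 * c - 2 * s * t * b + t ^+ 2 * a.
  have -> : s ^+ 2 * c - 2 * s * t * b + t ^+ 2 * a =
            ex mu (fun x => (s * f x - t * g x) ^+ 2).
    rewrite /a /b /c -!exZ -exB -exD; apply: eq_ex => x; ring.
  by apply: ex_ge0 => x; rewrite sqr_ge0.
have a0 : 0 <= a by apply: ex_ge0 => x; rewrite sqr_ge0.
have c0 : 0 <= c by apply: ex_ge0 => x; rewrite sqr_ge0.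
have [a_eq0|a_neq0] := eqVneq a 0.
  have [->|b0] := eqVneq b 0; first by rewrite expr0n mulr_ge0.
  have := q 1 ((c + 1) / (2 * b)); rewrite a_eq0 => h.
  have e : 2 * 1 * ((c + 1) / (2 * b)) * b = c + 1 by field.
  by rewrite e expr1n in h; lra.
have ap : 0 < a by rewrite lt_def a_neq0.
have := q a b => h.
have : 0 <= a * (c * a - b ^+ 2) by apply: le_trans h _; rewrite le_eqVlt; apply/orP; left; apply/eqP; ring.
by rewrite pmulr_rge0 // subr_ge0.
Qed.

End Distribution.

(** Evaluate the difference under the product coupling of the two distributions. *)
Lemma ex_diff_le (a b : T -> R) (Q : pred T) M f : distribution a -> distribution b ->
  (forall x, ~~ Q x -> a x = 0) -> (forall x, ~~ Q x -> b x = 0) ->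
  (forall x y, Q x -> Q y -> `|f x - f y| <= M) -> `|ex a f - ex b f| <= M.
Proof.
move=> aD bD aQ bQ fM.
have -> : ex a f - ex b f = \sum_x \sum_y a x * b y * (f x - f y).
  have -> : ex a f = \sum_x \sum_y a x * b y * f x.
    by apply: eq_bigr => x _; rewrite -mulr_suml -mulr_sumr (distr_sum bD); ring.
  have -> : ex b f = \sum_x \sum_y a x * b y * f y.
    rewrite exchange_big; apply: eq_bigr => y _ /=.
    by rewrite -mulr_suml -mulr_suml (distr_sum aD); ring.
  by rewrite -sumrB; apply: eq_bigr => x _; rewrite -sumrB; apply: eq_bigr => y _; ring.
apply: le_trans (ler_norm_sum _ _ _) _.
rewrite -[leRHS]mul1r -(distr_sum aD) mulr_suml; apply: ler_sum => x _.
apply: le_trans (ler_norm_sum _ _ _) _.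
rewrite -[leRHS]mulr1 -(distr_sum bD) mulr_sumr; apply: ler_sum => y _.
rewrite normrM ger0_norm; last by rewrite mulr_ge0 ?(distr_ge0 aD) ?(distr_ge0 bD).
rewrite mulrAC; have [Qx|/aQ ->] := boolP (Q x); last by rewrite !mul0r.
have [Qy|/bQ ->] := boolP (Q y); last by rewrite !mulr0.
by rewrite ler_wpM2r ?(distr_ge0 bD) // ler_wpM2l ?(distr_ge0 aD) // fM.
Qed.

End Expectation.

Section Gibbs.
Context {R : realType} {V W : finType}.
Notation conf := {ffun V -> W}.
Implicit Types (f g : conf -> R) (x y : conf) (i j : V) (w : W).

(** A Gibbs system in the high-noise regime: [k i x] is the conditional distribution
    at [i] given the values that [x] takes at the neighbours of [i]. The minorant of
    mass [1 - beta] limits the influence of one neighbour to [beta], and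
    [subcritical] says that the [D] neighbours together have influence below one.
    The constant [alpha] separates the possible symbols from the impossible ones. *)
Record kernel (adj : rel V) (D : nat) (beta alpha : R) (k : V -> conf -> W -> R) : Prop := {
  adj_sym : forall i j, adj i j = adj j i;
  adj_irr : forall i, ~~ adj i i;
  adj_deg : forall i, (#|[pred j | adj i j]| <= D)%N;
  k_ge0 : forall i x w, 0 <= k i x w;
  k_sum : forall i x, \sum_w k i x w = 1;
  k_loc : forall i x y, (forall j, adj i j -> x j = y j) -> k i x =1 k i y;
  k_minor : forall i, exists gam : W -> R,
      1 - beta <= \sum_w gam w /\ forall x w, gam w <= k i x w;
  k_atom : forall i x w, k i x w = 0 \/ alpha <= k i x w;
  alpha_gt0 : 0 < alpha;
  beta_ge0 : 0 <= beta;
  beta_lt1 : beta < 1;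
  subcritical : D%:R * beta < 1
}.

(** Detailed balance: [k i] is the conditional distribution of [mu] at [i]. *)
Definition reversible (k : V -> conf -> W -> R) (i : V) (mu : conf -> R) : Prop :=
  forall x w, mu x * k i x w = mu (upd x i w) * k i x (x i).

(** Conditional expectation given the values at the sites other than [i]. *)
Definition ce (k : V -> conf -> W -> R) i f x := \sum_w k i x w * f (upd x i w).

Section Kernel.
Variables (adj : rel V) (D : nat) (beta alpha : R) (k : V -> conf -> W -> R).
Hypothesis kK : kernel adj D beta alpha k.
Notation E := (ce k).

Lemma adj_neq i j : adj i j -> i != j.
Proof. by move=> ij; apply/eqP => e; move: ij; rewrite e (negbTE (adj_irr kK j)). Qed.

Lemma k_upd i x w : k i (upd x i w) =1 k i x.
Proof. by apply: (k_loc kK) => j /adj_neq; rewrite eq_sym => /upd_off ->. Qed.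

Lemma k_upd_nonadj i j x w : ~~ adj i j -> k i (upd x j w) =1 k i x.
Proof.
move=> ij; apply: (k_loc kK) => l il; rewrite upd_off //.
by apply: contraNneq ij => <-.
Qed.

Lemma eq_ce i f g : f =1 g -> E i f =1 E i g.
Proof. by move=> e x; apply: eq_bigr => w _; rewrite e. Qed.

Lemma ceB i f g x : E i (fun x => f x - g x) x = E i f x - E i g x.
Proof. by rewrite /ce -sumrB; apply: eq_bigr => w _; rewrite mulrBr. Qed.

Lemma ceZ i c f x : E i (fun x => c * f x) x = c * E i f x.
Proof. by rewrite /ce mulr_sumr; apply: eq_bigr => w _; rewrite mulrCA. Qed.

Lemma le_ce i f g : (forall x, f x <= g x) -> forall x, E i f x <= E i g x.
Proof. by move=> fg x; apply: ler_sum => w _; rewrite ler_wpM2l ?(k_ge0 kK). Qed.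

Lemma ce_upd i f x w : E i f (upd x i w) = E i f x.
Proof. by apply: eq_bigr => w' _; rewrite k_upd upd_upd. Qed.

Lemma ce_mull i f g x : (forall x w, g (upd x i w) = g x) ->
  E i (fun x => g x * f x) x = g x * E i f x.
Proof.
by move=> gi; rewrite /ce mulr_sumr; apply: eq_bigr => w _; rewrite gi mulrCA.
Qed.

Lemma ce_indep i g x : (forall x w, g (upd x i w) = g x) -> E i g x = g x.
Proof.
move=> gi; rewrite /ce (eq_bigr (fun w => k i x w * g x)) => [|w _]; last by rewrite gi.
by rewrite -mulr_suml (k_sum kK) mul1r.
Qed.

Lemma ce_idem i f : E i (E i f) =1 E i f.
Proof. by move=> x; apply: ce_indep => y w; rewrite ce_upd. Qed.

Lemma ce_cst i c x : E i (fun=> c) x = c.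
Proof. exact: ce_indep. Qed.

Lemma ce_comm i j f : ~~ adj i j -> E i (E j f) =1 E j (E i f).
Proof.
move=> ij x; have [->//|neq] := eqVneq i j.
rewrite /ce; under eq_bigr do rewrite mulr_sumr.
rewrite exchange_big /=; apply: eq_bigr => w' _; rewrite mulr_sumr; apply: eq_bigr => w _.
by rewrite (k_upd_nonadj _ _ ij) k_upd_nonadj 1?(adj_sym kK) // mulrCA updC.
Qed.

Section Reversible.
Variables (mu : conf -> R) (mu_distr : distribution mu).
Variables (i : V) (mu_rev : reversible k i mu).

Lemma ex_ce_swap (G : conf -> conf -> R) :
  ex mu (fun x => \sum_w k i x w * G x (upd x i w)) =
  ex mu (fun x => \sum_w k i x w * G (upd x i w) x).
Proof.
rewrite /ex.
under eq_bigr do rewrite mulr_sumr.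
rewrite (sum_upd_swap i (fun x w y => mu x * (k i x w * G x y))).
apply: eq_bigr => x _; rewrite mulr_sumr; apply: eq_bigr => w _.
by rewrite !mulrA k_upd -mu_rev.
Qed.

Lemma ce_selfadj f g :
  ex mu (fun x => E i f x * g x) = ex mu (fun x => f x * E i g x).
Proof.
transitivity (ex mu (fun x => \sum_w k i x w * (g x * f (upd x i w)))).
  by apply: eq_ex => x; rewrite /ce mulr_suml; apply: eq_bigr => w _; ring.
rewrite (ex_ce_swap (fun x y => g x * f y)).
by apply: eq_ex => x; rewrite /ce mulr_sumr; apply: eq_bigr => w _; ring.
Qed.

Lemma ex_ce f : ex mu (E i f) = ex mu f.
Proof.
have := ce_selfadj f (fun=> 1); under eq_ex do rewrite mulr1.
by move=> ->; apply: eq_ex => x; rewrite ce_cst mulr1.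
Qed.

Lemma ex_ce_sq f : ex mu (fun x => E i f x * f x) = ex mu (fun x => E i f x ^+ 2).
Proof.
have := ce_selfadj f (E i f) => h.
rewrite [LHS](eq_ex _ (g := fun x => f x * E i (E i f) x)).
  by rewrite -h; apply: eq_ex => x; rewrite expr2.
by move=> x; rewrite ce_idem mulrC.
Qed.

(** [ce k i] is an orthogonal projection of [L^2(mu)]. *)
Lemma ce_pythagoras f :
  ex mu (fun x => f x ^+ 2) =
  ex mu (fun x => E i f x ^+ 2) + ex mu (fun x => (f x - E i f x) ^+ 2).
Proof.
have h := ex_ce_sq f.
have -> : ex mu (fun x => (f x - E i f x) ^+ 2) =
  ex mu (fun x => f x ^+ 2) - 2 * ex mu (fun x => E i f x * f x) + ex mu (fun x => E i f x ^+ 2).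
  by rewrite -exZ -exB -exD; apply: eq_ex => x; ring.
by rewrite h; ring.
Qed.

Lemma ce_contract1 f : ex mu (fun x => `|E i f x|) <= ex mu (fun x => `|f x|).
Proof.
rewrite -[leRHS]ex_ce; apply: le_ex => // x.
apply: le_trans (ler_norm_sum _ _ _) _; apply: ler_sum => w _.
by rewrite normrM ger0_norm // (k_ge0 kK).
Qed.

End Reversible.
End Kernel.
End Gibbs.

(** * The Dobrushin comparison of two random fields *)

Lemma le_geometric_limit (R : realType) (a b c z : R) : 0 <= z < 1 ->
  (forall m, a <= b + c * z ^+ m) -> a <= b.
Proof.
move=> /andP[z0 z1] h.
have cv : ((fun m => b + c * z ^+ m) @ \oo --> b + c * 0)%classic.
  apply: cvgD; first exact: cvg_cst.
  by apply: cvgMl_tmp; apply: cvg_expr; rewrite ger0_norm.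
have -> : b = b + c * 0 by rewrite mulr0 addr0.
rewrite -(cvg_lim _ cv) //; apply: limr_ge; first exact: (cvgP _ cv).
exact: nearW.
Qed.

Section Comparison.
Context {R : realType} {V W : finType}.
Notation conf := {ffun V -> W}.
Implicit Types (f g : conf -> R) (x y : conf) (i j : V) (w : W).

(** Lipschitz continuity for the Hamming distance with weights [d]. *)
Definition osc f (d : V -> R) : Prop :=
  (forall i, 0 <= d i) /\ forall i x w, `|f (upd x i w) - f x| <= d i.

Section Kernel.
Variables (adj : rel V) (D : nat) (beta alpha : R) (k : V -> conf -> W -> R).
Hypothesis kK : kernel adj D beta alpha k.
Notation E := (ce k).

(** Oscillations after averaging at [i]: the dependence on [i] is lost and is
    passed on, with weight [a], to the neighbours of [i]. *)
Definition spread (a : R) i d j : R :=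
  if j == i then 0 else d j + (adj i j)%:R * a * d i.

(** Two kernels above a common minorant of mass at least [1 - beta] differ by
    residues of equal mass at most [beta]. *)
Lemma kernel_diff_le i x y (F : W -> R) (c : R) : 0 <= c ->
  (forall w w', `|F w - F w'| <= c) ->
  `|\sum_w k i x w * F w - \sum_w k i y w * F w| <= beta * c.
Proof.
move=> c0 Fc; have [gam [gsum gk]] := k_minor kK i.
pose r z w := k i z w - gam w.
have r0 z w : 0 <= r z w by rewrite subr_ge0.
pose rho := 1 - \sum_w gam w.
have rs z : \sum_w r z w = rho by rewrite sumrB (k_sum kK).
have -> : \sum_w k i x w * F w - \sum_w k i y w * F w =
          \sum_w r x w * F w - \sum_w r y w * F w.
  by rewrite -!sumrB; apply: eq_bigr => w _; rewrite /r; ring.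
have rho0 : 0 <= rho by rewrite -(rs x); apply: sumr_ge0.
have rhob : rho <= beta by rewrite /rho; lra.
have key : rho * (\sum_w r x w * F w - \sum_w r y w * F w) =
   \sum_w \sum_w' r x w * r y w' * (F w - F w').
  rewrite mulrBr.
  have -> : rho * (\sum_w r x w * F w) = \sum_w \sum_w' r x w * r y w' * F w.
    rewrite -(rs y) mulr_suml exchange_big; apply: eq_bigr => w' _ /=.
    by rewrite mulr_sumr; apply: eq_bigr => w _; ring.
  have -> : rho * (\sum_w r y w * F w) = \sum_w \sum_w' r x w * r y w' * F w'.
    rewrite -(rs x) mulr_suml; apply: eq_bigr => w' _ /=.
    by rewrite mulr_sumr; apply: eq_bigr => w _; ring.
  rewrite -sumrB; apply: eq_bigr => w _; rewrite -sumrB; apply: eq_bigr => w' _.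
  by ring.
have [rho_eq0|rho_neq0] := eqVneq rho 0.
  have rz z w : r z w = 0.
    have := rs z; rewrite rho_eq0 => /eqP; rewrite psumr_eq0 // => /allP h.
    by apply/eqP; apply: h; rewrite mem_index_enum.
  rewrite !big1 ?subrr ?normr0 ?mulr_ge0 ?(beta_ge0 kK) // => w _; by rewrite rz mul0r.
have rhop : 0 < rho by rewrite lt_def rho_neq0.
apply: le_trans (_ : rho * c <= _); last by rewrite ler_wpM2r.
rewrite -(ler_pM2l rhop) -{1}(ger0_norm rho0) -normrM key.
apply: le_trans (ler_norm_sum _ _ _) _.
apply: le_trans (_ : \sum_w \sum_w' r x w * r y w' * c <= _).
  apply: ler_sum => w _; apply: le_trans (ler_norm_sum _ _ _) _.
  apply: ler_sum => w' _; rewrite normrM ger0_norm ?mulr_ge0 //.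
  by rewrite ler_wpM2l ?mulr_ge0.
under eq_bigr do rewrite -mulr_suml -mulr_sumr rs -mulrA.
by rewrite -mulr_suml rs.
Qed.

Lemma osc_ce i f d : osc f d -> osc (E i f) (spread beta i d).
Proof.
move=> [d0 fd]; split=> [j|j x w]; rewrite /spread.
  by case: eqP => // _; rewrite addr_ge0 // !mulr_ge0 // (beta_ge0 kK).
case: eqP => [->|/eqP ji]; first by rewrite (ce_upd kK) subrr normr0.
have ij : i != j by rewrite eq_sym.
have e : E i f (upd x j w) - E i f x =
  (\sum_w' k i (upd x j w) w' * (f (upd (upd x i w') j w) - f (upd x i w'))) +
  (\sum_w' k i (upd x j w) w' * f (upd x i w') - \sum_w' k i x w' * f (upd x i w')).
  rewrite addrA -big_split /=; congr (_ - _); apply: eq_bigr => w' _.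
  by rewrite -(updC x w' w ij); ring.
rewrite e; apply: le_trans (ler_normD _ _) _; apply: lerD.
  apply: le_trans (ler_norm_sum _ _ _) _.
  rewrite -[leRHS]mul1r -(k_sum kK i (upd x j w)) mulr_suml.
  apply: ler_sum => w' _; rewrite normrM ger0_norm ?(k_ge0 kK) //.
  by rewrite ler_wpM2l ?(k_ge0 kK).
have [ijadj|nadj] := boolP (adj i j).
  rewrite mul1r; apply: kernel_diff_le => // w1 w2.
  by have := fd i (upd x i w2) w1; rewrite upd_upd.
rewrite !mul0r; under eq_bigr do rewrite (k_upd_nonadj kK) //.
by rewrite subrr normr0.
Qed.

Lemma ce_osc_dist i f d x : osc f d -> `|f x - E i f x| <= d i.
Proof.
move=> [d0 fd].
have -> : f x - E i f x = \sum_w k i x w * (f x - f (upd x i w)).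
  under [RHS]eq_bigr do rewrite mulrBr.
  by rewrite sumrB -mulr_suml (k_sum kK) mul1r.
apply: le_trans (ler_norm_sum _ _ _) _.
rewrite -[leRHS]mul1r -(k_sum kK i x) mulr_suml; apply: ler_sum => w _.
by rewrite normrM ger0_norm ?(k_ge0 kK) // ler_wpM2l ?(k_ge0 kK) // distrC.
Qed.

(** The distribution obtained from [p] by drawing the symbol at [i] anew from the
    kernel. *)
Definition resampled (p : conf -> R) i x : R := k i x (x i) * \sum_w p (upd x i w).

Lemma ex_resampled p i f : ex (resampled p i) f = ex p (E i f).
Proof.
rewrite /ex /ce; under [RHS]eq_bigr do rewrite mulr_sumr.
rewrite (sum_upd_swap i (fun x w y => p x * (k i x w * f y))).
apply: eq_bigr => x _; rewrite /resampled mulr_sumr mulr_suml.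
by apply: eq_bigr => w _; rewrite (k_upd kK); ring.
Qed.

(** Since [p] and its resampling integrate [E i f] equally, [f] may be replaced by
    [f - E i f], which the oscillation at [i] bounds. *)
Lemma ex_ce_dist p i f d : osc f d ->
  `|ex p f - ex p (E i f)| <= (\sum_x `|p x - resampled p i x|) * d i.
Proof.
move=> fd.
have -> : ex p f - ex p (E i f) =
   \sum_x (p x - resampled p i x) * (f x - E i f x).
  have h : ex p (E i f) = ex (resampled p i) (E i f).
    by rewrite ex_resampled; apply: eq_ex => x; rewrite (ce_idem kK).
  have -> : \sum_x (p x - resampled p i x) * (f x - E i f x) =
    ex p f - ex (resampled p i) f - (ex p (E i f) - ex (resampled p i) (E i f)).
    by rewrite /ex -!sumrB; apply: eq_bigr => x _; ring.
  by rewrite ex_resampled h subrr subr0.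
apply: le_trans (ler_norm_sum _ _ _) _; rewrite mulr_suml; apply: ler_sum => x _.
by rewrite normrM ler_wpM2l //; exact: ce_osc_dist.
Qed.

(** [controls p mu e] is the dual form of: [p] and [mu] have a coupling in which
    site [j] disagrees with probability at most [e j]. *)
Definition controls (p mu : conf -> R) (e : V -> R) : Prop :=
  forall f d, osc f d -> `|ex p f - ex mu f| <= \sum_j e j * d j.

Lemma controls_le p mu e e' : (forall j, e j <= e' j) ->
  controls p mu e -> controls p mu e'.
Proof.
move=> ee h f d fd; apply: le_trans (h f d fd) _; apply: ler_sum => j _.
by rewrite ler_wpM2r ?(proj1 fd).
Qed.

(** Under [mu], averaging [f] at [i] changes nothing; under [p] it costs [t] times the
    oscillation at [i]. The averaged function has the oscillations [spread], and
    transposing this gives the new vector. *)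
Lemma controls_step p mu e i t :
  (forall f, ex mu (E i f) = ex mu f) -> controls p mu e ->
  \sum_x `|p x - resampled p i x| <= t ->
  controls p mu (fun j => if j == i then t + \sum_l (adj i l)%:R * beta * e l else e j).
Proof.
move=> mui pe tp f d fd.
have -> : ex p f - ex mu f = (ex p f - ex p (E i f)) + (ex p (E i f) - ex mu (E i f)).
  by rewrite mui; ring.
apply: le_trans (ler_normD _ _) _.
apply: le_trans (lerD (ex_ce_dist p i fd) (pe _ _ (osc_ce i fd))) _.
rewrite (bigD1 i) //= [leRHS](bigD1 i) //= eqxx /spread eqxx mulr0 add0r.
rewrite mulrDl -addrA lerD //; first by rewrite ler_wpM2r ?(proj1 fd).
rewrite mulr_suml [X in _ <= X + _](bigD1 i) //= (negbTE (adj_irr kK i)) !mul0r add0r.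
rewrite -big_split /=; apply: ler_sum => j ji; rewrite (negbTE ji).
by rewrite le_eqVlt; apply/orP; left; apply/eqP; ring.
Qed.

Section Iteration.
(* The pinned sites, outside [free], agree under both measures. *)
Variables (free : pred V) (t : V -> R) (c : R).
Hypothesis t_ge0 : forall i, 0 <= t i.
Hypothesis t_le : forall i, t i <= c * (1 - D%:R * beta).

Definition relax (e : V -> R) i : R :=
  if free i then t i + \sum_j (adj i j)%:R * beta * e j else 0.

Definition bound m := iter m relax (fun i => if free i then c else 0).

Lemma sum_adj_le i (e : V -> R) (a : R) : 0 <= a -> (forall j, e j <= a) ->
  \sum_j (adj i j)%:R * beta * e j <= D%:R * beta * a.
Proof.
move=> a0 ea.
apply: le_trans (_ : \sum_j (adj i j)%:R * (beta * a) <= _).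
  apply: ler_sum => j _; rewrite -mulrA ler_wpM2l // ler_wpM2l //.
  exact: (beta_ge0 kK).
rewrite -mulr_suml -mulrA ler_wpM2r ?mulr_ge0 ?(beta_ge0 kK) //.
rewrite -natr_sum ler_nat; apply: leq_trans (adj_deg kK i).
by rewrite -sum1_card [leqRHS]big_mkcond /=; apply: leq_sum => j _; rewrite inE; case: adj.
Qed.

Lemma c_ge0 (i : V) : 0 <= c.
Proof.
have h := le_trans (t_ge0 i) (t_le i).
by rewrite -(pmulr_lge0 _ (x := 1 - D%:R * beta)) // subr_gt0 (subcritical kK).
Qed.

Lemma bound_ge0 m i : 0 <= bound m i.
Proof.
elim: m i => [|m IH] i /=; rewrite /relax; case: ifP => // _; first exact: (c_ge0 i).
by rewrite addr_ge0 // sumr_ge0 // => j _; rewrite !mulr_ge0 ?(beta_ge0 kK).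
Qed.

Lemma relax_mono e e' : (forall j, e j <= e' j) -> forall i, relax e i <= relax e' i.
Proof.
move=> ee i; rewrite /relax; case: ifP => // _; rewrite lerD2l; apply: ler_sum => j _.
by rewrite ler_wpM2l // mulr_ge0 // (beta_ge0 kK).
Qed.

Lemma bound_anti m i : bound m.+1 i <= bound m i.
Proof.
elim: m i => [|m IH] i; last exact: relax_mono.
rewrite /= /relax; case: ifP => // _.
have := @sum_adj_le i (fun j => if free j then c else 0) c (c_ge0 i).
have c0 := c_ge0 i; have hi := t_le i.
move=> /(_ (fun j => ltac:(by case: ifP))) h; lra.
Qed.

(** Dobrushin's comparison. A round relaxes the bound at the sites one after the
    other; as the iterates of [relax] decrease, the entries that have been relaxed
    already may be replaced by their values before the round. *)
Lemma controls_bound p mu :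
  (forall i, free i -> forall f, ex mu (E i f) = ex mu f) ->
  (forall i, free i -> \sum_x `|p x - resampled p i x| <= t i) ->
  controls p mu (bound 0) -> forall m, controls p mu (bound m).
Proof.
move=> muE tp h0; elim=> [//|m IH].
have hs (s : seq V) : controls p mu (fun j => if j \in s then bound m.+1 j else bound m j).
  elim: s => [|i s IHs]; first by apply: controls_le IH => j.
  have [ifree|inf] := boolP (free i).
    have := controls_step (muE i ifree) IHs (tp i ifree).
    apply: controls_le => j; rewrite in_cons; have [->|] //= := eqVneq j i.
    rewrite /relax ifree lerD2l; apply: ler_sum => l _.
    rewrite ler_wpM2l ?mulr_ge0 ?(beta_ge0 kK) //; case: ifP => // _; exact: bound_anti.
  apply: controls_le IHs => j; rewrite in_cons; have [->|] //= := eqVneq j i.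
  have b0 q : bound q i = 0 by case: q => [|q] /=; rewrite /relax (negbTE inf).
  by rewrite (b0 m) /relax (negbTE inf) if_same.
by apply: controls_le (hs (enum V)) => j; rewrite mem_enum.
Qed.

Let th := (1 + D%:R * beta) / 2.

(** In mean square the interaction term contracts by [th]: by convexity of the square
    each row and, the interaction being symmetric, each column of it has weight at
    most [D%:R * beta]. *)
Lemma bound_sqr m :
  \sum_i bound m.+1 i ^+ 2 <=
  (\sum_i t i ^+ 2) / (1 - th) + th * \sum_i bound m i ^+ 2.
Proof.
have d0 : 0 <= D%:R * beta by rewrite mulr_ge0 ?(beta_ge0 kK).
have d1 : D%:R * beta < 1 := subcritical kK.
have th1 : 0 < 1 - th by rewrite /th; lra.
have th0 : 0 < th by rewrite /th; lra.
have dth : D%:R * beta <= th by rewrite /th; lra.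
pose A i := \sum_j (adj i j)%:R * beta * bound m j.
have A0 i : 0 <= A i.
  by apply: sumr_ge0 => j _; rewrite !mulr_ge0 ?(beta_ge0 kK) ?bound_ge0.
apply: le_trans (_ : \sum_i (t i ^+ 2 / (1 - th) + A i ^+ 2 / th) <= _).
  apply: ler_sum => i _; apply: le_trans (_ : (t i + A i) ^+ 2 <= _).
    rewrite /= /relax; case: ifP => _; last by rewrite expr0n sqr_ge0.
    by rewrite -/(A i).
  rewrite -subr_ge0.
  have -> : t i ^+ 2 / (1 - th) + A i ^+ 2 / th - (t i + A i) ^+ 2 =
     (th * t i - (1 - th) * A i) ^+ 2 / ((1 - th) * th).
    field; apply/andP; split; lra.
  by apply: divr_ge0; [exact: sqr_ge0|apply: mulr_ge0; exact: ltW].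
rewrite big_split /= -!mulr_suml lerD2l ler_pdivrMr //.
have AS i : A i ^+ 2 <= th * \sum_j (adj i j)%:R * beta * bound m j ^+ 2.
  have sd : \sum_j (adj i j)%:R * beta <= th.
    have := @sum_adj_le i (fun=> 1) 1 ler01 (fun=> lexx 1).
    by under eq_bigr do rewrite mulr1; rewrite mulr1 => h; apply: le_trans h dth.
  pose s := \sum_j (adj i j)%:R * beta.
  have q u : 0 <= \sum_j (adj i j)%:R * beta * (u - bound m j) ^+ 2.
    apply: sumr_ge0 => j _; apply: mulr_ge0; last exact: sqr_ge0.
    by rewrite mulr_ge0 // (beta_ge0 kK).
  have e u : \sum_j (adj i j)%:R * beta * (u - bound m j) ^+ 2 =
     u ^+ 2 * s - 2 * u * A i + \sum_j (adj i j)%:R * beta * bound m j ^+ 2.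
    rewrite /s /A !mulr_sumr -sumrB -big_split /=; apply: eq_bigr => j _; ring.
  have := q (A i / th); rewrite e => h.
  have : 0 <= (A i / th) ^+ 2 * th - 2 * (A i / th) * A i + \sum_j (adj i j)%:R * beta * bound m j ^+ 2.
    apply: le_trans h _; rewrite lerD2r lerD2r ler_wpM2l ?sqr_ge0 //.
  have -> : (A i / th) ^+ 2 * th - 2 * (A i / th) * A i = - (A i ^+ 2 / th) by field; lra.
  by rewrite addrC subr_ge0 ler_pdivrMr // mulrC.
apply: le_trans (ler_sum _ (fun i _ => AS i)) _.
rewrite -[leLHS]mulr_sumr -[leRHS]mulrA ler_wpM2l ?(ltW th0) // [leRHS]mulrC exchange_big /=.
rewrite mulr_sumr; apply: ler_sum => j _.
rewrite -mulr_suml ler_wpM2r ?sqr_ge0 //.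
have := @sum_adj_le j (fun=> 1) 1 ler01 (fun=> lexx 1).
under eq_bigr do rewrite mulr1; rewrite mulr1 => h; apply: le_trans (le_trans h dth).
by rewrite le_eqVlt; apply/orP; left; apply/eqP; apply: eq_bigr => i _; rewrite (adj_sym kK).
Qed.

Lemma bound_sqr_limit (a : V -> R) :
  (forall i, 0 <= a i) -> (forall m i, a i <= bound m i) ->
  \sum_i a i ^+ 2 <= (\sum_i t i ^+ 2) / (1 - th) ^+ 2.
Proof.
move=> a0 ab.
have d0 : 0 <= D%:R * beta by rewrite mulr_ge0 ?(beta_ge0 kK).
have d1 : D%:R * beta < 1 := subcritical kK.
have th1 : 0 < 1 - th by rewrite /th; lra.
have th0 : 0 < th by rewrite /th; lra.
set T := \sum_i t i ^+ 2.
have T0 : 0 <= T by apply: sumr_ge0 => i _; rewrite sqr_ge0.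
have S m : \sum_i bound m i ^+ 2 <= T / (1 - th) ^+ 2 + (\sum_i bound 0 i ^+ 2) * th ^+ m.
  elim: m => [|m IH]; first by rewrite expr0 mulr1 lerDr divr_ge0 // sqr_ge0.
  apply: le_trans (bound_sqr m) _.
  apply: le_trans (lerD (lexx _) (ler_wpM2l (ltW th0) IH)) _.
  rewrite -/T [th ^+ m.+1]exprS; move: (th ^+ m) => u; rewrite le_eqVlt; apply/orP; left; apply/eqP; field; lra.
apply: (@le_geometric_limit _ _ _ (\sum_i bound 0 i ^+ 2) th).
  by rewrite ltW //= -subr_gt0.
move=> m; apply: le_trans (S m); apply: ler_sum => i _.
by rewrite lerXn2r ?nnegrE ?bound_ge0.
Qed.

End Iteration.
End Kernel.
End Comparison.

(** * Relative entropy *)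

Section Entropy.
Context {R : realType}.

Lemma ln_le_sub1 (x : R) : 0 < x -> ln x <= x - 1.
Proof.
move=> x0; have e : 1 + (x - 1) = x by ring.
by rewrite -{1}e le_ln1Dx //; lra.
Qed.

Definition kl (T : finType) (a b : T -> R) := \sum_x a x * ln (a x / b x).

Section Pinsker.
Variables (T : finType) (a b : T -> R).
Hypotheses (a_distr : distribution a) (b_distr : distribution b).
Hypothesis a_ll_b : forall x, b x = 0 -> a x = 0.

(** Pinsker's inequality, up to the constant: the relative entropy dominates the
    squared Hellinger distance because [ln u <= u - 1], and the total variation
    is compared with the latter by Cauchy--Schwarz. *)
Lemma pinsker : (\sum_x `|a x - b x|) ^+ 2 <= 4 * kl a b.
Proof.
have a0 := distr_ge0 a_distr; have b0 := distr_ge0 b_distr.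
pose u x := Num.sqrt (a x); pose v x := Num.sqrt (b x).
have u2 x : u x ^+ 2 = a x by rewrite sqr_sqrtr.
have v2 x : v x ^+ 2 = b x by rewrite sqr_sqrtr.
have u0 x : 0 <= u x by exact: sqrtr_ge0.
have v0 x : 0 <= v x by exact: sqrtr_ge0.
have hell : \sum_x (u x - v x) ^+ 2 <= kl a b.
  apply: le_trans (_ : \sum_x (2 * a x - 2 * (u x * v x)) <= _).
    have -> : \sum_x (2 * a x - 2 * (u x * v x)) =
              \sum_x (u x - v x) ^+ 2 + (\sum_x a x - \sum_x b x).
      rewrite -sumrB -big_split /=; apply: eq_bigr => x _.
      by rewrite -u2 -v2; ring.
    by rewrite (distr_sum a_distr) (distr_sum b_distr) subrr addr0.
  apply: ler_sum => x _; have [ax|ax] := eqVneq (a x) 0.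
    by rewrite /u ax sqrtr0 !(mul0r, mulr0, subr0).
  have ap : 0 < a x by rewrite lt_def ax a0.
  have bp : 0 < b x.
    by rewrite lt_def b0 andbT; apply: contra_neq ax; exact: a_ll_b.
  have up : 0 < u x by rewrite sqrtr_gt0.
  have vp : 0 < v x by rewrite sqrtr_gt0.
  have -> : ln (a x / b x) = - (ln (v x / u x) *+ 2).
    rewrite -lnXn ?divr_gt0 // expr_div_n u2 v2 -lnV ?posrE ?divr_gt0 //.
    by rewrite invf_div.
  have h := ln_le_sub1 (divr_gt0 vp up).
  have -> : 2 * a x - 2 * (u x * v x) = a x * - ((v x / u x - 1) *+ 2).
    by rewrite -u2; field; exact: lt0r_neq0.
  by rewrite ler_wpM2l // lerN2 lerMn2r h orbT.
have CS : (\sum_x `|a x - b x|) ^+ 2 <=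
    (\sum_x (u x - v x) ^+ 2) * \sum_x (u x + v x) ^+ 2.
  pose S1 := \sum_x (u x - v x) ^+ 2; pose S2 := \sum_x (u x + v x) ^+ 2.
  pose m := \sum_x `|a x - b x|.
  have q s t : 0 <= s ^+ 2 * S1 - 2 * s * t * m + t ^+ 2 * S2.
    have -> : s ^+ 2 * S1 - 2 * s * t * m + t ^+ 2 * S2 =
       \sum_x (s * `|u x - v x| - t * (u x + v x)) ^+ 2.
      rewrite /S1 /S2 /m !mulr_sumr -sumrB -big_split /=; apply: eq_bigr => x _.
      have -> : `|a x - b x| = `|u x - v x| * (u x + v x).
        rewrite -u2 -v2 subr_sqr normrM [X in _ * X]ger0_norm //.
        by rewrite addr_ge0.
      by rewrite -[(u x - v x) ^+ 2]real_normK ?num_real //; ring.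
    by apply: sumr_ge0 => x _; exact: sqr_ge0.
  have S20 : 0 <= S2 by apply: sumr_ge0 => x _; exact: sqr_ge0.
  have S2p : 0 < S2.
    rewrite lt_def S20 andbT; apply: contraTneq (ltr01 (R := R)) => S2z.
    rewrite -(distr_sum a_distr) big1 ?ltxx // => x _.
    move/eqP: S2z; rewrite psumr_eq0 => [/allP/(_ x)|y _]; last exact: sqr_ge0.
    rewrite mem_index_enum => /(_ isT); rewrite sqrf_eq0 paddr_eq0 //.
    by move=> /andP[/eqP ux _]; rewrite -u2 ux expr0n.
  have h := q S2 m.
  have : 0 <= S2 * (S1 * S2 - m ^+ 2).
    by apply: le_trans h _; rewrite le_eqVlt; apply/orP; left; apply/eqP; ring.
  by rewrite pmulr_rge0 // subr_ge0.
apply: le_trans CS _; rewrite [leRHS]mulrC ler_pM //.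
- by apply: sumr_ge0 => x _; exact: sqr_ge0.
- by apply: sumr_ge0 => x _; exact: sqr_ge0.
have -> : 4 = 2 * (\sum_x a x + \sum_x b x) :> R by rewrite (distr_sum a_distr) (distr_sum b_distr); ring.
rewrite -big_split mulr_sumr /=; apply: ler_sum => x _.
rewrite -u2 -v2 -subr_ge0.
have -> : 2 * (u x ^+ 2 + v x ^+ 2) - (u x + v x) ^+ 2 = (u x - v x) ^+ 2 by ring.
exact: sqr_ge0.
Qed.

(** The converse direction costs the smallest positive atom of [b]. *)
Lemma kl_le_atom (c : R) : 0 < c -> (forall x, b x = 0 \/ c <= b x) ->
  kl a b <= c^-1 * \sum_x (a x - b x) ^+ 2.
Proof.
move=> c0 bc.
have a0 := distr_ge0 a_distr; have b0 := distr_ge0 b_distr.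
apply: le_trans (_ : \sum_x (c^-1 * (a x - b x) ^+ 2 + (a x - b x)) <= _); last first.
  by rewrite big_split /= sumrB (distr_sum a_distr) (distr_sum b_distr) subrr addr0 mulr_sumr.
apply: ler_sum => x _; have [ax|ax] := eqVneq (a x) 0.
  rewrite ax mul0r sub0r sqrrN; case: (bc x) => [->|cb].
    by rewrite expr0n mulr0 subr0.
  rewrite subr_ge0 expr2 mulrA ler_peMl // mulrC ler_pdivlMr //; lra.
have ap : 0 < a x by rewrite lt_def ax a0.
have bp : 0 < b x.
  by rewrite lt_def b0 andbT; apply: contra_neq ax; exact: a_ll_b.
have cb : c <= b x by case: (bc x) => // h; move: bp; rewrite h ltxx.
apply: le_trans (_ : a x * (a x / b x - 1) <= _).
  by rewrite ler_wpM2l // ln_le_sub1 // divr_gt0.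
have -> : a x * (a x / b x - 1) = (b x)^-1 * (a x - b x) ^+ 2 + (a x - b x).
  by field; exact: lt0r_neq0.
by rewrite lerD2r ler_wpM2r ?sqr_ge0 // lef_pV2 ?posrE.
Qed.

End Pinsker.
End Entropy.

Section Pinning.
Context {R : realType} {V W : finType}.
Notation conf := {ffun V -> W}.
Implicit Types (f g : conf -> R) (x y eta : conf) (i j : V) (w : W) (S : {set V}).

Definition pin S eta : pred conf := fun x => [forall i in S, x i == eta i].

Lemma pinP S eta x : reflect (forall i, i \in S -> x i = eta i) (pin S eta x).
Proof.
by apply: (iffP forall_inP) => h i iS; [apply/eqP; exact: h|apply/eqP; exact: h].
Qed.

Lemma pin_upd S eta x i w : i \notin S -> pin S eta (upd x i w) = pin S eta x.
Proof.
move=> iS; apply/pinP/pinP => h j jS; rewrite -(h j jS) upd_off //;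
  by apply: contraNneq iS => <-.
Qed.

Lemma pinU1 S eta x i w : i \notin S ->
  pin (i |: S) (upd eta i w) x = pin S eta x && (x i == w).
Proof.
move=> iS; apply/pinP/andP => [h|[/pinP h /eqP xi] j]; first split.
- apply/pinP => j jS; rewrite h ?in_setU1 ?jS ?orbT // upd_off //.
  by apply: contraNneq iS => <-.
- by rewrite h ?setU11 // upd_at.
rewrite in_setU1; have [->|ji] := eqVneq j i; first by rewrite upd_at.
by move=> /= jS; rewrite upd_off // h.
Qed.

Lemma sum_pinU1 S eta i (G : conf -> R) : i \notin S ->
  \sum_(x | pin S eta x) G x = \sum_w \sum_(x | pin (i |: S) (upd eta i w) x) G x.
Proof.
move=> iS; rewrite (partition_big (fun x : conf => x i) xpredT) //=.
by apply: eq_bigr => w _; apply: eq_bigl => x; rewrite pinU1.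
Qed.

Definition mass (p : conf -> R) S eta := \sum_(x | pin S eta x) p x.

(** Walking from [x] to [y] one site at a time. *)
Lemma osc_dist f d x y : osc f d -> `|f y - f x| <= \sum_(j | x j != y j) d j.
Proof.
move=> [d0 fd].
pose z (s : seq V) : conf := [ffun j => if j \in s then y j else x j].
have zs s : uniq s -> `|f (z s) - f x| <= \sum_(j <- s | x j != y j) d j.
  elim: s => [|i s IH] /=.
    move=> _; have -> : z [::] = x by apply/ffunP => j; rewrite ffunE.
    by rewrite subrr normr0 big_nil.
  move=> /andP[is_ us]; rewrite big_cons.
  have zi : z (i :: s) = upd (z s) i (y i).
    by apply/ffunP => j; rewrite !ffunE in_cons; case: eqP => [->|].
  have xi : z s i = x i by rewrite ffunE (negbTE is_).
  case: eqP => [e|_] /=.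
    by rewrite zi -e -xi upd_self; exact: IH.
  have -> : f (z (i :: s)) - f x = (f (z (i :: s)) - f (z s)) + (f (z s) - f x) by ring.
  apply: le_trans (ler_normD _ _) _; apply: lerD; last exact: IH.
  by rewrite zi.
have -> : y = z (enum V) by apply/ffunP => j; rewrite ffunE mem_enum.
apply: le_trans (zs _ (enum_uniq V)) _.
rewrite big_enum_cond /= le_eqVlt; apply/orP; left; apply/eqP.
by apply: eq_bigl => j; rewrite !ffunE mem_enum.
Qed.

Section Kernel.
Variables (adj : rel V) (D : nat) (beta alpha : R) (k : V -> conf -> W -> R).
Hypothesis kK : kernel adj D beta alpha k.
Variables (mu : conf -> R) (mu_distr : distribution mu).
Hypothesis mu_rev : forall i, reversible k i mu.

(** The high-noise condition provides, at each site, a symbol that no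
    neighbourhood forbids. *)
Lemma safe_symbol i : exists w, forall x, alpha <= k i x w.
Proof.
have [gam [gs gk]] := k_minor kK i.
have [w gw] : exists w, 0 < gam w.
  apply/existsP; rewrite -[X in is_true X]negbK negb_exists; apply/forallP => h.
  have : \sum_w gam w <= 0.
    by apply: sumr_le0 => w _; rewrite leNgt; exact: h.
  by have := beta_lt1 kK; lra.
exists w => x; case: (k_atom kK i x w) => // e.
by have := gk x w; rewrite e; lra.
Qed.

Lemma mu_k_mass i x : mu x = k i x (x i) * \sum_w mu (upd x i w).
Proof.
rewrite -[LHS]mulr1 -(k_sum kK i x) mulr_sumr mulr_sumr.
by apply: eq_bigr => w _; rewrite mu_rev mulrC.
Qed.

Lemma mu_gt0_upd i x w : 0 < mu x -> alpha <= k i x w -> 0 < mu (upd x i w).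
Proof.
move=> mx kw; have kp : 0 < k i x w by apply: lt_le_trans kw; exact: (alpha_gt0 kK).
have := mulr_gt0 mx kp; rewrite mu_rev.
rewrite lt_def => /andP[+ _]; rewrite mulf_eq0 negb_or => /andP[+ _].
by rewrite lt_def distr_ge0 // andbT.
Qed.

Lemma alpha_le1 i x w : alpha <= k i x w -> alpha <= 1.
Proof.
move=> h; apply: le_trans h _; rewrite -(k_sum kK i x) (bigD1 w) //= lerDl.
by apply: sumr_ge0 => w' _; rewrite (k_ge0 kK).
Qed.

(** Whatever the surroundings, each site of [s] is at its safe symbol with
    conditional probability at least [alpha]; these factors multiply along [s]. *)
Lemma safe_mass (s : seq V) (w0 : V -> W) (Q : pred conf) :
  (forall i x, alpha <= k i x (w0 i)) -> uniq s ->
  (forall i x w, i \in s -> Q (upd x i w) = Q x) ->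
  alpha ^+ size s * \sum_(x | Q x) mu x <=
  \sum_(x | Q x && all (fun i => x i == w0 i) s) mu x.
Proof.
move=> w0P; elim: s Q => [|i s IH] Q us Qs /=.
  by rewrite expr0 mul1r; under [leRHS]eq_bigl do rewrite andbT.
move: us => /= /andP[nis us].
under [leRHS]eq_bigl do rewrite andbA.
apply: le_trans (IH (fun x => Q x && (x i == w0 i)) us _); last first.
  move=> j x w js; rewrite Qs ?in_cons ?js ?orbT // upd_off //.
  by apply: contraNneq nis => ->.
rewrite exprSr -mulrA ler_wpM2l ?exprn_ge0 ?(ltW (alpha_gt0 kK)) //.
have -> : \sum_(x | Q x && (x i == w0 i)) mu x = ex mu (fun x => (Q x)%:R * (x i == w0 i)%:R).
  rewrite /ex big_mkcond /=; apply: eq_bigr => x _.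
  by case: (Q x); case: (x i == _); rewrite /= ?mul1r ?mul0r ?mulr1 ?mulr0.
rewrite -(ex_ce kK (i := i)) // mulr_sumr big_mkcond /=; apply: ler_sum => x _.
rewrite (ce_mull k _ (g := fun x => (Q x)%:R)) => [|y w]; last by rewrite Qs ?mem_head.
rewrite mulrCA -[X in X <= _]mulr1; case: (Q x); last by rewrite !mul0r.
rewrite mul1r mulr1 mulrC ler_wpM2l ?distr_ge0 //.
rewrite /ce (bigD1 (w0 i)) //= upd_at eqxx mulr1.
apply: le_trans (w0P i x) _; rewrite lerDl; apply: sumr_ge0 => w _.
by rewrite mulr_ge0 ?(k_ge0 kK).
Qed.

(** Pinning keeps marginals bounded below: a possible symbol at [i] remains
    possible after its free neighbours have been moved to safe symbols, and that
    environment has probability at least [alpha ^+ D]. *)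
Lemma pinned_marginal S eta i w : i \notin S ->
  mass mu (i |: S) (upd eta i w) = 0 \/
  alpha ^+ D.+1 * mass mu S eta <= mass mu (i |: S) (upd eta i w).
Proof.
move=> iS; set P := mass mu (i |: S) _.
have P0 : 0 <= P by apply: sumr_ge0 => x _; exact: distr_ge0.
have [->|Pn] := eqVneq P 0; [by left|right].
have [x [/andP[px /eqP xi] mx]] : exists x, pin S eta x && (x i == w) /\ 0 < mu x.
  have /eqP : P <> 0 by apply/eqP.
  rewrite psumr_neq0 => [/hasP[x _ /andP[h mx]]|x _]; last exact: distr_ge0.
  by exists x; rewrite -pinU1.
have [w0 w0P] := choice safe_symbol.
pose s := [seq j <- enum V | adj i j & j \notin S].
have sP j : j \in s = adj i j && (j \notin S) by rewrite mem_filter mem_enum andbT.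
have us : uniq s by rewrite filter_uniq // enum_uniq.
have al1 : alpha <= 1 := alpha_le1 (w0P i x).
have al0 := alpha_gt0 kK.
have szs : (size s <= D)%N.
  apply: leq_trans (adj_deg kK i); rewrite cardE -[size s]/(size _) uniq_leq_size //.
  by move=> j; rewrite sP mem_enum inE => /andP[].
pose y := foldr (fun j z => upd z j (w0 j)) x s.
have yE j : y j = if j \in s then w0 j else x j.
  rewrite /y; elim: (s) => [//|l r IH] /=; rewrite ffunE in_cons.
  by case: eqP => [->|].
have my : 0 < mu y.
  by rewrite /y; elim: (s) => [//|l r IH] /=; apply: mu_gt0_upd => //; exact: w0P.
have yi : y i = w by rewrite yE sP (negbTE (adj_irr kK i)).
have yS j : j \in S -> y j = eta j.
  by move=> jS; rewrite yE sP jS andbF; exact: (pinP _ _ _ px).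
have ky : alpha <= k i y w.
  case: (k_atom kK i y w) => // h.
  by move: my; rewrite (mu_k_mass i) yi h mul0r ltxx.
pose A z := pin S eta z && all (fun j => z j == w0 j) s.
have Ai z w' : A (upd z i w') = A z.
  rewrite /A pin_upd //; congr (_ && _); apply: eq_in_all => j js.
  rewrite upd_off //; move: js; rewrite sP => /andP[/(adj_neq kK)].
  by rewrite eq_sym.
have kA z : A z -> alpha <= k i z w.
  move=> /andP[/pinP zS /allP zs]; rewrite (k_loc kK (y := y)) // => j ij.
  have [jS|jS] := boolP (j \in S); first by rewrite zS // yS.
  by rewrite yE sP ij jS; apply/eqP/zs; rewrite sP ij jS.
apply: le_trans (_ : alpha * \sum_(z | A z) mu z <= _).
  rewrite exprS -mulrA ler_wpM2l ?(ltW al0) //.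
  apply: le_trans (safe_mass w0P us _); last first.
    by move=> j z w'; rewrite sP => /andP[_]; exact: pin_upd.
  rewrite ler_wpM2r //; first by apply: sumr_ge0 => z _; exact: distr_ge0.
  by apply: ler_wiXn2l; rewrite ?(ltW al0).
apply: le_trans (_ : \sum_(z | A z && (z i == w)) mu z <= _); last first.
  rewrite /P /mass [leLHS]big_mkcond [leRHS]big_mkcond /=; apply: ler_sum => z _.
  rewrite pinU1 // /A; case: (pin S eta z) => //=; case: (z i == w); rewrite ?andbF ?andbT //.
  by case: ifP => // _; exact: distr_ge0.
have -> : \sum_(z | A z && (z i == w)) mu z = ex mu (fun z => (A z)%:R * (z i == w)%:R).
  rewrite /ex big_mkcond /=; apply: eq_bigr => z _.
  by case: (A z); case: (z i == _); rewrite /= ?mul1r ?mul0r ?mulr1 ?mulr0.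
rewrite -(ex_ce kK (i := i)) // mulr_sumr big_mkcond /=; apply: ler_sum => z _.
rewrite (ce_mull k _ (g := fun z => (A z)%:R)) => [|u w']; last by rewrite Ai.
case: ifP => Az; last by rewrite mul0r mulr0.
rewrite mul1r mulrC ler_wpM2l ?distr_ge0 //.
rewrite /ce (bigD1 w) //= upd_at eqxx mulr1.
apply: le_trans (kA z Az) _; rewrite lerDl; apply: sumr_ge0 => w' _.
by rewrite mulr_ge0 ?(k_ge0 kK).
Qed.

End Kernel.
End Pinning.

(** * Approximate tensorization of entropy *)

Section Tensorization.
Context {R : realType} {V W : finType}.
Notation conf := {ffun V -> W}.
Implicit Types (f g : conf -> R) (x y eta : conf) (i j : V) (w : W) (S : {set V}).
Variables (adj : rel V) (D : nat) (beta alpha : R) (k : V -> conf -> W -> R).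
Hypothesis kK : kernel adj D beta alpha k.
Variables (mu : conf -> R) (mu_distr : distribution mu).
Hypothesis mu_rev : forall i, reversible k i mu.
Variables (p : conf -> R) (p_ge0 : forall x, 0 <= p x).
Hypothesis p_ll_mu : forall x, mu x = 0 -> p x = 0.

Let mu_ge0 := distr_ge0 mu_distr.

(** Relative entropy of [p] with respect to [mu] given the pinning, weighted by
    the mass that [p] gives to it. *)
Definition pinned_entropy S eta : R :=
  \sum_(x | pin S eta x) p x * ln (p x / mu x) -
  mass p S eta * ln (mass p S eta / mass mu S eta).

(** Relative entropy of the conditional distributions at [i] given all the other
    sites, averaged under [p] over the configurations that satisfy the pinning. *)
Definition site_entropy i S eta : R :=
  \sum_(x | pin S eta x) p x *
    (ln (p x / mu x) - ln ((\sum_w p (upd x i w)) / \sum_w mu (upd x i w))).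

(** Relative entropy of the marginals at [i] given the pinning, with the weight of
    [pinned_entropy]. *)
Definition marginal_entropy i S eta : R :=
  \sum_w mass p (i |: S) (upd eta i w) *
    ln (mass p (i |: S) (upd eta i w) / mass mu (i |: S) (upd eta i w)) -
  mass p S eta * ln (mass p S eta / mass mu S eta).

Lemma entropy_chain i S eta : i \notin S ->
  pinned_entropy S eta =
  \sum_w pinned_entropy (i |: S) (upd eta i w) + marginal_entropy i S eta.
Proof.
move=> iS; rewrite /pinned_entropy /marginal_entropy (sum_pinU1 _ _ iS).
by rewrite sumrB; ring.
Qed.

Lemma site_entropy_sum i j S eta : i \notin S ->
  \sum_w site_entropy j (i |: S) (upd eta i w) = site_entropy j S eta.
Proof. by move=> iS; rewrite /site_entropy [RHS](sum_pinU1 _ _ iS). Qed.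

Lemma mass_ge0 (q : conf -> R) S eta : (forall x, 0 <= q x) -> 0 <= mass q S eta.
Proof. by move=> q0; apply: sumr_ge0. Qed.

Section Pinned.
Variables (S : {set V}) (eta : conf).
Hypothesis mass_gt0 : 0 < mass p S eta.
Let pm := mass p S eta.
Let mm := mass mu S eta.

Let mm_gt0 : 0 < mm.
Proof.
rewrite lt_def mass_ge0 // andbT; apply: contraTneq mass_gt0 => mm0.
rewrite -leNgt /mass big1 // => x px; apply: p_ll_mu.
by move/eqP: mm0; rewrite psumr_eq0 // => /allP/(_ x (mem_index_enum _)); rewrite px => /eqP.
Qed.

(* [p] and [mu] conditioned on the pinning. *)
Let a x := p x * (pin S eta x)%:R / pm.
Let b x := mu x * (pin S eta x)%:R / mm.

Let sum_norm (q : conf -> R) : \sum_x q x * (pin S eta x)%:R / mass q S eta =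
  mass q S eta / mass q S eta.
Proof.
rewrite -mulr_suml /mass; congr (_ / _).
by rewrite [RHS]big_mkcond /=; apply: eq_bigr => x _; case: ifP; rewrite ?mulr1 ?mulr0.
Qed.

Let a_distr : distribution a.
Proof.
split=> [x|]; first by rewrite /a divr_ge0 ?mulr_ge0 // ltW.
by rewrite sum_norm divff // gt_eqF.
Qed.

Let b_distr : distribution b.
Proof.
split=> [x|]; first by rewrite /b divr_ge0 ?mulr_ge0 // ltW.
by rewrite sum_norm divff // gt_eqF.
Qed.

Let b_ce i f : i \notin S -> ex b (ce k i f) = ex b f.
Proof.
move=> iS.
have h q : ex b q = mm^-1 * ex mu (fun x => (pin S eta x)%:R * q x).
  by rewrite /ex mulr_sumr; apply: eq_bigr => x _; rewrite /b; ring.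
rewrite !h; congr (_ * _).
rewrite -[RHS](ex_ce kK (mu_rev i)); apply: eq_ex => x.
by rewrite (ce_mull k _ (g := fun x => (pin S eta x)%:R)) // => y w; rewrite pin_upd.
Qed.

Let tv i : R := if i \in S then 0 else \sum_x `|a x - resampled k a i x|.

Let resampled_distr i : distribution (resampled k a i).
Proof.
split=> [x|].
  rewrite /resampled mulr_ge0 ?(k_ge0 kK) //; apply: sumr_ge0 => w _.
  exact: (distr_ge0 a_distr).
have := ex_resampled kK a i (fun=> 1); rewrite /ex; under eq_bigr do rewrite mulr1.
move=> ->; under eq_bigr do rewrite (ce_cst kK) mulr1.
exact: (distr_sum a_distr).
Qed.

Let tv_ge0 i : 0 <= tv i.
Proof. by rewrite /tv; case: ifP => // _; apply: sumr_ge0. Qed.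

Let tv_le i : tv i <= 2 / (1 - D%:R * beta) * (1 - D%:R * beta).
Proof.
have d1 := subcritical kK.
rewrite divfK; last by rewrite subr_eq0 eq_sym lt_eqF.
rewrite /tv; case: ifP => // _.
have -> : 2 = \sum_x (a x + resampled k a i x).
  by rewrite big_split /= (distr_sum a_distr) (distr_sum (resampled_distr i)).
apply: ler_sum => x _; apply: le_trans (ler_normB _ _) _.
by rewrite !ger0_norm // ?(distr_ge0 a_distr) ?(distr_ge0 (resampled_distr i)).
Qed.

Let controls0 : controls a b (bound adj beta (fun i => i \notin S) tv (2 / (1 - D%:R * beta)) 0).
Proof.
move=> f d fd.
have d1 := subcritical kK.
have bd0 : 0 <= D%:R * beta by rewrite mulr_ge0 ?(beta_ge0 kK).
pose dd := \sum_(j | j \notin S) d j.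
apply: le_trans (_ : dd <= _).
  apply: (ex_diff_le (Q := pin S eta)) => // [x px|x px|x y /pinP px /pinP py].
  - by rewrite /a (negbTE px) mulr0 mul0r.
  - by rewrite /b (negbTE px) mulr0 mul0r.
  apply: le_trans (osc_dist _ _ fd) _.
  rewrite /dd [leLHS]big_mkcond [leRHS]big_mkcond /=; apply: ler_sum => j _.
  have [jS|jS] := boolP (j \in S); first by rewrite px // py // eqxx.
  by case: ifP => // _; exact: (proj1 fd).
rewrite /dd big_mkcond /=; apply: ler_sum => j _.
case: ifP => _; last by rewrite mul0r.
rewrite ler_peMl ?(proj1 fd) // ler_pdivlMr ?subr_gt0 //; lra.
Qed.

Let marg (q : conf -> R) i w : R := mass q (i |: S) (upd eta i w) / mass q S eta.

Let ex_marg (q : conf -> R) i w : i \notin S ->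
  ex (fun x => q x * (pin S eta x)%:R / mass q S eta) (fun x => (x i == w)%:R) = marg q i w.
Proof.
move=> iS; rewrite /ex /marg /mass mulr_suml [RHS]big_mkcond /=; apply: eq_bigr => x _.
rewrite pinU1 //; case: (pin S eta x); case: (x i == w); rewrite ?mulr1 ?mulr0 ?mul0r //.
Qed.

Let marg_distr (q : conf -> R) i : i \notin S -> 0 < mass q S eta ->
  (forall x, 0 <= q x) -> distribution (marg q i).
Proof.
move=> iS q1 q0; split=> [w|]; first by rewrite /marg divr_ge0 ?mass_ge0.
by rewrite -mulr_suml /mass -(sum_pinU1 _ _ iS) -/(mass q S eta) divff // gt_eqF.
Qed.

Let marg_ll i w : marg mu i w = 0 -> marg p i w = 0.
Proof.
rewrite /marg => /eqP; rewrite mulf_eq0 invr_eq0 (gt_eqF mm_gt0) orbF => /eqP m0.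
apply/eqP; rewrite mulf_eq0; apply/orP; left; apply/eqP; apply: big1 => x px.
apply: p_ll_mu; move/eqP: m0; rewrite psumr_eq0 // => /allP/(_ x (mem_index_enum _)).
by rewrite px => /eqP.
Qed.

Let free := [pred i | i \notin S].
Let c0 : R := 2 / (1 - D%:R * beta).

(** The indicator of a symbol at [i] oscillates at [i] only, so that the comparison
    bounds the difference of the marginals by its entry at [i]. *)
Let marg_diff i w m : i \notin S ->
  `|marg p i w - marg mu i w| <= bound adj beta free tv c0 m i.
Proof.
move=> iS.
have fd : osc (fun x : conf => (x i == w)%:R : R) (fun j => (j == i)%:R).
  split=> // j x w'; have [->|ji] := eqVneq j i.
    by rewrite upd_at; case: (w' == w); case: (x i == w);
      rewrite ?subrr ?subr0 ?sub0r ?normrN ?normr0 ?normr1.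
  by rewrite upd_off 1?eq_sym // subrr normr0.
have tvE j : j \notin S -> \sum_x `|a x - resampled k a j x| <= tv j.
  by move=> jS; rewrite /tv (negbTE jS).
have := controls_bound kK tv_ge0 tv_le (fun i iS f => @b_ce i f iS) tvE controls0 m fd.
rewrite !ex_marg // => h; apply: le_trans h _.
rewrite (bigD1 i) //= eqxx mulr1 big1 ?addr0 // => j ji.
by rewrite (negbTE ji) mulr0.
Qed.

Let marginal_kl i : i \notin S ->
  marginal_entropy i S eta = pm * kl (marg p i) (marg mu i).
Proof.
move=> iS; rewrite /marginal_entropy /kl mulr_sumr -/pm -/mm.
have -> : pm * ln (pm / mm) =
    \sum_w mass p (i |: S) (upd eta i w) * ln (pm / mm).
  by rewrite -mulr_suml /mass -(sum_pinU1 _ _ iS).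
rewrite -sumrB; apply: eq_bigr => w _; rewrite /marg -/pm -/mm.
set pw := mass p _ _; set mw := mass mu _ _.
have [pw0|pwn] := eqVneq pw 0; first by rewrite pw0 !(mul0r, mulr0) subr0.
have pwp : 0 < pw by rewrite lt_def pwn mass_ge0.
have mwp : 0 < mw.
  rewrite lt_def mass_ge0 // andbT; apply: contra_neq pwn => mw0.
  have := @marg_ll i w; rewrite /marg -/pw -/mw mw0 mul0r => /(_ erefl)/eqP.
  by rewrite mulf_eq0 invr_eq0 (gt_eqF mass_gt0) orbF => /eqP.
have -> : pw / pm / (mw / mm) = (pw / mw) / (pm / mm).
  by field; rewrite !gt_eqF.
rewrite [in RHS]ln_div ?posrE ?divr_gt0 //.
by field; rewrite gt_eqF.
Qed.

Let resampled_ll i : i \notin S -> forall x, resampled k a i x = 0 -> a x = 0.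
Proof.
move=> iS x /eqP; rewrite /resampled mulf_eq0 => /orP[/eqP k0|].
  by rewrite /a p_ll_mu ?mul0r // (mu_k_mass kK mu_rev i) k0 mul0r.
rewrite psumr_eq0 => [/allP/(_ (x i) (mem_index_enum _))|w _]; last exact: (distr_ge0 a_distr).
by rewrite upd_self => /eqP.
Qed.

(** Resampling [a] at [i] keeps its distribution outside [i] and gives it the
    conditional distributions of [mu] at [i]. *)
Let site_kl i : i \notin S ->
  site_entropy i S eta = pm * kl a (resampled k a i).
Proof.
move=> iS; rewrite /site_entropy /kl mulr_sumr big_mkcond /=; apply: eq_bigr => x _.
rewrite {1}/a; case: ifP => px; last by rewrite mulr0 !mul0r mulr0.
have [p0|pn] := eqVneq (p x) 0; first by rewrite p0 !mul0r mulr0.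
have pp : 0 < p x by rewrite lt_def pn p_ge0.
have mp : 0 < mu x by rewrite lt_def mu_ge0 andbT; apply: contra_neq pn; exact: p_ll_mu.
have -> : a x = p x / pm by rewrite /a px mulr1.
have -> : resampled k a i x = k i x (x i) * (\sum_w p (upd x i w)) / pm.
  rewrite /resampled -mulrA mulr_suml; congr (_ * _); apply: eq_bigr => w _.
  by rewrite /a pin_upd // px mulr1.
have PP : 0 < \sum_w p (upd x i w).
  apply: lt_le_trans pp _; rewrite -{1}(upd_self x i) (bigD1 (x i)) //= lerDl.
  exact: sumr_ge0.
have mE := mu_k_mass kK mu_rev i x.
have MM : 0 < \sum_w mu (upd x i w).
  apply: lt_le_trans mp _; rewrite -{1}(upd_self x i) (bigD1 (x i)) //= lerDl.
  exact: sumr_ge0.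
have kp : 0 < k i x (x i) by move: mp; rewrite mE pmulr_lgt0.
have -> : p x / pm / (k i x (x i) * (\sum_w p (upd x i w)) / pm) =
  (p x / mu x) / ((\sum_w p (upd x i w)) / \sum_w mu (upd x i w)).
  by rewrite mE; field; rewrite !gt_eqF.
rewrite [in RHS]ln_div ?posrE ?divr_gt0 // mulr1.
by rewrite mulrA mulrCA divff ?mulr1 // gt_eqF.
Qed.

Let th := (1 + D%:R * beta) / 2.

(** The comparison theorem bounds the marginals of [p] against those of [mu] by
    the single-site discrepancies of [p], in mean square over the sites. *)
Lemma marginal_le_site_pos :
  \sum_(i | i \notin S) marginal_entropy i S eta <=
  4 * #|W|%:R / (alpha ^+ D.+1 * (1 - th) ^+ 2) *
    \sum_(i | i \notin S) site_entropy i S eta.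
Proof.
have al0 := alpha_gt0 kK.
have alD : 0 < alpha ^+ D.+1 by rewrite exprn_gt0.
have thp : 0 < (1 - th) ^+ 2.
  by rewrite exprn_gt0 // /th; have := subcritical kK; lra.
have sq w : \sum_(i | i \notin S) (marg p i w - marg mu i w) ^+ 2 <=
    (\sum_i tv i ^+ 2) / (1 - th) ^+ 2.
  have := @bound_sqr_limit _ _ _ _ _ _ _ _ kK free tv c0 tv_ge0 tv_le
    (fun i => if i \in S then 0 else `|marg p i w - marg mu i w|).
  move=> h; apply: le_trans (h _ _).
  - rewrite big_mkcond /=; apply: ler_sum => i _; case: (i \in S) => /=.
      by rewrite expr0n.
    by rewrite real_normK ?num_real.
  - by move=> i; case: ifP.
  move=> m i; case: ifP => iS; last by apply: marg_diff; rewrite iS.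
  exact: (@bound_ge0 _ _ _ _ _ _ _ _ kK free tv c0 tv_ge0 tv_le).
have tvs : \sum_i tv i ^+ 2 <= 4 / pm * \sum_(i | i \notin S) site_entropy i S eta.
  rewrite mulr_sumr big_mkcond [leRHS]big_mkcond /=; apply: ler_sum => i _.
  rewrite /tv; case: ifP => iS /=; first by rewrite expr0n.
  rewrite site_kl ?iS // mulrA divfK ?gt_eqF //.
  by apply: pinsker => //; apply: resampled_ll; rewrite iS.
apply: le_trans (_ : pm * \sum_(i | i \notin S) (alpha ^+ D.+1)^-1 *
    \sum_w (marg p i w - marg mu i w) ^+ 2 <= _).
  rewrite mulr_sumr; apply: ler_sum => i iS; rewrite marginal_kl // ler_wpM2l //.
    exact: ltW.
  apply: kl_le_atom => //; try exact: marg_distr.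
    by move=> w; exact: marg_ll.
  move=> w; rewrite /marg; case: (pinned_marginal kK mu_distr mu_rev eta w iS) => h.
    by left; rewrite h mul0r.
  by right; rewrite ler_pdivlMr.
rewrite -mulr_sumr exchange_big /=.
apply: le_trans (_ : pm * ((alpha ^+ D.+1)^-1 *
    (\sum_(w : W) (4 / pm * \sum_(i | i \notin S) site_entropy i S eta) / (1 - th) ^+ 2)) <= _).
  rewrite ler_wpM2l ?(ltW mass_gt0) // ler_wpM2l ?invr_ge0 ?(ltW alD) //; apply: ler_sum => w _.
  apply: le_trans (sq w) _; rewrite ler_wpM2r // invr_ge0; exact: ltW.
rewrite sumr_const -[X in _ * (_ * X)]mulr_natl le_eqVlt; apply/orP; left; apply/eqP.
field; rewrite (gt_eqF alD) (gt_eqF mass_gt0) /= !andbT.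
by move: thp; rewrite lt_def sqrf_eq0 => /andP[].
Qed.

End Pinned.

Let C := 4 * #|W|%:R / (alpha ^+ D.+1 * (1 - (1 + D%:R * beta) / 2) ^+ 2).

Let C_ge0 : 0 <= C.
Proof.
apply: divr_ge0; first exact: mulr_ge0.
apply: mulr_ge0; last exact: sqr_ge0.
apply: exprn_ge0; exact: ltW (alpha_gt0 kK).
Qed.

Lemma marginal_le_site S eta :
  \sum_(i | i \notin S) marginal_entropy i S eta <=
  C * \sum_(i | i \notin S) site_entropy i S eta.
Proof.
have [m0|mn] := eqVneq (mass p S eta) 0; last first.
  by apply: marginal_le_site_pos; rewrite lt_def mn mass_ge0.
have pz x : pin S eta x -> p x = 0.
  move=> px; move/eqP: m0; rewrite psumr_eq0 // => /allP/(_ x (mem_index_enum _)).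
  by rewrite px => /eqP.
rewrite !big1 ?mulr0 // => i iS.
  by rewrite /site_entropy big1 // => x px; rewrite pz // mul0r.
rewrite /marginal_entropy m0 mul0r subr0 big1 // => w _.
have -> : mass p (i |: S) (upd eta i w) = 0; last by rewrite mul0r.
by apply: big1 => x; rewrite pinU1 // => /andP[/pz].
Qed.

(** Entropy tensorizes approximately: averaging the chain rule over the first
    site to be revealed leaves, besides the induction hypothesis for the pinned
    fields, only marginal entropies, which the single-site terms control. *)
Lemma entropy_tensorization S eta :
  pinned_entropy S eta <= C * \sum_(i | i \notin S) site_entropy i S eta.
Proof.
have [n] := ubnP #|~: S|; elim: n S eta => [//|n IH] S eta; rewrite ltnS => nS.
have [S0|[i0 i0S]] := set_0Vmem (~: S).
  have St i : i \in S.
    apply/negPn/negP => iS.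
    have : i \in ~: S by rewrite inE.
    by rewrite S0 inE.
  rewrite big_pred0 => [|i]; last by rewrite St.
  rewrite mulr0 /pinned_entropy /mass.
  have pE : pin S eta =1 pred1 eta.
    move=> x; apply/pinP/eqP => [h|-> //]; apply/ffunP => i; exact: h.
  by rewrite !(eq_bigl _ _ pE) !big_pred1_eq subrr.
set I := \sum_(i | i \notin S) site_entropy i S eta.
have step i : i \notin S -> pinned_entropy S eta <=
    C * (I - site_entropy i S eta) + marginal_entropy i S eta.
  move=> iS; rewrite (entropy_chain _ iS) lerD2r.
  apply: le_trans (ler_sum _ (fun w _ => IH (i |: S) (upd eta i w) _)) _.
    move=> _ _; apply: leq_trans nS; apply: proper_card.
    apply/properP; split; last by exists i; rewrite ?inE ?eqxx.
    by apply/fintype.subsetP => j; rewrite !inE negb_or => /andP[].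
  rewrite -mulr_sumr exchange_big /= ler_wpM2l //.
  rewrite /I [X in _ <= X - _](bigD1 i) //= addrAC subrr add0r.
  rewrite (eq_bigl (fun j => (j \notin S) && (j != i))) => [|j]; last first.
    by rewrite in_setU1 negb_or andbC.
  by apply: ler_sum => j _; rewrite site_entropy_sum.
have N0 : (0 < #|~: S|)%N by apply/card_gt0P; exists i0.
have cE (u : R) : \sum_(i | i \notin S) u = #|~: S|%:R * u.
  by rewrite sumr_const mulr_natl; congr (_ *+ _); apply: eq_card => i; rewrite !inE.
have : \sum_(i | i \notin S) pinned_entropy S eta <= \sum_(i | i \notin S)
    (C * (I - site_entropy i S eta) + marginal_entropy i S eta).
  by apply: ler_sum => i; exact: step.
rewrite cE big_split /=.
rewrite -mulr_sumr sumrB cE -/I => h.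
have h2 := marginal_le_site S eta; rewrite -/I in h2.
have : #|~: S|%:R * pinned_entropy S eta <= #|~: S|%:R * (C * I) by lra.
by rewrite ler_pM2l // ltr0n.
Qed.

End Tensorization.

(** * The logarithmic Sobolev inequality *)

Section LogSobolev.
Context {R : realType} {V W : finType}.
Notation conf := {ffun V -> W}.
Implicit Types (f g F H : conf -> R) (x y : conf) (i j : V) (w : W) (s : seq V).
Variables (adj : rel V) (D : nat) (beta alpha : R) (k : V -> conf -> W -> R).
Hypothesis kK : kernel adj D beta alpha k.
Variables (mu : conf -> R) (mu_distr : distribution mu).
Hypothesis mu_rev : forall i, reversible k i mu.
Notation E := (ce k).

Let mu_ge0 := distr_ge0 mu_distr.

Definition sqnorm f := ex mu (fun x => f x ^+ 2).
Definition onenorm f := ex mu (fun x => `|f x|).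
Definition res j f x := f x - E j f x.

(** Entropy of [f^2] under [mu]. *)
Definition ent2 f := ex mu (fun x => f x ^+ 2 * ln (f x ^+ 2)) - sqnorm f * ln (sqnorm f).

Lemma sqnorm_ge0 f : 0 <= sqnorm f.
Proof. by apply: (ex_ge0 mu_distr) => x; exact: sqr_ge0. Qed.

Lemma onenorm_ge0 f : 0 <= onenorm f.
Proof. exact: (ex_ge0 mu_distr). Qed.

(** The single-site logarithmic Sobolev inequality, with a constant that depends on
    the smallest atom. Let [m] be the conditional quadratic mean of [f] at [j]. The
    atom bounds [f^2] by [m^2 / alpha], so that linearizing [ln] leaves a multiple of
    [(|f| - m)^2], whose mean is at most twice the conditional variance of [|f|]. *)
Lemma site_entropy_le j f x0 :
  site_entropy mu (fun x => mu x * f x ^+ 2) j finset.set0 x0 <=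
  4 * (1 + alpha^-1) * sqnorm (res j f).
Proof.
have al0 := alpha_gt0 kK.
pose m x := Num.sqrt (E j (fun y => f y ^+ 2) x).
have m2 x : m x ^+ 2 = E j (fun y => f y ^+ 2) x.
  rewrite sqr_sqrtr //; apply: sumr_ge0 => w _.
  by rewrite mulr_ge0 ?(k_ge0 kK) ?sqr_ge0.
have m0 x : 0 <= m x by exact: sqrtr_ge0.
(* [(a + m)^2 <= 2 (a^2 + m^2) <= c m^2] as soon as [alpha * a^2 <= m^2]. *)
pose c := 2 / alpha + 2.
have c0 : 2 <= c by rewrite /c lerDr divr_ge0 // ltW.
apply: le_trans (_ : ex mu (fun x => c * (`|f x| - m x) ^+ 2 + (f x ^+ 2 - m x ^+ 2)) <= _).
  rewrite /site_entropy (eq_bigl xpredT) => [|x]; last first.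
    by apply/pinP => i; rewrite finset.in_set0.
  apply: ler_sum => x _; have [mx|mx] := eqVneq (mu x) 0; first by rewrite mx !mul0r.
  have mp : 0 < mu x by rewrite lt_def mx mu_ge0.
  rewrite -mulrA ler_wpM2l //.
  have mE := mu_k_mass kK mu_rev j x.
  have MM : 0 < \sum_w mu (upd x j w).
    apply: lt_le_trans mp _; rewrite -{1}(upd_self x j) (bigD1 (x j)) //= lerDl.
    exact: sumr_ge0.
  have kp : alpha <= k j x (x j).
    by case: (k_atom kK j x (x j)) => // h; move: mp; rewrite mE h mul0r ltxx.
  have -> : (\sum_w mu (upd x j w) * f (upd x j w) ^+ 2) / (\sum_w mu (upd x j w)) = m x ^+ 2.
    rewrite m2 /ce mulr_suml; apply: eq_bigr => w _.
    rewrite (mu_k_mass kK mu_rev j (upd x j w)) (k_upd kK) upd_at.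
    under eq_bigr do rewrite upd_upd.
    by field; rewrite gt_eqF.
  have [fx|fx] := eqVneq (f x) 0.
    rewrite fx expr0n /= mul0r normr0 !sub0r sqrrN subr_ge0 ler_peMl ?sqr_ge0 //.
    by apply: le_trans c0; rewrite ler1n.
  have f2p : 0 < f x ^+ 2 by rewrite lt_def sqrf_eq0 fx sqr_ge0.
  have fm : alpha * f x ^+ 2 <= m x ^+ 2.
    rewrite m2 /ce (bigD1 (x j)) //= upd_self.
    apply: le_trans (_ : k j x (x j) * f x ^+ 2 <= _); first by rewrite ler_wpM2r ?sqr_ge0.
    rewrite lerDl; apply: sumr_ge0 => w _.
    by rewrite mulr_ge0 ?(k_ge0 kK) ?sqr_ge0.
  have m2p : 0 < m x ^+ 2 by apply: lt_le_trans fm; rewrite mulr_gt0.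
  have -> : mu x * f x ^+ 2 / mu x = f x ^+ 2 by field.
  rewrite -ln_div ?posrE //.
  have := ln_le_sub1 (divr_gt0 f2p m2p) => h.
  apply: le_trans (_ : f x ^+ 2 * (f x ^+ 2 / m x ^+ 2 - 1) <= _).
    by rewrite ler_wpM2l ?sqr_ge0.
  have -> : f x ^+ 2 * (f x ^+ 2 / m x ^+ 2 - 1) =
     (f x ^+ 2 - m x ^+ 2) ^+ 2 / m x ^+ 2 + (f x ^+ 2 - m x ^+ 2).
    by field; move: m2p; rewrite lt_def sqrf_eq0 => /andP[].
  rewrite lerD2r ler_pdivrMr //.
  move: fm; rewrite -(real_normK (num_real (f x))); set a := `|f x| => fm.
  have -> : (a ^+ 2 - m x ^+ 2) ^+ 2 = (a - m x) ^+ 2 * (a + m x) ^+ 2 by ring.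
  have -> : c * (a - m x) ^+ 2 * m x ^+ 2 = (a - m x) ^+ 2 * (c * m x ^+ 2) by ring.
  rewrite ler_wpM2l ?sqr_ge0 //.
  have a1 : a ^+ 2 <= m x ^+ 2 / alpha by rewrite ler_pdivlMr // mulrC.
  have -> : c * m x ^+ 2 = 2 * (m x ^+ 2 / alpha) + 2 * m x ^+ 2.
    by rewrite /c; field; rewrite gt_eqF.
  have := sqr_ge0 (a - m x); rewrite sqrrB sqrrD; lra.
rewrite exD exB exZ.
have -> : ex mu (fun x => m x ^+ 2) = ex mu (fun x => f x ^+ 2).
  by rewrite -[RHS](ex_ce kK (mu_rev j)); apply: eq_ex.
rewrite subrr addr0.
have -> : 4 * (1 + alpha^-1) = c * 2 by rewrite /c; field; rewrite gt_eqF.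
rewrite -mulrA ler_wpM2l //; first by apply: le_trans c0.
pose e := E j (fun y => `|f y|).
have me x : e x <= m x.
  rewrite -ler_sqr ?nnegrE // ?m2; last first.
    by apply: sumr_ge0 => w _; rewrite mulr_ge0 ?(k_ge0 kK).
  have : 0 <= E j (fun y => (`|f y| - e x) ^+ 2) x.
    by apply: sumr_ge0 => w _; rewrite mulr_ge0 ?(k_ge0 kK) ?sqr_ge0.
  have -> : E j (fun y => (`|f y| - e x) ^+ 2) x =
    E j (fun y => f y ^+ 2 - (2 * e x * `|f y| - e x ^+ 2)) x.
    by apply: eq_ce => y; rewrite -(real_normK (num_real (f y))); ring.
  rewrite ceB ceB ceZ -/(e x) (ce_cst kK); lra.
have e0 x : 0 <= e x by apply: sumr_ge0 => w _; rewrite mulr_ge0 ?(k_ge0 kK).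
have -> : ex mu (fun x => (`|f x| - m x) ^+ 2) = 2 * (ex mu (fun x => m x ^+ 2 - m x * e x)).
  have h1 : ex mu (fun x => m x * e x) = ex mu (fun x => m x * `|f x|).
    rewrite -[RHS](ex_ce kK (mu_rev j)); apply: eq_ex => x.
    rewrite (ce_mull k _ (g := m)) // => y w.
    by rewrite /m (ce_upd kK).
  have h2 : ex mu (fun x => m x ^+ 2) = ex mu (fun x => f x ^+ 2).
    by rewrite -[RHS](ex_ce kK (mu_rev j)); apply: eq_ex.
  rewrite exB h1.
  rewrite (eq_ex mu (g := fun x => f x ^+ 2 + (m x ^+ 2 - 2 * (m x * `|f x|)))) => [|x].
    by rewrite exD exB exZ h2; ring.
  by rewrite -(real_normK (num_real (f x))); ring.
rewrite ler_pM2l //.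
apply: le_trans (_ : ex mu (fun x => m x ^+ 2 - e x ^+ 2) <= _).
  apply: (le_ex mu_distr) => x; rewrite lerD2l lerN2 expr2.
  by rewrite ler_wpM2r.
rewrite exB.
have -> : ex mu (fun x => m x ^+ 2) = sqnorm f.
  by rewrite /sqnorm -[RHS](ex_ce kK (mu_rev j)); apply: eq_ex.
rewrite /sqnorm (ce_pythagoras kK (mu_rev j) f) -/(sqnorm (res j f)).
suff : ex mu (fun x => E j f x ^+ 2) <= ex mu (fun x => e x ^+ 2).
  by rewrite /sqnorm /res; lra.
apply: (le_ex mu_distr) => x; rewrite -(real_normK (num_real (E j f x))).
rewrite lerXn2r ?nnegrE // /e /ce; apply: le_trans (ler_norm_sum _ _ _) _.
by apply: ler_sum => w _; rewrite normrM ger0_norm ?(k_ge0 kK).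
Qed.

Definition lsi_const : R := 4 * #|W|%:R /
  (alpha ^+ D.+1 * (1 - (1 + D%:R * beta) / 2) ^+ 2) * (4 * (1 + alpha^-1)).

Lemma lsi_const_ge0 : 0 <= lsi_const.
Proof.
have al0 := alpha_gt0 kK.
apply: mulr_ge0; last by rewrite mulr_ge0 // addr_ge0 // invr_ge0 ltW.
apply: divr_ge0; first exact: mulr_ge0.
by apply: mulr_ge0; [apply: exprn_ge0; exact: ltW|exact: sqr_ge0].
Qed.

(** Tensorization applied to the density [f^2]. *)
Theorem log_sobolev f : ent2 f <= lsi_const * \sum_j sqnorm (res j f).
Proof.
have [x0 _] : exists x : conf, 0 < mu x.
  apply/existsP; apply: contraT; rewrite negb_exists => /forallP h.
  have := distr_sum mu_distr; rewrite big1 => [/eqP|x _].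
    by rewrite eq_sym oner_eq0.
  by apply/eqP; rewrite eq_le mu_ge0 andbT leNgt; exact: h.
pose p x := mu x * f x ^+ 2.
have p0 x : 0 <= p x by rewrite mulr_ge0 ?sqr_ge0.
have pll x : mu x = 0 -> p x = 0 by rewrite /p => ->; rewrite mul0r.
have := entropy_tensorization kK mu_distr mu_rev p0 pll finset.set0 x0.
have pT : pin (finset.set0 : {set V}) x0 =1 xpredT.
  by move=> x; apply/pinP => i; rewrite finset.in_set0.
have -> : pinned_entropy mu p finset.set0 x0 = ent2 f.
  rewrite /pinned_entropy /mass !(eq_bigl _ _ pT) (distr_sum mu_distr) divr1.
  congr (_ - _); apply: eq_bigr => x _; rewrite /p -mulrA.
  have [->|mx] := eqVneq (mu x) 0; first by rewrite !mul0r.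
  by congr (_ * (_ * ln _)); field.
move=> /le_trans; apply; rewrite /lsi_const -[leRHS]mulrA ler_wpM2l //.
  apply: divr_ge0; first exact: mulr_ge0.
  apply: mulr_ge0; [apply: exprn_ge0; exact: ltW (alpha_gt0 kK)|exact: sqr_ge0].
rewrite (eq_bigl xpredT) => [|i]; last by rewrite finset.in_set0.
by rewrite mulr_sumr; apply: ler_sum => j _; exact: site_entropy_le.
Qed.

(** Entropy exceeds the second moment by any factor that the ratio of the first
    two moments allows: linearize [ln] at the point [expR (- l)]. *)
Lemma ent2_lower l f :
  (1 + 2 * l) * sqnorm f - expR (2 * l) * onenorm f ^+ 2 <= ent2 f.
Proof.
pose s := Num.sqrt (sqnorm f).
have s2 : s ^+ 2 = sqnorm f by rewrite sqr_sqrtr // sqnorm_ge0.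
have s0 : 0 <= s by exact: sqrtr_ge0.
have el := expR_gt0 l.
apply: le_trans (_ : 2 * (1 + l) * sqnorm f - 2 * expR l * s * onenorm f <= _).
  have := sqr_ge0 (s - expR l * onenorm f); rewrite -s2.
  have -> : expR (2 * l) = expR l ^+ 2 by rewrite -expRM_natl.
  rewrite -subr_ge0 => h; rewrite -subr_ge0; apply: le_trans h _.
  by rewrite subr0 le_eqVlt; apply/orP; left; apply/eqP; ring.
have [n0|nn] := eqVneq (sqnorm f) 0.
  have fz x : mu x * f x ^+ 2 = 0.
    move/eqP: n0; rewrite /sqnorm /ex psumr_eq0 => [/allP/(_ x (mem_index_enum _))/eqP//|y _].
    by rewrite mulr_ge0 ?sqr_ge0.
  rewrite /ent2 n0 mulr0 mul0r subr0 /s n0 sqrtr0 mulr0 mul0r subr0.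
  by rewrite /ex big1 // => x _; rewrite mulrA fz mul0r.
have np : 0 < sqnorm f by rewrite lt_def nn sqnorm_ge0.
have sp : 0 < s by rewrite sqrtr_gt0.
have -> : ent2 f = ex mu (fun x => f x ^+ 2 * (ln (f x ^+ 2) - ln (sqnorm f))).
  rewrite /ent2 {1}/sqnorm mulrC -exZ -exB; apply: eq_ex => x; ring.
rewrite /onenorm /sqnorm -!exZ -exB; apply: (le_ex mu_distr) => x.
have [->|fx] := eqVneq (f x) 0; first by rewrite expr0n normr0 !(mulr0, mul0r) subrr.
have fp : 0 < `|f x| by rewrite normr_gt0.
have -> : ln (f x ^+ 2) - ln (sqnorm f) = - (ln (s / `|f x|) *+ 2).
  rewrite ln_div ?posrE // mulrnBl -!lnXn // s2 real_normK ?num_real //; ring.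
have h := ln_le_sub1 (divr_gt0 (mulr_gt0 el sp) fp).
rewrite -mulrA lnM ?posrE ?divr_gt0 // expRK in h.
rewrite -(real_normK (num_real (f x))).
have -> : 2 * (1 + l) * `|f x| ^+ 2 - 2 * expR l * s * `|f x| =
  `|f x| ^+ 2 * (2 * (1 + l - expR l * (s / `|f x|))).
  by field; rewrite gt_eqF.
rewrite ler_wpM2l ?sqr_ge0 //; lra.
Qed.
End LogSobolev.

(** * The Falik--Samorodnitsky inequality for a set of nonadjacent sites *)

Section Influences.
Context {R : realType} {V W : finType}.
Notation conf := {ffun V -> W}.
Implicit Types (f g F H : conf -> R) (x y : conf) (i j b : V) (w : W) (s : seq V).
Variables (adj : rel V) (D : nat) (beta alpha : R) (k : V -> conf -> W -> R).
Hypothesis kK : kernel adj D beta alpha k.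
Variables (mu : conf -> R) (mu_distr : distribution mu).
Hypothesis mu_rev : forall i, reversible k i mu.
Notation E := (ce k).
Notation sqnorm := (sqnorm mu).
Notation onenorm := (onenorm mu).
Notation res := (res k).

Fixpoint avg s F := if s is i :: s' then avg s' (E i F) else F.

(** The increments of the martingale obtained by averaging out the sites of [s]
    one after the other. *)
Fixpoint increments s F := if s is i :: s' then res i F :: increments s' (E i F) else [::].

Definition indep s := forall i j, i \in s -> j \in s -> ~~ adj i j.

Lemma indep_cons i s : indep (i :: s) -> indep s.
Proof. by move=> h a b ai bi; apply: h; rewrite in_cons ?ai ?bi orbT. Qed.

Lemma sqnorm_split i F : sqnorm F = sqnorm (E i F) + sqnorm (res i F).
Proof. exact: (ce_pythagoras kK (mu_rev i)). Qed.

Lemma sqnorm_res_le i F : sqnorm (res i F) <= sqnorm F.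
Proof. by rewrite [leRHS](sqnorm_split i) lerDr (sqnorm_ge0 mu_distr). Qed.

Lemma sqnorm_ce_le i F : sqnorm (E i F) <= sqnorm F.
Proof. by rewrite [leRHS](sqnorm_split i) lerDl (sqnorm_ge0 mu_distr). Qed.

Lemma E_comm i j F : ~~ adj i j -> E i (E j F) = E j (E i F).
Proof. by move=> ij; apply/funext => x; exact: (ce_comm kK). Qed.

Lemma res_ce i j F : ~~ adj i j -> res i (E j F) = E j (res i F).
Proof.
by move=> ij; apply/funext => x; rewrite /res ceB (E_comm _ ij).
Qed.

Lemma res_comm i j F : ~~ adj i j -> res i (res j F) = res j (res i F).
Proof.
move=> ij; apply/funext => x; rewrite /res !ceB (E_comm _ ij); ring.
Qed.

Lemma sqnorm_res_ce_le i j F : ~~ adj i j -> sqnorm (res i (E j F)) <= sqnorm (res i F).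
Proof. by move=> ij; rewrite res_ce // sqnorm_ce_le. Qed.

Lemma increments_sqnorm s F :
  \sum_(f <- increments s F) sqnorm f = sqnorm F - sqnorm (avg s F).
Proof.
elim: s F => [|i s IH] F /=; first by rewrite big_nil subrr.
by rewrite big_cons IH (sqnorm_split i F); ring.
Qed.

(** An increment is the residue at its own site of an average over the sites before
    it, and these averages commute with the residue. *)
Lemma increments_onenorm s F : indep s ->
  \sum_(f <- increments s F) onenorm f ^+ 2 <= \sum_(b <- s) onenorm (res b F) ^+ 2.
Proof.
elim: s F => [|i s IH] F sI /=; first by rewrite !big_nil.
rewrite !big_cons lerD2l; apply: le_trans (IH _ (indep_cons sI)) _.
rewrite big_seq [leRHS]big_seq; apply: ler_sum => b bs.
rewrite lerXn2r ?nnegrE ?(onenorm_ge0 mu_distr) // res_ce.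
  exact: (ce_contract1 kK mu_distr (mu_rev i)).
by apply: sI; rewrite in_cons ?bs ?eqxx ?orbT.
Qed.

Lemma sqnormB_le f g : sqnorm (fun x => f x - g x) <= 2 * sqnorm f + 2 * sqnorm g.
Proof.
rewrite /sqnorm -!exZ -exD; apply: (le_ex mu_distr) => x.
by have := sqr_ge0 (f x + g x); rewrite sqrrD sqrrB; lra.
Qed.

(** Averages at sites that are not neighbours of [j] commute with [res j], so
    that the corresponding terms telescope; each of the few neighbours of [j]
    costs a factor two and its own residue. *)
Lemma increments_energy j s F : indep s ->
  \sum_(f <- increments s F) sqnorm (res j f) <=
  2 ^+ count (adj j) s *
    (sqnorm (res j F) + 2 * \sum_(b <- s | adj j b) sqnorm (res b F)).
Proof.
elim: s F => [|i s IH] F sI /=.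
  by rewrite !big_nil mulr0 addr0 expr0 mul1r (sqnorm_ge0 mu_distr).
rewrite !big_cons; apply: le_trans (lerD (lexx _) (IH _ (indep_cons sI))) _.
have S0 G : 0 <= \sum_(b <- s | adj j b) sqnorm (res b G).
  by apply: sumr_ge0 => b _; exact: (sqnorm_ge0 mu_distr).
have Sle : \sum_(b <- s | adj j b) sqnorm (res b (E i F)) <=
           \sum_(b <- s | adj j b) sqnorm (res b F).
  rewrite big_seq_cond [leRHS]big_seq_cond; apply: ler_sum => b /andP[bs _].
  by apply: sqnorm_res_ce_le; apply: sI; rewrite in_cons ?bs ?eqxx ?orbT.
set r := count (adj j) s.
have r1 : 1 <= 2 ^+ r :> R by rewrite exprn_ege1 // ler1n.
have [ji|ji] := boolP (adj j i); last first.
  rewrite add0n.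
  have e : sqnorm (res j (res i F)) = sqnorm (res j F) - sqnorm (res j (E i F)).
    by rewrite res_comm // (res_ce F ji) (sqnorm_split i (res j F)); ring.
  rewrite e.
  have h : sqnorm (res j (E i F)) <= sqnorm (res j F) by exact: sqnorm_res_ce_le.
  have : 0 <= (2 ^+ r - 1) * (sqnorm (res j F) - sqnorm (res j (E i F))).
    by rewrite mulr_ge0 // subr_ge0.
  have : 2 ^+ r * \sum_(b <- s | adj j b) sqnorm (res b (E i F)) <=
         2 ^+ r * \sum_(b <- s | adj j b) sqnorm (res b F).
    by rewrite ler_wpM2l // exprn_ge0.
  lra.
rewrite add1n exprS.
have h1 : sqnorm (res j (res i F)) <= sqnorm (res i F) by exact: sqnorm_res_le.
have h2 : sqnorm (res j (E i F)) <= 2 * sqnorm (res j F) + 2 * sqnorm (res i F).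
  have -> : res j (E i F) = (fun x => res j F x - res j (res i F) x).
    by apply/funext => x; rewrite /res !ceB; ring.
  apply: le_trans (sqnormB_le _ _) _; lra.
have n0 := sqnorm_ge0 mu_distr (res i F).
set A := sqnorm (res j F) in h2 *; set B := sqnorm (res i F) in h1 h2 n0 *.
set S := \sum_(b <- s | _) sqnorm (res b F) in Sle *.
have SS : 0 <= S by exact: S0.
have : 2 ^+ r * (sqnorm (res j (E i F)) + 2 * \sum_(b <- s | adj j b) sqnorm (res b (E i F)))
   <= 2 ^+ r * (2 * A + 2 * B + 2 * S).
  by rewrite ler_wpM2l ?exprn_ge0 //; lra.
have : 0 <= (2 ^+ r - 1) * B by rewrite mulr_ge0 // subr_ge0.
have : 0 <= 2 ^+ r * S by rewrite mulr_ge0 // exprn_ge0.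
have : 0 <= 2 ^+ r * B by rewrite mulr_ge0 // exprn_ge0.
lra.
Qed.

Lemma sum_uniq_le s (G : V -> R) : uniq s -> (forall j, 0 <= G j) ->
  \sum_(b <- s) G b <= \sum_j G j.
Proof.
move=> us G0; rewrite big_uniq //= big_mkcond /=; apply: ler_sum => j _.
by case: ifP.
Qed.

Lemma increments_energy_sum s F : indep s -> uniq s ->
  \sum_(f <- increments s F) \sum_j sqnorm (res j f) <=
  2 ^+ D * (1 + 2 * D%:R) * \sum_j sqnorm (res j F).
Proof.
move=> sI us; rewrite exchange_big /=.
have n0 b := sqnorm_ge0 mu_distr (res b F).
apply: le_trans (_ : \sum_j 2 ^+ D * (sqnorm (res j F) +
    2 * \sum_(b <- s | adj j b) sqnorm (res b F)) <= _).
  apply: ler_sum => j _; apply: le_trans (increments_energy j F sI) _.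
  rewrite ler_wpM2r //.
    by rewrite addr_ge0 // mulr_ge0 // sumr_ge0.
  rewrite ler_weXn2l ?ler1n //; apply: leq_trans (adj_deg kK j).
  rewrite -size_filter cardE uniq_leq_size ?filter_uniq // => b.
  by rewrite mem_filter mem_enum => /andP[].
rewrite -mulr_sumr -mulrA ler_wpM2l ?exprn_ge0 // big_split /= mulrDl mul1r lerD2l.
rewrite -mulr_sumr -mulrA ler_wpM2l //.
rewrite (eq_bigr (fun j => \sum_(b <- s) if adj j b then sqnorm (res b F) else 0)); last first.
  by move=> j _; rewrite big_mkcond.
rewrite exchange_big /=.
apply: le_trans (_ : \sum_(b <- s) D%:R * sqnorm (res b F) <= _).
  apply: ler_sum => b _; rewrite -big_mkcond /=.
  rewrite (eq_bigl (fun j => j \in [pred j | adj b j])) => [|j]; last first.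
    by rewrite inE (adj_sym kK).
  by rewrite sumr_const -[leLHS]mulr_natl ler_wpM2r // ler_nat (adj_deg kK).
by rewrite -mulr_sumr ler_wpM2l // sum_uniq_le.
Qed.

(** The Falik--Samorodnitsky argument: the logarithmic Sobolev inequality,
    applied to the increments of a martingale rather than to [F] itself, gains
    the factor [l] as soon as the increments have small first moments. *)
Lemma falik_samorodnitsky l s F : indep s -> uniq s ->
  (1 + 2 * l) * (sqnorm F - sqnorm (avg s F)) <=
  lsi_const (W := W) D beta alpha * (2 ^+ D * (1 + 2 * D%:R)) * \sum_j sqnorm (res j F) +
  expR (2 * l) * \sum_(b <- s) onenorm (res b F) ^+ 2.
Proof.
move=> sI us; rewrite -increments_sqnorm [leLHS]mulr_sumr.
apply: le_trans (_ : \sum_(f <- increments s F)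
   (lsi_const (W := W) D beta alpha * (\sum_j sqnorm (res j f)) +
    expR (2 * l) * onenorm f ^+ 2) <= _).
  apply: ler_sum => f _; rewrite -lerBlDr.
  apply: le_trans (ent2_lower mu_distr l f) _; exact: (log_sobolev kK).
rewrite big_split /=; apply: lerD; rewrite -[leLHS]mulr_sumr.
  rewrite -mulrA; apply: ler_wpM2l; first exact: (lsi_const_ge0 kK).
  exact: increments_energy_sum.
by apply: ler_wpM2l; [exact: expR_ge0|exact: increments_onenorm].
Qed.

End Influences.

(** * Spectral gap of colour classes and Talagrand's inequality *)

Section Gap.
Context {R : realType} {V W : finType}.
Notation conf := {ffun V -> W}.
Implicit Types (f g F H : conf -> R) (x y : conf) (i j b : V) (w : W) (s : seq V).
Variables (adj : rel V) (D : nat) (beta alpha : R) (k : V -> conf -> W -> R).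
Hypothesis kK : kernel adj D beta alpha k.
Variables (mu : conf -> R) (mu_distr : distribution mu).
Hypothesis mu_rev : forall i, reversible k i mu.
Notation E := (ce k).
Notation sqnorm := (sqnorm mu).
Notation onenorm := (onenorm mu).
Notation res := (res k).
Notation avg := (avg k).

Lemma avg_ce s i F : (forall j, j \in s -> ~~ adj i j) -> avg s (E i F) = E i (avg s F).
Proof.
elim: s F => [//|j s IH] F h /=; rewrite -(E_comm kK); last by rewrite h ?mem_head.
by rewrite IH // => l ls; rewrite h // in_cons ls orbT.
Qed.

Lemma indep_head i s : indep adj (i :: s) -> forall j, j \in s -> ~~ adj i j.
Proof. by move=> h j js; apply: h; rewrite ?mem_head // in_cons js orbT. Qed.

Lemma avg_selfadj s F G : indep adj s ->
  ex mu (fun x => avg s F x * G x) = ex mu (fun x => F x * avg s G x).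
Proof.
elim: s F G => [//|i s IH] F G sI /=.
rewrite (IH _ _ (indep_cons sI)) (ce_selfadj kK (mu_rev i)).
by rewrite avg_ce //; exact: indep_head.
Qed.

Lemma avg_idem s F : indep adj s -> avg s (avg s F) = avg s F.
Proof.
elim: s F => [//|i s IH] F sI /=.
have hi := indep_head sI.
rewrite (avg_ce (avg s (E i F)) hi) (IH _ (indep_cons sI)) -avg_ce //.
by congr (avg s _); apply/funext => x; exact: (ce_idem kK).
Qed.

Lemma avg_sqnorm s F : indep adj s -> ex mu (fun x => avg s F x * F x) = sqnorm (avg s F).
Proof.
by move=> sI; rewrite -{1}(avg_idem F sI) avg_selfadj.
Qed.

Lemma ex_avg s F : ex mu (avg s F) = ex mu F.
Proof. by elim: s F => [//|i s IH] F /=; rewrite IH (ex_ce kK (mu_rev i)). Qed.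

(** Averaging at one site removes its oscillation and returns at most the fraction
    [D%:R * beta] of it to its neighbours. *)
Lemma avg_osc s F d : uniq s -> osc F d -> exists d', osc (avg s F) d' /\
  \sum_j d' j <= \sum_j d j - (1 - D%:R * beta) * \sum_(j <- s) d j.
Proof.
elim: s F d => [|i s IH] F d /=.
  by move=> _ Fd; exists d; split=> //; rewrite big_nil mulr0 subr0.
move=> /andP[nis us] Fd; have [d' [Fd' h]] := IH _ _ us (osc_ce kK i Fd).
exists d'; split=> //; apply: le_trans h _.
have d0 := proj1 Fd.
have b0 := beta_ge0 kK.
have d1 := subcritical kK.
have h1 : \sum_j spread adj beta i d j <= \sum_j d j - (1 - D%:R * beta) * d i.
  rewrite (bigD1 i) //= [\sum_j d j](bigD1 i) //= /spread eqxx add0r.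
  under eq_bigr => j ji do rewrite (negbTE ji).
  rewrite big_split /=.
  have : \sum_(j | j != i) (adj i j)%:R * beta * d i <= D%:R * beta * d i.
    apply: le_trans (_ : \sum_j (adj i j)%:R * beta * d i <= _).
      rewrite big_mkcond /=; apply: ler_sum => j _; case: ifP => // _.
      by rewrite !mulr_ge0.
    exact: (@sum_adj_le _ _ _ _ _ _ _ _ kK i (fun=> d i) (d i) (d0 i) (fun=> lexx _)).
  lra.
have h2 : \sum_(j <- s) d j <= \sum_(j <- s) spread adj beta i d j.
  rewrite big_seq [leRHS]big_seq; apply: ler_sum => j js; rewrite /spread.
  case: eqP => [e|_]; first by rewrite -e js in nis.
  by rewrite lerDl !mulr_ge0.
rewrite big_cons.
have : (1 - D%:R * beta) * \sum_(j <- s) d j <= (1 - D%:R * beta) * \sum_(j <- s) spread adj beta i d j.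
  by rewrite ler_wpM2l // subr_ge0 ltW.
lra.
Qed.

Section Colouring.
Variables (q : nat) (col : V -> 'I_q.+1).
Hypothesis col_adj : forall i j, adj i j -> col i != col j.

Definition colour_class c := [seq i <- enum V | col i == c].

Lemma colour_class_uniq c : uniq (colour_class c).
Proof. by rewrite filter_uniq // enum_uniq. Qed.

Lemma colour_class_indep c : indep adj (colour_class c).
Proof.
move=> i j; rewrite !mem_filter => /andP[/eqP ic _] /andP[/eqP jc _].
by apply/negP => /col_adj; rewrite ic jc eqxx.
Qed.

Lemma sum_colour_class (G : V -> R) :
  \sum_c \sum_(j <- colour_class c) G j = \sum_j G j.
Proof.
rewrite [RHS](partition_big col xpredT) //=; apply: eq_bigr => c _.
by rewrite big_filter big_enum_cond.
Qed.

(* Averaging over a colour class chosen at random: unlike the average over one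
   class, it contracts the total oscillation. *)
Let Q F x := q.+1%:R^-1 * \sum_c avg (colour_class c) F x.
Let th := 1 - (1 - D%:R * beta) / q.+1%:R.

Let q_gt0 : 0 < q.+1%:R :> R. Proof. by rewrite ltr0n. Qed.

Let Q_selfadj F G : ex mu (fun x => Q F x * G x) = ex mu (fun x => F x * Q G x).
Proof.
rewrite (eq_ex mu (g := fun x => q.+1%:R^-1 * \sum_c avg (colour_class c) F x * G x)).
  rewrite [RHS](eq_ex mu (g := fun x => q.+1%:R^-1 * \sum_c F x * avg (colour_class c) G x)).
    rewrite !exZ !ex_sum; congr (_ * _); apply: eq_bigr => c _.
    by apply: avg_selfadj; exact: colour_class_indep.
  by move=> x; rewrite /Q mulrCA mulr_sumr.
by move=> x; rewrite /Q -mulrA mulr_suml.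
Qed.

Let Q_osc F d : osc F d -> exists d', osc (Q F) d' /\ \sum_j d' j <= th * \sum_j d j.
Proof.
move=> Fd.
have h c := avg_osc (colour_class_uniq c) Fd.
have [d' d'P] := choice h.
exists (fun j => q.+1%:R^-1 * \sum_c d' c j); split.
  split=> [j|j x w].
    rewrite mulr_ge0 ?invr_ge0 // sumr_ge0 // => c _; exact: (proj1 (proj1 (d'P c))).
  rewrite /Q -mulrBr normrM ger0_norm ?invr_ge0 // ler_wpM2l ?invr_ge0 //.
  rewrite -sumrB; apply: le_trans (ler_norm_sum _ _ _) _; apply: ler_sum => c _.
  exact: (proj2 (proj1 (d'P c))).
rewrite -mulr_sumr exchange_big /= ler_pdivrMl //.
apply: le_trans (ler_sum _ (fun c _ => proj2 (d'P c))) _.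
rewrite sumrB sumr_const card_ord -mulr_sumr sum_colour_class /th -mulr_natl.
rewrite le_eqVlt; apply/orP; left; apply/eqP; field; exact: lt0r_neq0.
Qed.

Let ex_Q F : ex mu (Q F) = ex mu F.
Proof.
rewrite /Q exZ ex_sum.
under eq_bigr do rewrite ex_avg.
by rewrite sumr_const card_ord -[X in _ * X]mulr_natl mulrA mulVf ?mul1r // gt_eqF.
Qed.

Let th_gt0 : 0 <= th.
Proof.
have d1 := subcritical kK.
have bd0 : 0 <= D%:R * beta by rewrite mulr_ge0 // (beta_ge0 kK).
rewrite /th subr_ge0 ler_pdivrMr // mul1r.
have : 1 <= q.+1%:R :> R by rewrite ler1n.
lra.
Qed.

(** A self-adjoint operator that contracts oscillations contracts [L^2] at the
    same rate: the norms of its iterates form a logarithmically convex sequence,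
    so a slower decay at the first step would persist. *)
Let Q_contract F d : osc F d -> ex mu F = 0 -> sqnorm (Q F) <= th ^+ 2 * sqnorm F.
Proof.
move=> Fd F0; pose G m := iter m Q F; pose b m := sqnorm (G m).
have b0 m : 0 <= b m by exact: (sqnorm_ge0 mu_distr).
have lc m : b m.+1 ^+ 2 <= b m * b m.+2.
  have -> : b m.+1 = ex mu (fun x => G m x * G m.+2 x).
    by rewrite /b /sqnorm /= -Q_selfadj; apply: eq_ex => x; rewrite expr2.
  exact: (ex_CauchySchwarz mu_distr).
have ub m : b m <= (\sum_j d j) ^+ 2 * (th ^+ 2) ^+ m.
  have [d' [Gd' d's]] : exists d', osc (G m) d' /\ \sum_j d' j <= th ^+ m * \sum_j d j.
    elim: m => [|m [d' [Gd' IH]]]; first by exists d; split=> //; rewrite expr0 mul1r.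
    have [d'' [h1 h2]] := Q_osc Gd'; exists d''; split=> //.
    by apply: le_trans h2 _; rewrite exprS -mulrA ler_wpM2l.
  have Gx x : `|G m x| <= \sum_j d' j.
    have exG : ex mu (G m) = 0 by rewrite /G; elim: (m) => [//|l IH] /=; rewrite ex_Q.
    have -> : G m x = ex mu (fun y => G m x - G m y).
      by rewrite exB exG subr0 (ex_cst mu_distr).
    apply: le_trans (ex_norm mu_distr _) _.
    rewrite -[leRHS](ex_cst mu_distr); apply: (le_ex mu_distr) => y.
    apply: le_trans (osc_dist _ _ Gd') _; rewrite big_mkcond /=; apply: ler_sum => j _.
    by case: ifP => // _; exact: (proj1 Gd').
  rewrite -exprM mulnC exprM -exprMn mulrC.
  rewrite /b /sqnorm -[leRHS](ex_cst mu_distr); apply: (le_ex mu_distr) => x.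
  rewrite -(real_normK (num_real (G m x))) lerXn2r ?nnegrE //.
    by apply: le_trans d's; apply: le_trans (Gx x).
  exact: le_trans (Gx x) d's.
change (b 1%N <= th ^+ 2 * b 0%N); rewrite leNgt; apply/negP => lt1.
have b1 : 0 < b 1%N by apply: le_lt_trans lt1; rewrite mulr_ge0 // sqr_ge0.
have b0p : 0 < b 0%N.
  rewrite lt_def b0 andbT; apply: contraTneq b1 => b00.
  have := lc 0%N; rewrite b00 mul0r => h.
  by rewrite -leNgt -(ler_pXn2r (n := 2)) ?nnegrE // expr0n.
pose rho := b 1%N / b 0%N.
have rho0 : 0 < rho by rewrite divr_gt0.
have inc m : 0 < b m /\ rho * b m <= b m.+1.
  elim: m => [|m [bm IH]]; first by rewrite /rho divfK ?gt_eqF.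
  have bm1 : 0 < b m.+1 by apply: lt_le_trans IH; rewrite mulr_gt0.
  split=> //; rewrite -(ler_pM2l bm); apply: le_trans (lc m).
  by rewrite mulrCA mulrA expr2 ler_wpM2r // ltW.
have lb m : rho ^+ m * b 0%N <= b m.
  elim: m => [|m IH]; first by rewrite expr0 mul1r.
  apply: le_trans (proj2 (inc m)); rewrite exprS -mulrA ler_wpM2l //; exact: ltW.
have : b 0%N <= 0.
  apply: (@le_geometric_limit _ _ _ ((\sum_j d j) ^+ 2) (th ^+ 2 / rho)).
    rewrite divr_ge0 ?sqr_ge0 ?(ltW rho0) //= ltr_pdivrMr // mul1r.
    by rewrite /rho ltr_pdivlMr.
  move=> m; rewrite add0r expr_div_n mulrA ler_pdivlMr ?exprn_gt0 // mulrC.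
  exact: le_trans (lb m) (ub m).
by rewrite leNgt b0p.
Qed.

Lemma osc_exists F : exists d, osc F d.
Proof.
exists (fun i => \sum_x \sum_w `|F (upd x i w) - F x|); split=> [i|i x w].
  by apply: sumr_ge0 => x _; apply: sumr_ge0.
rewrite (bigD1 x) //= (bigD1 w) //= -addrA lerDl.
by rewrite addr_ge0 ?sumr_ge0 // => y _; rewrite sumr_ge0.
Qed.

(** Spectral gap of the dynamics that refreshes a colour class chosen at random:
    its generator is [Q - 1], and [Q] contracts the functions of mean zero. *)
Lemma colour_gap F : ex mu F = 0 ->
  (1 - D%:R * beta) * sqnorm F <=
  \sum_c (sqnorm F - sqnorm (avg (colour_class c) F)).
Proof.
move=> F0; have [d Fd] := osc_exists F.
have n0 := sqnorm_ge0 mu_distr F.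
have e : ex mu (fun x => Q F x * F x) = q.+1%:R^-1 * \sum_c sqnorm (avg (colour_class c) F).
  rewrite (eq_ex mu (g := fun x => q.+1%:R^-1 * \sum_c avg (colour_class c) F x * F x)).
    rewrite exZ ex_sum; congr (_ * _); apply: eq_bigr => c _.
    by apply: avg_sqnorm; exact: colour_class_indep.
  by move=> x; rewrite /Q -mulrA mulr_suml.
have le : ex mu (fun x => Q F x * F x) <= th * sqnorm F.
  apply: le_trans (ler_norm _) _.
  rewrite -ler_sqr ?nnegrE ?mulr_ge0 // real_normK ?num_real //.
  apply: le_trans (ex_CauchySchwarz mu_distr _ _) _.
  rewrite exprMn expr2 [X in _ <= _ * X]expr2 mulrA -expr2.
  by apply: ler_wpM2r => //; exact: Q_contract Fd F0.
rewrite e in le.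
rewrite sumrB sumr_const card_ord -[X in _ <= X - _]mulr_natl.
set S := \sum_c _ in le *.
have h : S <= q.+1%:R * (th * sqnorm F) by rewrite -ler_pdivrMl.
have e2 : q.+1%:R * (th * sqnorm F) = q.+1%:R * sqnorm F - (1 - D%:R * beta) * sqnorm F.
  by rewrite /th; field; exact: lt0r_neq0.
by rewrite e2 in h; lra.
Qed.

Definition talagrand_const : R :=
  q.+1%:R * (lsi_const (W := W) D beta alpha * (2 ^+ D * (1 + 2 * D%:R))).

Lemma talagrand_const_ge0 : 0 <= talagrand_const.
Proof.
apply: mulr_ge0 => //; apply: mulr_ge0; first exact: (lsi_const_ge0 kK).
apply: mulr_ge0; first exact: exprn_ge0.
by apply: addr_ge0 => //; exact: mulr_ge0.
Qed.

(** Talagrand's inequality. The best [l] is about half the logarithm of the ratio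
    between the sums of the squared [L^2] and [L^1] influences. *)
Theorem talagrand l F : 0 <= l ->
  (1 - D%:R * beta) * ((1 + 2 * l) * sqnorm (fun x => F x - ex mu F)) <=
  talagrand_const * \sum_j sqnorm (res j F) +
  expR (2 * l) * \sum_j onenorm (res j F) ^+ 2.
Proof.
move=> l0; set F' := fun x => _.
have resE j : res j F' = res j F.
  apply/funext => x; rewrite /res /F' ceB (ce_cst kK); ring.
have F'0 : ex mu F' = 0 by rewrite /F' exB (ex_cst mu_distr) subrr.
rewrite mulrCA; apply: le_trans (_ : (1 + 2 * l) *
    (\sum_c (sqnorm F' - sqnorm (avg (colour_class c) F'))) <= _).
  by rewrite ler_wpM2l ?colour_gap // addr_ge0 // mulr_ge0.
rewrite [leLHS]mulr_sumr.
apply: le_trans (ler_sum _ (fun c _ => falik_samorodnitsky kK mu_distr mu_rev l F'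
  (@colour_class_indep c) (colour_class_uniq c))) _.
rewrite big_split /= sumr_const card_ord -mulr_sumr sum_colour_class.
under eq_bigr do rewrite resE.
under [X in _ + _ * X <= _]eq_bigr do rewrite resE.
by rewrite lerD2r /talagrand_const -[leLHS]mulr_natl mulrA.
Qed.

(** The weight [h j] stands for the probability that [F] is sensitive to [j]. Since
    [h j <= 1], the [L^1] and the squared [L^2] influences of [j] are both of order
    [ex mu (h j)], and the square of the former gains a factor [eta]. *)
Theorem talagrand_localized l (a eta : R) F (h : V -> conf -> R) : 0 <= l -> 0 <= a ->
  (forall j x, 0 <= h j x <= 1) ->
  (forall j x w, `|F (upd x j w) - F x| <= a * (h j x + h j (upd x j w))) ->
  (forall j, ex mu (h j) <= eta) ->
  (1 - D%:R * beta) * ((1 + 2 * l) * sqnorm (fun x => F x - ex mu F)) <=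
  4 * a ^+ 2 * (talagrand_const + expR (2 * l) * eta) * \sum_j ex mu (h j).
Proof.
move=> l0 a0 h01 Fh heta; apply: le_trans (talagrand F l0) _.
have h0 j x : 0 <= h j x by case/andP: (h01 j x).
have h1 j x : h j x <= 1 by case/andP: (h01 j x).
have eh0 j : 0 <= ex mu (h j) by exact: (ex_ge0 mu_distr).
have resl j x : `|res j F x| <= a * (h j x + E j (h j) x).
  have -> : res j F x = \sum_w k j x w * (F x - F (upd x j w)).
    under [RHS]eq_bigr do rewrite mulrBr.
    by rewrite sumrB -mulr_suml (k_sum kK) mul1r.
  apply: le_trans (ler_norm_sum _ _ _) _.
  have -> : a * (h j x + E j (h j) x) = \sum_w k j x w * (a * (h j x + h j (upd x j w))).
    rewrite -[h j x in LHS]mul1r -(k_sum kK j x) mulr_suml /ce -big_split /= mulr_sumr.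
    by apply: eq_bigr => w _; ring.
  apply: ler_sum => w _; rewrite normrM ger0_norm ?(k_ge0 kK) //.
  by rewrite ler_wpM2l ?(k_ge0 kK) // distrC.
have Eh0 j x : 0 <= E j (h j) x.
  by rewrite -(ce_cst kK j 0 x); apply: (le_ce kK).
have Eh1 j x : E j (h j) x <= 1.
  by rewrite -(ce_cst kK j 1 x); apply: (le_ce kK).
have one j : onenorm (res j F) <= 2 * a * ex mu (h j).
  have -> : 2 * a * ex mu (h j) = ex mu (fun x => a * (h j x + E j (h j) x)).
    by rewrite exZ exD (ex_ce kK (mu_rev j)); ring.
  exact: (le_ex mu_distr).
have two j : sqnorm (res j F) <= 4 * a ^+ 2 * ex mu (h j).
  have -> : 4 * a ^+ 2 * ex mu (h j) = ex mu (fun x => 2 * a ^+ 2 * (h j x + E j (h j) x)).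
    by rewrite exZ exD (ex_ce kK (mu_rev j)); ring.
  apply: (le_ex mu_distr) => x; rewrite -(real_normK (num_real (res j F x))).
  apply: le_trans (_ : (a * (h j x + E j (h j) x)) ^+ 2 <= _).
    rewrite lerXn2r ?nnegrE //; first by rewrite mulr_ge0 // addr_ge0.
  rewrite exprMn (_ : 2 * a ^+ 2 * _ = a ^+ 2 * (2 * (h j x + E j (h j) x))); last ring.
  apply: ler_wpM2l; first exact: sqr_ge0.
  rewrite expr2 ler_wpM2r ?addr_ge0 //.
  have := h1 j x; have := Eh1 j x; lra.
have tc := talagrand_const_ge0.
have s2 : talagrand_const * \sum_j sqnorm (res j F) <=
    talagrand_const * (4 * a ^+ 2 * \sum_j ex mu (h j)).
  by rewrite ler_wpM2l // mulr_sumr; apply: ler_sum.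
have s1 : \sum_j onenorm (res j F) ^+ 2 <= 4 * a ^+ 2 * eta * \sum_j ex mu (h j).
  rewrite mulr_sumr; apply: ler_sum => j _.
  apply: le_trans (_ : (2 * a * ex mu (h j)) ^+ 2 <= _).
    rewrite lerXn2r ?nnegrE ?(onenorm_ge0 mu_distr) //.
    by rewrite mulr_ge0 // mulr_ge0.
  have -> : (2 * a * ex mu (h j)) ^+ 2 = 4 * a ^+ 2 * ex mu (h j) * ex mu (h j) by ring.
  rewrite ler_wpM2r // ler_wpM2l // mulr_ge0 //; exact: sqr_ge0.
have := ler_wpM2l (expR_ge0 (2 * l)) s1; lra.
Qed.

End Colouring.
End Gap.

Local Open Scope classical_set_scope.
Local Open Scope ring_scope.

(** * Local functions of a random field *)

Lemma generated_bigcap (T : Type) (J : choiceType) (G : set (set T)) (A : {fset J})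
    (F : J -> set T) : (forall i, i \in A -> <<s G >> (F i)) ->
  <<s G >> (\bigcap_(i in [set` A]) F i).
Proof.
move=> GF.
have [GT _ _ GI] : [/\ <<s G >> setT, setSD_closed <<s G >>, ndseq_closed <<s G >>
    & setI_closed <<s G >>].
  by apply/sigma_algebraP; [move=> X _ x|exact: smallest_sigma_algebra].
rewrite bigcap_seq big_seq; apply: (big_ind (fun B => <<s G >> B)) => //.
Qed.

Section Cylinders.
Context {I : choiceType} {W : finType}.
Implicit Types (x y z : I -> W) (A B : {fset I}).

Definition agree A x y : Prop := forall i, i \in A -> x i = y i.

Definition local {T : Type} A (G : (I -> W) -> T) : Prop :=
  forall x y, agree A x y -> G x = G y.

Lemma local_sub (T : Type) A B (G : (I -> W) -> T) :
  (A `<=` B)%fset -> local A G -> local B G.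
Proof. by move=> /fsubsetP AB GA x y xy; apply: GA => i iA; exact: xy (AB _ iA). Qed.

(** The configuration [x] with boundary condition [z]. *)
Definition glue z {B} (x : {ffun B -> W}) : I -> W :=
  fun i => if insub i is Some s then x s else z i.

Lemma glue_in z B (x : {ffun B -> W}) (i : B) : glue z x (val i) = x i.
Proof. by rewrite /glue valK. Qed.

Lemma glue_out z B (x : {ffun B -> W}) i : i \notin B -> glue z x i = z i.
Proof. by move=> iB; rewrite /glue insubN. Qed.

Definition setc x i w : I -> W := fun j => if j == i then w else x j.

Lemma glue_upd z B (x : {ffun B -> W}) (i : B) w :
  glue z (upd x i w) = setc (glue z x) (val i) w.
Proof.
apply/funext => j; rewrite /setc.
have [jB|jB] := boolP (j \in B); last first.
  rewrite !glue_out //; case: eqP => // e; move: jB; rewrite e.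
  by rewrite (valP i).
rewrite (_ : j = val [` jB]%fset) // !glue_in.
have [e|ne] := eqVneq [` jB]%fset i; first by rewrite e upd_at eqxx.
by rewrite upd_off //; case: eqP => // /val_inj e; rewrite e eqxx in ne.
Qed.

Definition restr B x : {ffun B -> W} := [ffun i => x (val i)].

Lemma glue_restr z B x : agree B (glue z (restr B x)) x.
Proof.
by move=> i iB; rewrite (_ : i = val [` iB]%fset) // glue_in ffunE.
Qed.

End Cylinders.

Section RandomField.
Context (disp : measure_display) (Omega : measurableType disp) (R : realType).
Variables (P : probability Omega R) (W : finType) (I : choiceType).
Variable sigma : I -> Omega -> W.
Hypothesis sigma_meas : random_field sigma.
Implicit Types (z : I -> W) (A B : {fset I}).

Definition cyl A (y : I -> W) : set Omega := [set o | agree A (sigma ^~ o) y].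

Lemma cyl_bigcap A y : cyl A y = \bigcap_(i in [set` A]) sigma i @^-1` [set y i].
Proof. by apply/seteqP; split=> o h i; exact: h. Qed.

Lemma measurable_cyl A y : measurable (cyl A y).
Proof. by rewrite cyl_bigcap; apply: fin_bigcap_measurable => // i _; exact: sigma_meas. Qed.

Definition pc A y : R := fine (P (cyl A y)).

Lemma pcE A y : P (cyl A y) = (pc A y)%:E.
Proof. by rewrite /pc fineK // fin_num_measure //; exact: measurable_cyl. Qed.

Lemma pc_ge0 A y : 0 <= pc A y.
Proof. by rewrite -lee_fin -pcE. Qed.

Lemma eq_pc A y y' : agree A y y' -> pc A y = pc A y'.
Proof.
move=> h; rewrite /pc; congr (fine (P _)); apply/seteqP; split=> o ho i iA.
  by rewrite ho // h.
by rewrite ho // h.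
Qed.

(** Distribution of the field in [B]; [z] completes [x] to a configuration. *)
Definition law B z (x : {ffun B -> W}) : R := pc B (glue z x).

Definition Ep (G : (I -> W) -> R) : R := fine ('E_P[fun o => G (sigma ^~ o)])%E.

(** A local function is a finite combination of indicators of cylinders. *)
Lemma expectation_local B z (G : (I -> W) -> R) : local B G ->
  ('E_P[fun o => G (sigma ^~ o)] = (ex (@law B z) (fun x => G (glue z x)))%:E)%E.
Proof.
move=> GB; rewrite unlock.
have E o : (G (sigma ^~ o))%:E =
  (\sum_(x : {ffun B -> W}) (G (glue z x))%:E * (\1_(cyl B (glue z x)) o)%:E)%E.
  rewrite (bigD1 (restr B (sigma ^~ o))) //= big1 => [|x xn].
    rewrite adde0 indicE mem_set ?mule1; last first.
      by move=> i iB; rewrite (glue_restr z (sigma ^~ o) iB).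
    congr (_%:E); apply: GB => i iB; exact/esym/glue_restr.
  rewrite indicE memNset ?mule0 //= => h; move/eqP: xn; apply.
  by apply/ffunP => i; rewrite ffunE h ?glue_in // (valP i).
under eq_integral do rewrite E.
have intx (x : {ffun B -> W}) : P.-integrable setT
    (fun o => (\1_(cyl B (glue z x)) o)%:E : \bar R).
  by apply: integrable_indic; exact: measurable_cyl.
rewrite integral_sum //; last by move=> x; apply: integrableZl.
rewrite /ex -sumEFin; apply: eq_bigr => x _.
rewrite integralZl // integral_indic //; last exact: measurable_cyl.
by rewrite setIT [X in (_ * X)%E]pcE -EFinM mulrC.
Qed.

Lemma Ep_law B z G : local B G -> Ep G = ex (@law B z) (fun x => G (glue z x)).
Proof. by move=> GB; rewrite /Ep (expectation_local z GB). Qed.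

Lemma law_distr B z : distribution (@law B z).
Proof.
split=> [x|]; first exact: pc_ge0.
have := @expectation_local B z (fun=> 1) (fun _ _ _ => erefl).
rewrite expectation_cst => /eqP; rewrite eqe => /eqP e.
by rewrite e; apply: eq_bigr => x _; rewrite mulr1.
Qed.

Lemma config_inhabited : exists z : I -> W, True.
Proof.
have : [set: Omega] !=set0.
  apply/set0P/eqP => h; have := probability_setT P; rewrite h measure0 => /eqP.
  by rewrite eqe eq_sym oner_eq0.
by case=> o _; exists (sigma ^~ o).
Qed.

(** The variance minimizes the mean square distance to a constant. *)
Lemma variance_local_le B G c : local B G ->
  ('V_P[fun o => G (sigma ^~ o)] <= (Ep (fun x => (G x - c) ^+ 2))%:E)%E.
Proof.
move=> GB; have [z _] := config_inhabited.
have GB2 m : local B (fun x => (G x - m) ^+ 2) by move=> x y xy; rewrite (GB _ _ xy).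
rewrite /variance unlock -/(Ep G).
have -> : (('E_P[((fun o => G (sigma ^~ o)) \- cst (Ep G)) *
     ((fun o => G (sigma ^~ o)) \- cst (Ep G))]) = (Ep (fun x => (G x - Ep G) ^+ 2))%:E)%E.
  rewrite (Ep_law z (GB2 _)) -(expectation_local z (GB2 _)).
  by congr expectation.
rewrite lee_fin !(Ep_law z (GB2 _)) (Ep_law z GB).
set p := law _; set m := ex p (fun x => G (glue z x)).
have pd : distribution p := law_distr B z.
rewrite -subr_ge0 -exB.
set u := ex _ _; suff -> : u = (m - c) ^+ 2 by exact: sqr_ge0.
rewrite /u (eq_ex _ (g := fun x => 2 * (m - c) * G (glue z x) - (m ^+ 2 - c ^+ 2))) => [|x].
  by rewrite exB exZ (ex_cst pd) -/m; ring.
by ring.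
Qed.

End RandomField.

(** * Finite-volume approximation of a Markov field *)

Section Boxes.
Context {I : choiceType} (nbrs : I -> {fset I}).

Definition thicken (A : {fset I}) : {fset I} := (A `|` \bigcup_(i <- A) nbrs i)%fset.

Definition box A n := iter n thicken A.

Lemma thicken_sub A : (A `<=` thicken A)%fset.
Proof. exact: fsubsetUl. Qed.

Lemma thicken_nbrs A i j : i \in A -> j \in nbrs i -> j \in thicken A.
Proof.
move=> iA ji; rewrite /thicken inE; apply/orP; right.
by apply/bigfcupP; exists i => //; rewrite iA.
Qed.

Lemma box_sub A m n : (m <= n)%N -> (box A m `<=` box A n)%fset.
Proof.
move=> /subnK <-; elim: (n - m)%N => [|l IH]; first exact: fsubset_refl.
by apply: fsubset_trans IH _; exact: thicken_sub.
Qed.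

End Boxes.

Section Field.
Context (disp : measure_display) (Omega : measurableType disp) (R : realType).
Variables (P : probability Omega R) (W : finType) (I : choiceType).
Variables (nbrs : I -> {fset I}) (sigma : I -> Omega -> W) (q : specification R W nbrs).
Arguments q : clear implicits.
Notation restrict i x := (Defs.restrict nbrs i x).
Hypothesis sigma_markov : markov_random_field P sigma q.

Variables (D cn : nat) (beta alpha : R) (col : I -> 'I_cn.+1).
Hypothesis nbrs_sym : forall i j, (j \in nbrs i) = (i \in nbrs j).
Hypothesis nbrs_irr : forall i, i \notin nbrs i.
Hypothesis nbrs_deg : forall i, (#|` nbrs i| <= D)%N.
Hypothesis q_minor : forall i, 1 - beta <= gamma q i.
Hypothesis q_atom : forall i eta w, q i eta w = 0 \/ alpha <= q i eta w.
Hypothesis alpha_pos : 0 < alpha.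
Hypothesis beta_nneg : 0 <= beta.
Hypothesis beta_small : beta < 1.
Hypothesis beta_sub : D%:R * beta < 1.
Hypothesis col_nbrs : forall i j, j \in nbrs i -> col i != col j.

Implicit Types (z : I -> W) (A B : {fset I}).

Let sigma_meas : random_field sigma. Proof. by case: sigma_markov. Qed.
Notation pc := (pc P sigma).
Notation law := (law P sigma).
Notation Ep := (Ep P sigma).

Lemma q_local i (x y : I -> W) w : agree (nbrs i) x y ->
  q i (restrict i x) w = q i (restrict i y) w.
Proof.
move=> xy; congr (q _ _ w); apply/ffunP => j; rewrite !ffunE; apply: xy.
exact: (valP j).
Qed.

Lemma outer_cyl i A (y : I -> W) : i \notin A ->
  outer_sigma_algebra sigma i (cyl sigma A y).
Proof.
move=> iA; rewrite cyl_bigcap.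
apply: generated_bigcap => j jA.
apply: sub_sigma_algebra; exists j, (y j); split=> //.
by move=> e; move: iA; rewrite -e => /negP; apply.
Qed.

(** The Markov property on cylinders: on the cylinder over [A] minus [i] the
    conditional probability is constant, since [A] contains the neighbours of [i]. *)
Lemma dlr i A (y : I -> W) : i \in A -> (nbrs i `<=` A)%fset ->
  pc A y = q i (restrict i y) (y i) * pc (A `\ i)%fset y.
Proof.
move=> iA nA.
have [_ _ _ /(_ i (y i)) [_ h]] := sigma_markov.
have iD : i \notin (A `\ i)%fset by rewrite !inE eqxx.
have {h} := h _ (outer_cyl y iD).
have -> : cyl sigma (A `\ i)%fset y `&` sigma i @^-1` [set y i] = cyl sigma A y.
  apply/seteqP; split=> o.
    move=> [h1 h2] j jA; have [->|ji] := eqVneq j i; first exact: h2.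
    by apply: h1; rewrite !inE ji.
  move=> h; split; last exact: h.
  by move=> j; rewrite !inE => /andP[_]; exact: h.
rewrite (pcE P sigma_meas) => h; apply: EFin_inj; rewrite h.
under eq_integral => o oc.
  rewrite (@q_local i (sigma ^~ o) y (y i)); last first.
    move=> j ji; move: oc; rewrite inE; apply; rewrite !inE (fsubsetP nA) // andbT.
    by apply: contraTneq ji => ->; exact: nbrs_irr.
  over.
rewrite -/(cst (q i (restrict i y) (y i))%:E) integral_cst; last exact: measurable_cyl.
by rewrite [X in (_ * X)%E](pcE P sigma_meas) EFinM.
Qed.

Section Box.
Variables (B : {fset I}) (z : I -> W).

Definition box_adj : rel B := fun i j => val j \in nbrs (val i).

Definition box_kernel (i : B) (x : {ffun B -> W}) (w : W) : R :=
  q (val i) (restrict (val i) (glue z x)) w.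

Lemma box_kernelP : kernel box_adj D beta alpha box_kernel.
Proof.
have [_ q0 qs _] := sigma_markov.
split=> //.
- by move=> i j; rewrite /box_adj nbrs_sym.
- by move=> i; exact: nbrs_irr.
- move=> i; apply: leq_trans (nbrs_deg (val i)).
  rewrite cardE -(size_map val) uniq_leq_size ?(map_inj_uniq val_inj) ?enum_uniq //.
  by move=> _ /mapP[j + ->]; rewrite mem_enum inE.
- by move=> i x w; exact: q0.
- by move=> i x; exact: qs.
- move=> i x y xy w; apply: q_local => j ji.
  have [jB|jB] := boolP (j \in B); last by rewrite !glue_out.
  by rewrite (_ : j = val [` jB]%fset) // !glue_in; apply: xy.
- move=> i; exists (gamma_at q (val i)); split; first exact: q_minor.
  by move=> x w; exact: bigmin_le.
- by move=> i x w; exact: q_atom.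
Qed.

Lemma glue_agree_nbr (i : B) (x : {ffun B -> W}) w A :
  val i \notin A -> agree A (glue z (upd x i w)) (glue z x).
Proof. by move=> iA j jA; rewrite glue_upd /setc; case: eqP => // e; rewrite -e jA in iA. Qed.

(** At a site whose neighbours lie in the box, the field has the conditional
    distribution of the Gibbs measure, whatever the boundary condition. *)
Lemma law_resampled (i : B) (x : {ffun B -> W}) : (nbrs (val i) `<=` B)%fset ->
  law z x = resampled box_kernel (law (B := B) z) i x.
Proof.
move=> nB.
have e (u : {ffun B -> W}) w : law z (upd u i w) =
    box_kernel i u w * pc (B `\ val i)%fset (glue z u).
  rewrite /(law _ _) (dlr (i := val i)) // ?(valP i) // glue_in upd_at; congr (_ * _).
    by apply: q_local; apply: glue_agree_nbr; exact: nbrs_irr.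
  by apply: eq_pc; apply: glue_agree_nbr; rewrite !inE eqxx.
rewrite /resampled -{1}(upd_self x i) e; congr (_ * _).
under eq_bigr do rewrite e.
by rewrite -mulr_suml (k_sum box_kernelP) mul1r.
Qed.

(** The Gibbs measure in [B] with boundary condition [z], as a conditional
    distribution of the field given [z] on the layer around [B]. *)
Definition box_weight (x : {ffun B -> W}) : R := pc (thicken nbrs B) (glue z x).
Definition box_measure x : R := box_weight x / \sum_y box_weight y.

Lemma box_measureP : 0 < pc (thicken nbrs B) z -> distribution box_measure.
Proof.
move=> z0.
have w0 x : 0 <= box_weight x by exact: pc_ge0.
have Z0 : 0 < \sum_y box_weight y.
  apply: lt_le_trans z0 _.
  rewrite (bigD1 (restr B z)) //= -[X in X <= _]addr0; apply: lerD; last exact: sumr_ge0.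
  rewrite /box_weight le_eqVlt; apply/orP; left; apply/eqP; apply: eq_pc => i _.
  have [iB|iB] := boolP (i \in B); last by rewrite glue_out.
  by rewrite glue_restr.
split=> [x|]; first by rewrite divr_ge0 // ltW.
by rewrite -mulr_suml divff // gt_eqF.
Qed.

Lemma box_measure_rev i : reversible box_kernel i box_measure.
Proof.
have e (u : {ffun B -> W}) w : box_weight (upd u i w) =
    box_kernel i u w * pc (thicken nbrs B `\ val i)%fset (glue z u).
  have iT : val i \in thicken nbrs B by apply: (fsubsetP (thicken_sub _ _)); exact: (valP i).
  rewrite /box_weight (dlr (i := val i)) // ?glue_in ?upd_at.
    congr (_ * _).
      by apply: q_local; apply: glue_agree_nbr; exact: nbrs_irr.
    by apply: eq_pc; apply: glue_agree_nbr; rewrite !inE eqxx.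
  by apply/fsubsetP => j; apply: thicken_nbrs; exact: (valP i).
move=> x w; rewrite /box_measure e -{1}(upd_self x i) e; ring.
Qed.

End Box.

(** The influence of the boundary decays geometrically with the number of layers
    that separate it from [A]: resampling moves the field only next to the boundary,
    and each round of the comparison carries this error one layer further. *)
Lemma box_comparison A n z (G : (I -> W) -> R) K : 0 <= K -> local A G ->
  (forall x y, `|G x - G y| <= K) ->
  let B := box nbrs A n in
  0 < pc (thicken nbrs B) z ->
  `|Ep G - ex (box_measure (B := B) z) (fun x => G (glue z x))| <=
    #|` A|%:R * (2 / (1 - D%:R * beta)) * K * (D%:R * beta) ^+ n.
Proof.
move=> K0 GA GK B z0.
have AB : (A `<=` B)%fset by apply: (@box_sub _ _ A 0).
have GB : local B G by apply: local_sub GA.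
rewrite (Ep_law P sigma_meas z GB).
have kK := box_kernelP B z.
have muD := box_measureP z0.
have lD := law_distr P sigma_meas B z.
(* The [l^1] distance of two distributions is at most [2]. *)
pose t (i : B) : R := if (nbrs (val i) `<=` B)%fset then 0 else 2.
pose c : R := 2 / (1 - D%:R * beta).
have d1 : 0 < 1 - D%:R * beta by rewrite subr_gt0.
have db0 : 0 <= D%:R * beta by rewrite mulr_ge0.
have c2 : 2 <= c by rewrite ler_pdivlMr //; lra.
have t0 i : 0 <= t i by rewrite /t; case: ifP.
have tc i : t i <= c * (1 - D%:R * beta).
  by rewrite divfK ?gt_eqF // /t; case: ifP.
have fd : osc (fun x : {ffun B -> W} => G (glue z x)) (fun j => if val j \in A then K else 0).
  split=> [j|j x w]; first by case: ifP.
  case: ifP => jA //; rewrite (GA (glue z (upd x j w)) (glue z x)) ?subrr ?normr0 //.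
  by apply: glue_agree_nbr; rewrite jA.
have muE i (_ : predT i) f : ex (box_measure (B := B) z) (ce (box_kernel z) i f) =
    ex (box_measure (B := B) z) f.
  by apply: (ex_ce kK); exact: box_measure_rev.
have lt (i : B) (_ : predT i) : \sum_x `|law (B := B) z x - resampled (box_kernel z) (law (B := B) z) i x| <= t i.
  rewrite /t; case: ifP => h.
    by rewrite big1 // => x _; rewrite -law_resampled // subrr normr0.
  have -> : 2 = \sum_x law (B := B) z x + \sum_x resampled (box_kernel z) (law (B := B) z) i x :> R.
    have e1 : ex (law (B := B) z) (ce (box_kernel z) i (fun=> 1)) = 1.
      rewrite (eq_ex _ (g := fun=> 1)) ?(ex_cst lD) // => x.
      by rewrite (ce_cst kK).
    have := ex_resampled kK (law (B := B) z) i (fun=> 1).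
    rewrite e1 /ex; under eq_bigr do rewrite mulr1.
    by move=> ->; rewrite (distr_sum lD).
  rewrite -big_split /=; apply: ler_sum => x _; apply: le_trans (ler_normB _ _) _.
  have r0 : 0 <= resampled (box_kernel z) (law (B := B) z) i x.
    by rewrite mulr_ge0 ?(k_ge0 kK) // sumr_ge0 // => w _; exact: (distr_ge0 lD).
  by rewrite !ger0_norm // (distr_ge0 lD).
have init : controls (law (B := B) z) (box_measure (B := B) z) (bound (@box_adj B) beta predT t c 0).
  move=> f d fdd; apply: (ex_diff_le (Q := predT)) => // x y _ _.
  apply: le_trans (osc_dist _ _ fdd) _.
  rewrite big_mkcond /=; apply: ler_sum => j _; have dj := proj1 fdd j.
  case: ifP => _; last by rewrite mulr_ge0 //; apply: le_trans c2.
  by rewrite ler_peMl //; apply: le_trans c2; rewrite ler1n.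
have decay m : (m <= n)%N -> forall j : B, val j \in box nbrs A (n - m) ->
    bound (@box_adj B) beta predT t c m j <= c * (D%:R * beta) ^+ m.
  elim: m => [|m IH] mn j jb; first by rewrite expr0 mulr1.
  rewrite /= /relax /=.
  have nj : forall l, l \in nbrs (val j) -> l \in box nbrs A (n - m).
    move=> l lj; rewrite -(subnSK mn).
    by rewrite /box iterS; exact: thicken_nbrs lj.
  have -> : t j = 0.
    rewrite /t ifT //; apply/fsubsetP => l /nj; apply/fsubsetP; apply: box_sub; exact: leq_subr.
  rewrite add0r exprS.
  apply: le_trans (_ : \sum_i (box_adj j i)%:R * beta *
     (if box_adj j i then bound (@box_adj B) beta predT t c m i else 0) <= _).
    apply: ler_sum => i _; case: (box_adj j i) => //; by rewrite !mul0r.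
  rewrite mulrCA; apply: (sum_adj_le kK).
    by rewrite mulr_ge0 ?exprn_ge0 //; apply: le_trans c2.
  move=> i; case: ifP => ji; last by rewrite mulr_ge0 ?exprn_ge0 //; apply: le_trans c2.
  by apply: IH; [exact: ltnW|exact: nj].
apply: le_trans (controls_bound kK t0 tc muE lt init n fd) _.
apply: le_trans (_ : \sum_(j : B | val j \in A) c * (D%:R * beta) ^+ n * K <= _).
  rewrite [leRHS]big_mkcond /=; apply: ler_sum => j _; case: ifP => jA; last by rewrite mulr0.
  by rewrite ler_wpM2r //; apply: decay; rewrite ?subnn.
rewrite sumr_const -[leLHS]mulr_natl -/c.
have -> : #|` A|%:R * c * K * (D%:R * beta) ^+ n = #|` A|%:R * (c * (D%:R * beta) ^+ n * K) by ring.
rewrite ler_wpM2r ?mulr_ge0 ?exprn_ge0 //; first by rewrite invr_ge0 ltW.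
rewrite ler_nat cardE -(size_map val) uniq_leq_size ?(map_inj_uniq val_inj) ?enum_uniq //.
by move=> _ /mapP[j + ->]; rewrite mem_enum.
Qed.

Lemma positive_config A : exists z, 0 < pc A z.
Proof.
have [z0 _] := config_inhabited P sigma.
have lD := law_distr P sigma_meas A z0.
apply: contrapT => h; have := distr_sum lD; rewrite big1 => [/eqP|x _].
  by rewrite eq_sym oner_eq0.
apply/eqP; rewrite eq_le (distr_ge0 lD) andbT leNgt; apply/negP => lp.
by apply: h; exists (glue z0 x).
Qed.

Lemma local_bounded A (F : (I -> W) -> R) : local A F ->
  exists2 K, 0 <= K & forall x y, `|F x - F y| <= K.
Proof.
move=> FA; have [z _] := config_inhabited P sigma.
pose f (x : {ffun A -> W}) := F (glue z x).
exists (\sum_x \sum_y `|f x - f y|); first by apply: sumr_ge0 => x _; exact: sumr_ge0.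
move=> x y.
have e u : F u = f (restr A u) by apply: FA => i iA; rewrite glue_restr.
rewrite !e (bigD1 (restr A x)) //= (bigD1 (restr A y)) //= -addrA lerDl.
by rewrite addr_ge0 ?sumr_ge0 // => u _; rewrite sumr_ge0.
Qed.

(** The localized inequality in infinite volume. The centring constant is the
    mean under the approximating Gibbs measure, hence depends on [eps]. *)
Theorem field_variance (l a eta Hs : R) A F (h : I -> (I -> W) -> R) :
  0 <= l -> 0 <= a -> 0 <= eta -> 0 <= Hs -> local A F -> (forall j, local A (h j)) ->
  (forall j x, 0 <= h j x <= 1) ->
  (forall x j w, `|F (setc x j w) - F x| <= a * (h j x + h j (setc x j w))) ->
  (forall j, Ep (h j) <= eta) ->
  (forall B x, \sum_(j : B) h (val j) x <= Hs) ->
  forall eps, 0 < eps -> exists c,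
  (1 - D%:R * beta) * ((1 + 2 * l) * Ep (fun x => (F x - c) ^+ 2)) <=
  4 * a ^+ 2 * (talagrand_const (W := W) D beta alpha cn + expR (2 * l) * eta) * Hs + eps.
Proof.
move=> l0 a0 eta0 Hs0 FA hA h01 Fh heta hH eps eps0.
have [K K0 FK] := local_bounded FA.
have d1 : 0 < 1 - D%:R * beta by rewrite subr_gt0.
have db0 : 0 <= D%:R * beta by rewrite mulr_ge0.
(* [M1 * e] and [M2 * e] are the errors of replacing the field by the Gibbs measure
   in the weights [h] and in the variance. *)
pose M1 := 4 * a ^+ 2 * expR (2 * l) * Hs.
pose M2 := (1 - D%:R * beta) * ((1 + 2 * l) * (2 * K ^+ 2)).
have M10 : 0 <= M1.
  by rewrite /M1; apply: mulr_ge0 => //; apply: mulr_ge0 (expR_ge0 _); apply: mulr_ge0 => //; exact: sqr_ge0.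
have M20 : 0 <= M2.
  rewrite /M2; apply: mulr_ge0; first exact: ltW.
  apply: mulr_ge0; first by rewrite addr_ge0 // mulr_ge0.
  by apply: mulr_ge0 => //; exact: sqr_ge0.
pose e := eps / (M1 + M2 + 1).
have Mp : 0 < M1 + M2 + 1 by lra.
have e0 : 0 < e by rewrite divr_gt0.
have [n hn] : exists n, #|` A|%:R * (2 / (1 - D%:R * beta)) * (D%:R * beta) ^+ n <= e.
  apply: contrapT => hN.
  have : e <= 0.
    apply: (@le_geometric_limit _ _ _ (#|` A|%:R * (2 / (1 - D%:R * beta))) (D%:R * beta)).
      by rewrite db0.
    by move=> m; rewrite add0r leNgt; apply/negP => /ltW le; apply: hN; exists m.
  by rewrite leNgt e0.
pose B := box nbrs A n.
have [z zp] := positive_config (thicken nbrs B).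
have cmp G C : 0 <= C -> local A G -> (forall x y, `|G x - G y| <= C) ->
    `|Ep G - ex (box_measure (B := B) z) (fun x => G (glue z x))| <= C * e.
  move=> C0 GA GC; apply: le_trans (box_comparison C0 GA GC zp) _.
  have -> : #|` A|%:R * (2 / (1 - D%:R * beta)) * C * (D%:R * beta) ^+ n =
     C * (#|` A|%:R * (2 / (1 - D%:R * beta)) * (D%:R * beta) ^+ n) by ring.
  exact: ler_wpM2l.
have muD := box_measureP zp.
pose mu := box_measure (B := B) z.
pose c := ex mu (fun x => F (glue z x)).
have Fc x : `|F x - c| <= K.
  have -> : F x - c = ex mu (fun y => F x - F (glue z y)) by rewrite exB (ex_cst muD).
  apply: le_trans (ex_norm muD _) _; rewrite -[leRHS](ex_cst muD).
  by apply: (le_ex muD) => y; exact: FK.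
exists c.
have tal := @talagrand_localized R B W _ D beta alpha (box_kernel z) (box_kernelP B z) mu
  muD (fun i => @box_measure_rev B z i) cn (fun i => col (val i))
  (fun i j ij => col_nbrs ij) l a (eta + e) (fun x => F (glue z x))
  (fun j x => h (val j) (glue z x)) l0 a0 (fun j x => h01 _ _).
have tal1 : (1 - D%:R * beta) * ((1 + 2 * l) * sqnorm mu (fun x => F (glue z x) - c)) <=
   4 * a ^+ 2 * (talagrand_const (W := W) D beta alpha cn + expR (2 * l) * (eta + e)) * Hs.
  apply: le_trans (tal _ _) _.
  - by move=> j x w; rewrite glue_upd; exact: Fh.
  - move=> j; have := cmp (h (val j)) 1 ler01 (hA _) _; rewrite mul1r => hc.
    have : `|Ep (h (val j)) - ex mu (fun x => h (val j) (glue z x))| <= e.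
      apply: hc => x y; have /andP[? ?] := h01 (val j) x; have /andP[? ?] := h01 (val j) y.
      by rewrite ler_norml; apply/andP; split; lra.
    by rewrite ler_norml => /andP[]; have := heta (val j); lra.
  apply: ler_wpM2l.
    apply: mulr_ge0; first by apply: mulr_ge0 => //; exact: sqr_ge0.
    apply: addr_ge0; first exact: (talagrand_const_ge0 (box_kernelP B z)).
    by apply: mulr_ge0; [exact: expR_ge0|rewrite addr_ge0 // ltW].
  rewrite -(ex_sum mu (index_enum B) (fun j x => h (val j) (glue z x))).
  by rewrite -[leRHS](ex_cst muD); apply: (le_ex muD) => x; exact: hH.
have F2 : Ep (fun x => (F x - c) ^+ 2) <= sqnorm mu (fun x => F (glue z x) - c) + 2 * K ^+ 2 * e.
  have : `|Ep (fun x => (F x - c) ^+ 2) - ex mu (fun x => (F (glue z x) - c) ^+ 2)| <= 2 * K ^+ 2 * e.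
    apply: cmp; first by apply: mulr_ge0 => //; exact: sqr_ge0.
      by move=> x y xy; rewrite (FA _ _ xy).
    move=> x y; rewrite subr_sqr normrM.
    have -> : 2 * K ^+ 2 = K * (K + K) by ring.
    apply: ler_pM => //; first by rewrite opprB addrA subrK.
    by apply: le_trans (ler_normD _ _) _; rewrite lerD.
  by rewrite ler_norml /sqnorm => /andP[]; lra.
have : (1 - D%:R * beta) * ((1 + 2 * l) * Ep (fun x => (F x - c) ^+ 2)) <=
  (1 - D%:R * beta) * ((1 + 2 * l) * (sqnorm mu (fun x => F (glue z x) - c) + 2 * K ^+ 2 * e)).
  rewrite ler_wpM2l ?(ltW d1) // ler_wpM2l // addr_ge0 // mulr_ge0 //.
have ee : (M1 + M2) * e <= eps.
  rewrite /e mulrCA ger_pMr // ler_pdivrMr //; lra.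
rewrite /M1 /M2 in ee; lra.
Qed.

End Field.

(** * First-passage times and geodesics *)

Section Norm.
Context {d : nat}.
Implicit Types u v : vertex d.

Lemma l1normD u v : (l1norm (u + v)%R <= l1norm u + l1norm v)%N.
Proof. rewrite /l1norm -big_split /=; apply: leq_sum => i _.
by rewrite mxE; move: (u ord0 i) (v ord0 i) => a b; lia. Qed.

Lemma l1normN u : l1norm (- u) = l1norm u.
Proof. by apply: eq_bigr => i _; rewrite mxE abszN. Qed.

Lemma l1normB u v : l1norm (u - v) = l1norm (v - u).
Proof. by rewrite -l1normN opprB. Qed.

Lemma l1norm0 : l1norm (0 : vertex d) = 0%N.
Proof. by rewrite /l1norm big1 // => i _; rewrite mxE. Qed.

Lemma l1norm_eq0 u : (l1norm u == 0%N) = (u == 0).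
Proof.
apply/idP/eqP => [|->]; last by rewrite l1norm0.
rewrite sum_nat_eq0 => /forallP h; apply/rowP => i.
by have := h i; rewrite /= absz_eq0 mxE => /eqP.
Qed.

End Norm.

(** What the argument needs to know of paths, for sites and bonds at once: a path is
    seen through the sequence of the items, sites or bonds, whose passage times it
    collects. Two concatenated paths of sites share a vertex, which counts once;
    hence the prefix [r] in [path_cat]. In [path_cut] the segment between two items
    is replaced by a straight one; its slack allows for both end points of a path of
    sites, and for entering and leaving a bond at either end. *)
Record path_system {d : nat} {I : choiceType} (shift : vertex d -> I -> I)
    (pos : I -> vertex d) (Pth : vertex d -> vertex d -> seq I -> Prop) : Prop := {
  shift_shift : forall z z' i, shift z (shift z' i) = shift (z' + z) i;
  shift_zero : forall i, shift 0 i = i;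
  pos_shift : forall z i, pos (shift z i) = pos i + z;
  path_exists : forall v w, exists s, Pth v w s /\ (size s <= l1norm (w - v)%R + 1)%N;
  path_cat : forall u v w s s', Pth u v s -> Pth v w s' -> exists r s'',
    Pth u w (s ++ s'') /\ s' = r ++ s'';
  path_shift : forall z v w s, Pth v w s -> Pth (v + z) (w + z) [seq shift z i | i <- s];
  path_cut : forall v w s1 s2 s3 u u', Pth v w (s1 ++ u :: s2 ++ u' :: s3) ->
    exists r, (size r <= l1norm (pos u' - pos u)%R + 3)%N /\ Pth v w (s1 ++ r ++ s3);
  path_ball : forall v M, exists A : {fset I}, forall w s, Pth v w s -> (size s <= M)%N ->
    {subset s <= A}
}.

Section FirstPassage.
Context {R : realType} {d : nat} {W : finType} (tv : W -> R) (lo hi : R).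
Hypothesis lo_gt0 : 0 < lo.
Hypothesis lo_le_hi : lo <= hi.
Hypothesis tv_bounds : forall w, lo <= tv w <= hi.
Context {I : choiceType} (shift : vertex d -> I -> I) (pos : I -> vertex d).
Variable Pth : vertex d -> vertex d -> seq I -> Prop.
Hypothesis PS : path_system shift pos Pth.
Implicit Types (x y : I -> W) (u v w z : vertex d) (s r : seq I) (i j : I).

Definition time x s : R := \sum_(i <- s) tv (x i).

Definition passage x v w : R := inf [set time x s | s in [set s | Pth v w s]].

Definition geodesic x v w s : Prop :=
  Pth v w s /\ forall s', Pth v w s' -> time x s <= time x s'.

Lemma time_cat x s r : time x (s ++ r) = time x s + time x r.
Proof. by rewrite /time big_cat. Qed.

Lemma tv_lo c : lo <= tv c. Proof. by case/andP: (tv_bounds c). Qed.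
Lemma tv_hi c : tv c <= hi. Proof. by case/andP: (tv_bounds c). Qed.
Lemma tv_ge0 c : 0 <= tv c. Proof. exact: le_trans (ltW lo_gt0) (tv_lo c). Qed.

Lemma time_lo x s : lo * (size s)%:R <= time x s.
Proof.
rewrite /time; elim: s => [|i s IH]; first by rewrite big_nil mulr0.
by rewrite big_cons /= -natr1 mulrDr mulr1 addrC lerD // tv_lo.
Qed.

Lemma time_hi x s : time x s <= hi * (size s)%:R.
Proof.
rewrite /time; elim: s => [|i s IH]; first by rewrite big_nil mulr0.
by rewrite big_cons /= -natr1 mulrDr mulr1 addrC lerD // tv_hi.
Qed.

Lemma time_ge0 x s : 0 <= time x s.
Proof. by apply: sumr_ge0 => i _; exact: tv_ge0. Qed.

Lemma time_count x s : time x s = \sum_(c : W) (count (fun i => x i == c) s)%:R * tv c.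
Proof.
rewrite /time; elim: s => [|i s IH].
  by rewrite big_nil big1 // => c _; rewrite mul0r.
rewrite big_cons IH [in RHS](bigD1 (x i)) //= eqxx natrD mulrDl mul1r -addrA; congr (_ + _).
rewrite (bigD1 (x i)) //=; congr (_ + _); apply: eq_bigr => c ci.
by rewrite eq_sym (negbTE ci).
Qed.

(** The time of a path depends on the numbers of symbols that it meets; paths
    that compete with a given one are not longer than some bound, so that their
    times take finitely many values. *)
Lemma geodesic_exists x v w : exists s, geodesic x v w s.
Proof.
have [s0 [Ps0 _]] := path_exists PS v w.
pose M := Num.bound (time x s0 / lo).
have HM : time x s0 <= lo * M%:R.
  rewrite -ler_pdivrMl // mulrC; apply: ltW.
  by rewrite /M; apply: archi_boundP; rewrite divr_ge0 ?time_ge0 ?ltW.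
pose Q (f : {ffun W -> 'I_M.+1}) := `[< exists s, Pth v w s /\
   forall c, count (fun i => x i == c) s = f c >].
pose val_ (f : {ffun W -> 'I_M.+1}) := \sum_(c : W) (f c : nat)%:R * tv c.
have toQ s : Pth v w s -> (size s <= M)%N -> exists2 f, Q f & val_ f = time x s.
  move=> Ps sM; pose f : {ffun W -> 'I_M.+1} := [ffun c => inord (count (fun i => x i == c) s)].
  have fc c : f c = count (fun i => x i == c) s :> nat.
    by rewrite ffunE inordK // ltnS (leq_trans (count_size _ _)).
  exists f; first by apply/asboolP; exists s; split=> // c; rewrite fc.
  by rewrite time_count; apply: eq_bigr => c _; rewrite fc.
have s0M : (size s0 <= M)%N.
  by have := le_trans (time_lo x s0) HM; rewrite ler_pM2l // ler_nat.
have [f0 Qf0 vf0] := toQ s0 Ps0 s0M.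
case: (@arg_minP _ _ _ f0 Q val_ Qf0) => f /asboolP[s [Ps sc]] fmin.
have vs : val_ f = time x s by rewrite time_count; apply: eq_bigr => c _; rewrite sc.
exists s; split=> // s' Ps'; rewrite -vs.
have [s'M|Ms'] := leqP (size s') M.
  by have [f' Qf' <-] := toQ s' Ps' s'M; exact: fmin.
apply: le_trans (fmin _ Qf0) _; rewrite vf0; apply: le_trans HM _.
by apply: le_trans (time_lo x s'); rewrite ler_wpM2l ?(ltW lo_gt0) // ler_nat ltnW.
Qed.

Lemma passage_geodesic x v w s : geodesic x v w s -> passage x v w = time x s.
Proof.
move=> [Ps smin].
have lb : lbound [set time x s | s in [set s | Pth v w s]] (time x s).
  by move=> _ [s' Ps' <-]; exact: smin.
apply/eqP; rewrite eq_le; apply/andP; split.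
  by apply: ge_inf; [exists (time x s)|exists s].
by apply: lb_le_inf => //; exists (time x s); exists s.
Qed.

Lemma passage_le x v w s : Pth v w s -> passage x v w <= time x s.
Proof.
by move=> Ps; have [g gg] := geodesic_exists x v w; rewrite (passage_geodesic gg) (proj2 gg).
Qed.

Lemma hi_gt0 : 0 < hi. Proof. exact: lt_le_trans lo_gt0 lo_le_hi. Qed.

Lemma passage_le_dist x v w : passage x v w <= hi * (l1norm (w - v)%R + 1)%:R.
Proof.
have [s [Ps ss]] := path_exists PS v w.
apply: le_trans (passage_le x Ps) _; apply: le_trans (time_hi x s) _.
by rewrite ler_wpM2l ?ler_nat // ltW // hi_gt0.
Qed.

Lemma passage_triangle x u v w : passage x u w <= passage x u v + passage x v w.
Proof.
have [s gs] := geodesic_exists x u v; have [s' gs'] := geodesic_exists x v w.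
have [r [s'' [Pss e]]] := path_cat PS (proj1 gs) (proj1 gs').
apply: le_trans (passage_le x Pss) _.
rewrite (passage_geodesic gs) (passage_geodesic gs') e !time_cat lerD2l lerDr.
exact: time_ge0.
Qed.

Lemma geodesic_size x v w s : geodesic x v w s ->
  lo * (size s)%:R <= hi * (l1norm (w - v)%R + 1)%:R.
Proof.
move=> g; apply: le_trans (time_lo x s) _; rewrite -(passage_geodesic g).
exact: passage_le_dist.
Qed.

(** Between its first and its last visit to a set, a geodesic is no slower than
    the straight path, which bounds the number of its visits by the diameter. *)
Lemma geodesic_visits x v w s (Q : pred I) m : geodesic x v w s ->
  (forall i j, Q i -> Q j -> (l1norm (pos j - pos i)%R <= m)%N) ->
  lo * (count Q s)%:R <= hi * (m + 3)%:R.
Proof.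
move=> [Ps smin] Qm.
have small k : (k <= 1)%N -> lo * k%:R <= hi * (m + 3)%:R.
  move=> k1; apply: le_trans (_ : lo * 1 <= _).
    by rewrite ler_pM2l // -[1]/(1%:R) ler_nat.
  apply: le_trans (_ : hi * 1 <= _); first by rewrite ler_wpM2r.
  by rewrite ler_pM2l ?hi_gt0 // -[1]/(1%:R) ler_nat; lia.
have [hQ|] := boolP (has Q s); last first.
  by rewrite has_count -leqNgt leqn0 => /eqP ->; exact: small.
case/split_find: hQ Ps smin => u s1 s' Qu nQ; rewrite cat_rcons => Ps smin.
rewrite count_cat -size_filter.
have -> : [seq i <- s1 | Q i] = [::] by apply/eqP; rewrite -[_ == _]negbK -has_filter.
rewrite /= Qu add0n.
have [hQ'|] := boolP (has Q s'); last first.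
  by rewrite has_count -leqNgt leqn0 => /eqP ->; rewrite addn0; exact: small.
have hQr : has Q (rev s') by rewrite has_rev.
have [u' [s2 [s3 [es' Qu' nQ3]]]] : exists (u' : I) s2 s3, [/\ s' = s2 ++ u' :: s3, Q u' & ~~ has Q s3].
  move e: (rev s') hQr => t hQr; case/split_find: hQr e => u' t1 t2 Qu' nt e.
  exists u', (rev t2), (rev t1); split=> //; last by rewrite has_rev.
  by rewrite -[s']revK e rev_cat rev_rcons.
rewrite es' in Ps smin *.
have [r [rs Pr]] := path_cut PS Ps.
have := smin _ Pr; rewrite -cat_cons !time_cat -[u' :: s3]cat1s -[u :: s2]/([:: u] ++ s2) !time_cat.
move=> h.
have h2 : time x (u :: s2 ++ [:: u']) <= hi * (m + 3)%:R.
  apply: le_trans (_ : time x r <= _).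
    by rewrite -cat1s !time_cat; lra.
  apply: le_trans (time_hi x r) _; rewrite ler_pM2l ?hi_gt0 // ler_nat.
  by apply: leq_trans rs _; rewrite leq_add2r; exact: Qm.
apply: le_trans h2; apply: le_trans (time_lo x _).
rewrite ler_pM2l // ler_nat /= count_cat /= Qu' size_cat /=.
have -> : count Q s3 = 0%N by apply/eqP; move: nQ3; rewrite has_count -leqNgt leqn0.
by have := count_size Q s2; lia.
Qed.

Lemma time_shift z x s : time x [seq shift z i | i <- s] = time (x \o shift z) s.
Proof. by rewrite /time big_map. Qed.

Lemma shiftK z : cancel (shift z) (shift (- z)).
Proof. by move=> i; rewrite (shift_shift PS) subrr (shift_zero PS). Qed.

Lemma geodesic_shift z x v w s : geodesic (x \o shift z) v w s ->
  geodesic x (v + z) (w + z) [seq shift z i | i <- s].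
Proof.
move=> [Ps smin]; split; first exact: (path_shift PS).
move=> s' Ps'; rewrite time_shift.
have := path_shift PS (- z) Ps'; rewrite !addrK => /smin; rewrite /time !big_map.
under [X in _ <= X]eq_bigr => i _ do
  rewrite /= (shift_shift PS) addNr (shift_zero PS).
by [].
Qed.

Lemma passage_shift z x v w : passage (x \o shift z) v w = passage x (v + z) (w + z).
Proof.
have [s gs] := geodesic_exists (x \o shift z) v w.
by rewrite (passage_geodesic gs) (passage_geodesic (geodesic_shift gs)) time_shift.
Qed.

(** Compare each of the two configurations along the geodesic of the other: a path
    notices the change of a symbol at [j] once per visit. *)
Lemma geodesic_setc x j c v w s s' : geodesic x v w s -> geodesic (setc x j c) v w s' ->
  `|passage (setc x j c) v w - passage x v w| <=
    hi * ((count (pred1 j) s)%:R + (count (pred1 j) s')%:R).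
Proof.
have one y e r : time (setc y j e) r - time y r <= hi * (count (pred1 j) r)%:R.
  elim: r => [|i r IH]; first by rewrite /time !big_nil subrr mulr0.
  rewrite /time !big_cons -!/(time _ _) /= /setc natrD mulrDr opprD addrACA lerD //.
  case: eqP => _; last by rewrite subrr mulr0.
  by rewrite mulr1 lerBlDr; apply: le_trans (tv_hi _) _; rewrite lerDl tv_ge0.
have back : setc (setc x j c) j (x j) = x.
  by apply/funext => i; rewrite /setc; case: eqP => [->|].
have c0 r : 0 <= hi * (count (pred1 j) r)%:R by rewrite mulr_ge0 // ltW // hi_gt0.
move=> [Ps smin] [Ps' smin'].
rewrite (passage_geodesic (conj Ps smin)) (passage_geodesic (conj Ps' smin')).
have h1 := one x c s; have h2 := one (setc x j c) (x j) s'; rewrite back in h2.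
have h3 := smin' _ Ps; have h4 := smin _ Ps'; have := c0 s; have := c0 s'.
by rewrite mulrDr ler_norml => ? ?; apply/andP; split; lra.
Qed.

End FirstPassage.

(** * Averaging over translates of the end points *)

Section Plane.
Context {d : nat} (i0 i1 : 'I_d) (m : nat).
Hypothesis i01 : i0 != i1.

(** The averaging square spans two directions of the lattice: along a single one its
    [m] points could all be visited by a geodesic. *)
Definition plane_point (p : 'I_m * 'I_m) : vertex d :=
  p.1%:Z *: unitv i0 + p.2%:Z *: unitv i1.

Lemma l1norm_scale_unitv (c : int) (i : 'I_d) : l1norm (c *: unitv i) = `|c|%N.
Proof.
rewrite /l1norm (bigD1 i) //= big1 ?addn0 => [|j ji]; rewrite !mxE ?eqxx ?(negbTE ji) /=.
  by rewrite mulr1.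
by rewrite mulr0.
Qed.

Lemma plane_point_dist p p' : (l1norm (plane_point p - plane_point p')%R <= 2 * m)%N.
Proof.
have -> : plane_point p - plane_point p' =
  (p.1%:Z - p'.1%:Z) *: unitv i0 + (p.2%:Z - p'.2%:Z) *: unitv i1.
  by rewrite /plane_point !scalerBl opprD addrACA.
apply: leq_trans (l1normD _ _) _; rewrite !l1norm_scale_unitv.
case: p p' => [[a am] [b bm]] [[a' a'm] [b' b'm]] /=; lia.
Qed.

Lemma plane_point_norm p : (l1norm (plane_point p) <= 2 * m)%N.
Proof.
apply: leq_trans (l1normD _ _) _; rewrite !l1norm_scale_unitv.
case: p => [[a am] [b bm]] /=; lia.
Qed.

Lemma plane_point_inj : injective plane_point.
Proof.
move=> [a b] [a' b'] /rowP h.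
have i10 : (i1 == i0) = false by rewrite eq_sym (negbTE i01).
have := h i0; rewrite !mxE !eqxx (negbTE i01) /= !mulr0 !mulr1 !addr0 => -[/val_inj ->].
by have := h i1; rewrite !mxE !eqxx i10 /= !mulr0 !mulr1 !add0r => -[/val_inj ->].
Qed.

End Plane.

Lemma double_add1_le k m : (0 < m)%N -> (k <= 2 * m)%N -> (k + 1 <= 3 * m)%N.
Proof. lia. Qed.

Lemma fourth_root (n : nat) : (0 < n)%N ->
  exists m, [/\ (0 < m)%N, (m ^ 4 <= n)%N & (n < (2 * m) ^ 4)%N].
Proof.
move=> n0; have ex : exists m, (m ^ 4 <= n)%N by exists 1%N; rewrite exp1n.
have bnd m : (m ^ 4 <= n)%N -> (m <= n)%N.
  move=> h; apply: leq_trans h; case: m => // m.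
  by rewrite -[X in (X <= _)%N]expn1; exact: leq_pexp2l.
case: (ex_maxnP ex bnd) => m hm mmax; exists m.
have m0 : (0 < m)%N by apply: mmax; rewrite exp1n.
split=> //; rewrite ltnNge; apply/negP => /mmax; lia.
Qed.

Section Sublinear.
Context (disp : measure_display) (Omega : measurableType disp) (R : realType).
Variables (P : probability Omega R) (W : finType) (I : choiceType).
Variables (nbrs : I -> {fset I}) (sigma : I -> Omega -> W) (q : specification R W nbrs).
Arguments q : clear implicits.
Hypothesis sigma_markov : markov_random_field P sigma q.

Variables (D cn : nat) (beta alpha : R) (col : I -> 'I_cn.+1).
Hypothesis nbrs_sym : forall i j, (j \in nbrs i) = (i \in nbrs j).
Hypothesis nbrs_irr : forall i, i \notin nbrs i.
Hypothesis nbrs_deg : forall i, (#|` nbrs i| <= D)%N.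
Hypothesis q_minor : forall i, 1 - beta <= gamma q i.
Hypothesis q_atom : forall i eta w, q i eta w = 0 \/ alpha <= q i eta w.
Hypothesis alpha_pos : 0 < alpha.
Hypothesis beta_nneg : 0 <= beta.
Hypothesis beta_small : beta < 1.
Hypothesis beta_sub : D%:R * beta < 1.
Hypothesis col_nbrs : forall i j, j \in nbrs i -> col i != col j.

Variables (d : nat) (tv : W -> R) (lo hi : R).
Hypothesis lo_gt0 : 0 < lo.
Hypothesis lo_le_hi : lo <= hi.
Hypothesis tv_bounds : forall w, lo <= tv w <= hi.
Variables (shift : vertex d -> I -> I) (pos : I -> vertex d).
Variable Pth : vertex d -> vertex d -> seq I -> Prop.
Hypothesis PS : path_system shift pos Pth.
Hypothesis sigma_shift : forall z B, cylinder_sigma_algebra B ->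
  field_law P (fun i => sigma (shift z i)) B = field_law P sigma B.
Hypothesis d_ge2 : (2 <= d)%N.

Let sigma_meas : random_field sigma. Proof. by case: sigma_markov. Qed.

(** A local function sees finitely many cylinders, whose probabilities are invariant. *)
Lemma Ep_shift (A : {fset I}) z (G : (I -> W) -> R) : local A G ->
  Ep P sigma (fun x => G (x \o shift z)) = Ep P sigma G.
Proof.
move=> GA; have [y _] := config_inhabited P sigma.
have shift_meas : random_field (fun i => sigma (shift z i)) by move=> i w; exact: sigma_meas.
change (Ep P (fun i => sigma (shift z i)) G = Ep P sigma G).
rewrite (Ep_law P shift_meas y GA) (Ep_law P sigma_meas y GA).
apply: eq_bigr => x _; congr (_ * _); congr fine.
have := sigma_shift z (B := [set u | agree A u (glue y x)]); apply.
have -> : [set u | agree A u (glue y x)] =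
    \bigcap_(i in [set` A]) [set u : I -> W | u i = glue y x i].
  by apply/seteqP; split=> u h i; exact: h.
apply: generated_bigcap => i _.
by apply: sub_sigma_algebra; exists i, (glue y x i).
Qed.

Notation Ep := (Ep P sigma).
Notation passage := (passage tv Pth).
Notation geodesic := (geodesic tv Pth).

Let hi0 : 0 < hi. Proof. exact: lt_le_trans lo_gt0 lo_le_hi. Qed.

Section Expectation.
Variable A : {fset I}.
Implicit Types F G : (I -> W) -> R.

Lemma Ep_le F G : local A F -> local A G -> (forall x, F x <= G x) -> Ep F <= Ep G.
Proof.
move=> FA GA FG; have [z _] := config_inhabited P sigma.
rewrite (Ep_law P sigma_meas z FA) (Ep_law P sigma_meas z GA).
by apply: le_ex => //; exact: law_distr.
Qed.

Lemma Ep_cst c : Ep (fun=> c) = c.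
Proof.
have [z _] := config_inhabited P sigma.
rewrite (@Ep_law _ _ _ P _ _ sigma sigma_meas A z) //.
by apply: ex_cst; exact: law_distr.
Qed.

Lemma Ep_lin (T : finType) c (F : T -> (I -> W) -> R) : (forall t, local A (F t)) ->
  Ep (fun x => c * \sum_t F t x) = c * \sum_t Ep (F t).
Proof.
move=> FA; have [z _] := config_inhabited P sigma.
rewrite (@Ep_law _ _ _ P _ _ sigma sigma_meas A z); last first.
  by move=> x y xy; congr (_ * _); apply: eq_bigr => t _; exact: FA.
rewrite exZ ex_sum; congr (_ * _); apply: eq_bigr => t _.
by rewrite (Ep_law P sigma_meas z (FA t)).
Qed.

End Expectation.

Section Endpoint.
Variables (v : vertex d) (m : nat) (y0 : I -> W) (i0 i1 : 'I_d).
Hypotheses (m_gt0 : (0 < m)%N) (i01 : i0 != i1).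
Notation n := (l1norm v).

(* A bound for the number of items of any geodesic from [0] to [v]. *)
Let N := Num.bound (hi * (n + 1)%:R / lo).

Let geodesic_N x s : geodesic x 0 v s -> (size s <= N)%N.
Proof.
move=> /(geodesic_size lo_gt0 lo_le_hi tv_bounds PS); rewrite subr0 => h.
rewrite -(ler_nat R); apply: ltW; apply: le_lt_trans (_ : hi * (n + 1)%:R / lo < _).
  by rewrite ler_pdivlMr // mulrC.
by apply: archi_boundP; rewrite divr_ge0 ?mulr_ge0 // ltW.
Qed.

Let ball : {fset I} := projT1 (cid (path_ball PS 0 N)).

Let ball_geodesic x s : geodesic x 0 v s -> {subset s <= ball}.
Proof.
move=> g; apply: (projT2 (cid (path_ball PS 0 N)) v s (proj1 g)); exact: geodesic_N g.
Qed.

Let time_agree A (x y : I -> W) s : agree A x y -> {subset s <= A} -> time tv x s = time tv y s.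
Proof. by move=> xy sA; apply: eq_big_seq => i /sA/xy ->. Qed.

Let geodesic_agree x y s : agree ball x y -> geodesic x 0 v s -> geodesic y 0 v s.
Proof.
move=> xy gs; split; first exact: (proj1 gs).
have [r gr] := geodesic_exists lo_gt0 tv_bounds PS y 0 v.
move=> s' Ps'; apply: le_trans (proj2 gr _ Ps').
rewrite -(time_agree xy (ball_geodesic gs)) -(time_agree xy (ball_geodesic gr)).
exact: (proj2 gs _ (proj1 gr)).
Qed.

Lemma passage_local : local ball (fun x => passage x 0 v).
Proof.
move=> x y xy; have [s gs] := geodesic_exists lo_gt0 tv_bounds PS x 0 v.
rewrite (passage_geodesic gs) (passage_geodesic (geodesic_agree xy gs)).
exact: time_agree (ball_geodesic gs).
Qed.

Let clip (x : I -> W) : I -> W := fun i => if i \in ball then x i else y0 i.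

(* Choosing the geodesic after [clip] makes the choice itself a local function. *)
Let geo0 (x : I -> W) : seq I := projT1 (cid (geodesic_exists lo_gt0 tv_bounds PS (clip x) 0 v)).

Let geo0_local : local ball geo0.
Proof.
move=> x y xy; rewrite /geo0; have -> // : clip x = clip y.
by apply/funext => i; rewrite /clip; case: ifP => // /xy.
Qed.

Let geo0P x : geodesic x 0 v (geo0 x).
Proof.
apply: (geodesic_agree (x := clip x)); first by move=> i; rewrite /clip => ->.
exact: (projT2 (cid (geodesic_exists lo_gt0 tv_bounds PS (clip x) 0 v))).
Qed.

Let z := @plane_point d i0 i1 m.
Let geo p (x : I -> W) : seq I := [seq shift (z p) i | i <- geo0 (x \o shift (z p))].

Let geoP p x : geodesic x (z p) (v + z p) (geo p x).
Proof.
have := geodesic_shift PS (geo0P (x \o shift (z p))); by rewrite add0r.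
Qed.

Let A : {fset I} := (\bigcup_(p <- enum {: 'I_m * 'I_m}) [fset shift (z p) i | i in ball])%fset.

Let shift_local (T : Type) (G : (I -> W) -> T) p : local ball G -> local A (fun x => G (x \o shift (z p))).
Proof.
move=> GA x y xy; apply: GA => i ib /=; apply: xy.
by apply/bigfcupP; exists p; rewrite ?mem_enum //; apply/imfsetP; exists i.
Qed.

Let m2 : R := (m ^ 2)%:R.
Let m2_gt0 : 0 < m2. Proof. by rewrite ltr0n expn_gt0 m_gt0. Qed.

Let card_pairs : #|{: 'I_m * 'I_m}| = (m ^ 2)%N.
Proof. by rewrite card_prod !card_ord mulnn. Qed.

Let F x : R := m2^-1 * \sum_(p : 'I_m * 'I_m) passage (x \o shift (z p)) 0 v.

Let FA : local A F.
Proof.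
move=> x y xy; congr (_ * _); apply: eq_bigr => p _.
exact: (shift_local p passage_local xy).
Qed.

(* Bounds the number of visits of a geodesic to one item. *)
Let C0 : R := hi * 3 / lo.
Let C0_ge1 : 1 <= C0. Proof. by rewrite ler_pdivlMr // mul1r; apply: le_trans lo_le_hi _; rewrite ler_peMr ?(ltW hi0) // ler1n. Qed.
Let C0_gt0 : 0 < C0. Proof. exact: lt_le_trans C0_ge1. Qed.

(* The proportion of the translated geodesics that visit [j], counted with
   multiplicity and normalized so that it is at most one. *)
Let h j x : R := (C0 * m2)^-1 * \sum_(p : 'I_m * 'I_m) (count (pred1 j) (geo p x))%:R.

Let geo_local (p : 'I_m * 'I_m) : local A (geo p).
Proof. by move=> x y xy; rewrite /geo (shift_local p geo0_local xy). Qed.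

Let hA j : local A (h j).
Proof. by move=> x y xy; congr (_ * _); apply: eq_bigr => p _; rewrite (geo_local p xy). Qed.

Let Cm_gt0 : 0 < C0 * m2. Proof. exact: mulr_gt0 C0_gt0 m2_gt0. Qed.
Let h_coef_gt0 : 0 < (C0 * m2)^-1. Proof. by rewrite invr_gt0 Cm_gt0. Qed.

Let count_le_C0 j p x : (count (pred1 j) (geo p x))%:R <= C0.
Proof.
rewrite ler_pdivlMr // mulrC.
apply: (geodesic_visits lo_gt0 lo_le_hi tv_bounds PS (m := 0) (geoP p x)).
by move=> i l /eqP -> /eqP ->; rewrite subrr l1norm0.
Qed.

Let h01 j x : 0 <= h j x <= 1.
Proof.
apply/andP; split; first by rewrite mulr_ge0 ?(ltW h_coef_gt0) // sumr_ge0.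
rewrite /h (ler_pdivrMl _ _ Cm_gt0) mulr1.
apply: le_trans (ler_sum _ (fun p _ => count_le_C0 j p x)) _.
by rewrite sumr_const card_pairs -[leLHS]mulr_natl mulrC.
Qed.

Let F_setc x j w : `|F (setc x j w) - F x| <= (hi * C0) * (h j x + h j (setc x j w)).
Proof.
rewrite /F -mulrBr normrM ger0_norm ?invr_ge0 ?(ltW m2_gt0) //.
rewrite (ler_pdivrMl _ _ m2_gt0) -sumrB; apply: le_trans (ler_norm_sum _ _ _) _.
have -> : m2 * (hi * C0 * (h j x + h j (setc x j w))) = \sum_(p : 'I_m * 'I_m)
   hi * ((count (pred1 j) (geo p x))%:R + (count (pred1 j) (geo p (setc x j w)))%:R).
  by rewrite -mulr_sumr big_split /= /h; field; rewrite !gt_eqF // ltr0n.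
apply: ler_sum => p _; rewrite !(passage_shift lo_gt0 tv_bounds PS) add0r.
exact: (geodesic_setc lo_gt0 lo_le_hi tv_bounds (geoP _ _) (geoP _ _)).
Qed.

Let eta : R := 5 * hi / (lo * C0 * m%:R).

Let mr_gt0 : 0 < m%:R :> R. Proof. by rewrite ltr0n. Qed.

(** By translation invariance, the expected number of translated geodesics
    through [j] is the expected number of visits of one geodesic to an [m] by
    [m] square, which is of order [m]. *)
Let Ep_h j : Ep (h j) <= eta.
Proof.
pose cnt (p : 'I_m * 'I_m) (x : I -> W) : R := (count (pred1 (shift (- z p) j)) (geo0 x))%:R.
have cE p x : (count (pred1 j) (geo p x))%:R = cnt p (x \o shift (z p)).
  rewrite /geo count_map /cnt; congr (_%:R); apply: eq_count => i /=.
  apply/eqP/eqP => [<-|->]; first by rewrite (shiftK PS).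
  by rewrite (shift_shift PS) addNr (shift_zero PS).
have cl p : local ball (cnt p) by move=> x y xy; rewrite /cnt (geo0_local xy).
rewrite /h (@Ep_lin A) => [|p x y xy]; last by rewrite (geo_local p xy).
have -> : \sum_(p : 'I_m * 'I_m) Ep (fun x => (count (pred1 j) (geo p x))%:R) =
          \sum_(p : 'I_m * 'I_m) Ep (cnt p).
  apply: eq_bigr => p _; rewrite -(Ep_shift (z p) (cl p)); congr (Ep _).
  by apply/funext => x; exact: cE.
rewrite -(Ep_lin _ cl) -[leRHS](Ep_cst ball).
apply: (Ep_le (A := ball)) => [x y xy|x y xy|x] //.
  by congr (_ * _); apply: eq_bigr => p _; exact: cl.
rewrite (ler_pdivrMl _ _ Cm_gt0).
pose Q : pred I := fun i => i \in [seq shift (- z p) j | p <- enum {: 'I_m * 'I_m}].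
have -> : \sum_(p : 'I_m * 'I_m) cnt p x = (count Q (geo0 x))%:R.
  rewrite /cnt -natr_sum; congr (_%:R).
  pose f p := shift (- z p) j.
  have f_inj : injective f.
    move=> p p' /(congr1 pos); rewrite !(pos_shift PS) => /addrI /oppr_inj.
    exact: plane_point_inj.
  have one i : (\sum_p (i == f p) = Q i)%N.
    rewrite /Q; case: mapP => [[p _ ->]|nh].
      by rewrite (bigD1 p) //= eqxx big1 // => p' /negbTE pp; rewrite (inj_eq f_inj) eq_sym pp.
    by rewrite big1 // => p _; case: eqP => // e; case: nh; exists p; rewrite ?mem_enum.
  elim: (geo0 x) => [|i s IH] /=; first by rewrite big1.
  by rewrite big_split /= IH one.
have := geodesic_visits lo_gt0 lo_le_hi tv_bounds PS (Q := Q) (m := (2 * m)%N) (geo0P x).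
move=> /(_ _); rewrite mulrC -ler_pdivlMr // => hv.
apply: le_trans (hv _) _.
  move=> i l /mapP[p _ ->] /mapP[p' _ ->]; rewrite !(pos_shift PS) opprB addrC addrA subrK.
  exact: plane_point_dist.
have -> : C0 * m2 * eta = hi * (5 * m%:R) / lo.
  by rewrite /eta /m2 natrX; field; rewrite !gt_eqF.
apply: ler_wpM2r; first by rewrite invr_ge0 ltW.
apply: ler_wpM2l; first exact: ltW hi0.
have m1 : 1 <= m%:R :> R by rewrite ler1n.
by rewrite natrD natrM; lra.
Qed.

Let Hs : R := hi * (n + 1)%:R / (lo * C0).

Let h_sum (B : {fset I}) x : \sum_(j : B) h (val j) x <= Hs.
Proof.
have visits s : \sum_(j : B) (count (pred1 (val j)) s)%:R <= (size s)%:R :> R.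
  elim: s => [|i s IH] /=; first by rewrite big1.
  under eq_bigr do rewrite natrD.
  rewrite big_split /= -add1n natrD lerD //.
  have [iB|iB] := boolP (i \in B).
    rewrite (bigD1 [` iB]%fset) //= eqxx big1 ?addr0 // => j jn.
    by case: eqP => // e; case/eqP: jn; apply: val_inj; rewrite /= -e.
  rewrite big1 // => j _; case: eqP => // e; move: iB; rewrite e.
  by rewrite (valP j).
rewrite /h -mulr_sumr (ler_pdivrMl _ _ Cm_gt0) exchange_big /=.
apply: le_trans (_ : \sum_(p : 'I_m * 'I_m) hi * (n + 1)%:R / lo <= _).
  apply: ler_sum => p _; apply: le_trans (visits _) _.
  rewrite ler_pdivlMr // mulrC.
  have := geodesic_size lo_gt0 lo_le_hi tv_bounds PS (geoP p x).
  by rewrite addrK.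
rewrite sumr_const card_pairs -[leLHS]mulr_natl /Hs -/m2.
by rewrite le_eqVlt; apply/orP; left; apply/eqP; field; rewrite !gt_eqF.
Qed.

Let F_near x : `|F x - passage x 0 v| <= 6 * hi * m%:R.
Proof.
have near p : `|passage (x \o shift (z p)) 0 v - passage x 0 v| <= 6 * hi * m%:R.
  rewrite (passage_shift lo_gt0 tv_bounds PS) add0r.
  have tri := passage_triangle lo_gt0 tv_bounds PS x.
  have dst a b : (l1norm (b - a)%R <= 2 * m)%N -> passage x a b <= 3 * hi * m%:R.
    move=> ab; apply: le_trans (passage_le_dist lo_gt0 lo_le_hi tv_bounds PS x a b) _.
    rewrite -mulrA mulrCA ler_pM2l // -natrM ler_nat.
    exact: double_add1_le.
  have zn : (l1norm (z p) <= 2 * m)%N by exact: plane_point_norm.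
  have := tri 0 (z p) (v + z p); have := tri 0 (v + z p) v.
  have := tri (z p) 0 (v + z p); have := tri 0 v (v + z p).
  have := dst 0 (z p); rewrite subr0 => /(_ zn).
  have := dst (z p) 0; rewrite sub0r l1normN => /(_ zn).
  have := dst v (v + z p); rewrite addrC addKr => /(_ zn).
  have := dst (v + z p) v; rewrite opprD addrA subrr sub0r l1normN => /(_ zn).
  by rewrite ler_norml => *; apply/andP; split; lra.
have -> : F x - passage x 0 v =
    m2^-1 * \sum_(p : 'I_m * 'I_m) (passage (x \o shift (z p)) 0 v - passage x 0 v).
  rewrite sumrB mulrBr sumr_const card_pairs -[X in _ = _ - _ * X]mulr_natl -/m2.
  by rewrite mulKf // gt_eqF.
rewrite normrM ger0_norm ?invr_ge0 ?(ltW m2_gt0) // (ler_pdivrMl _ _ m2_gt0).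
apply: le_trans (ler_norm_sum _ _ _) _.
apply: le_trans (ler_sum _ (fun p _ => near p)) _.
by rewrite sumr_const card_pairs -[leLHS]mulr_natl.
Qed.

Definition energy_const : R :=
  4 * (hi * C0) ^+ 2 * (talagrand_const (W := W) D beta alpha cn + 5 * hi / (lo * C0)) *
  (2 * hi / (lo * C0)) + 1.

(** The parameter of Talagrand's inequality is [ln m / 2], so that the factor [m] it
    costs is compensated by the bound [eta] for the influences. *)
Lemma endpoint_variance : (0 < n)%N -> exists Y,
  ('V_P[fun o => passage (sigma ^~ o) 0%R v] <= (2 * Y + 72 * hi ^+ 2 * m%:R ^+ 2)%:E)%E /\
  (1 - D%:R * beta) * ((1 + ln m%:R) * Y) <= energy_const * n%:R.
Proof.
move=> n0.
have n1 : 1 <= n%:R :> R by rewrite ler1n.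
have lm0 : 0 <= ln m%:R / 2 :> R by rewrite divr_ge0 // ln_ge0 // ler1n.
have hC0 : 0 < hi * C0 by exact: mulr_gt0.
have lC0 : 0 < lo * C0 by exact: mulr_gt0.
have eta0 : 0 <= eta.
  exact: divr_ge0 (mulr_ge0 (ler0n _ 5) (ltW hi0)) (ltW (mulr_gt0 lC0 mr_gt0)).
have Hs0 : 0 <= Hs by exact: divr_ge0 (mulr_ge0 (ltW hi0) (ler0n _ _)) (ltW lC0).
have [c hc] := field_variance sigma_markov nbrs_sym nbrs_irr nbrs_deg q_minor q_atom
  alpha_pos beta_nneg beta_small beta_sub col_nbrs lm0 (ltW hC0) eta0 Hs0 FA hA h01
  F_setc Ep_h h_sum ltr01.
have e2 : 2 * (ln m%:R / 2) = ln m%:R :> R by field.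
rewrite e2 lnK ?posrE // in hc.
exists (Ep (fun x => (F x - c) ^+ 2)); split; last first.
  apply: le_trans hc _; rewrite /energy_const.
  set tc := talagrand_const _ _ _ _.
  have tc0 : 0 <= tc by exact: (talagrand_const_ge0 (box_kernelP
    sigma_markov nbrs_sym nbrs_irr nbrs_deg q_minor q_atom alpha_pos beta_nneg beta_small beta_sub
    fset0 y0)).
  have -> : m%:R * eta = 5 * hi / (lo * C0) by rewrite /eta; field; rewrite !gt_eqF.
  rewrite [leRHS]mulrDl mul1r; apply: lerD => //; rewrite -[leRHS]mulrA; apply: ler_wpM2l.
    apply: mulr_ge0; first by apply: mulr_ge0 => //; exact: sqr_ge0.
    by apply: addr_ge0 => //; exact: divr_ge0 (mulr_ge0 (ler0n _ 5) (ltW hi0)) (ltW lC0).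
  rewrite /Hs [leRHS]mulrAC; apply: ler_wpM2r; first by rewrite invr_ge0 ltW.
  rewrite [2 * hi]mulrC -mulrA; apply: ler_wpM2l; first exact: ltW hi0.
  by rewrite natrD; lra.
apply: le_trans (variance_local_le P sigma_meas c passage_local) _.
rewrite lee_fin.
have pos2 : 0 <= (6 * hi * m%:R) ^+ 2 by exact: sqr_ge0.
have -> : 2 * Ep (fun x => (F x - c) ^+ 2) + 72 * hi ^+ 2 * m%:R ^+ 2 =
   Ep (fun x => 2 * \sum_(t : bool) (if t then (F x - c) ^+ 2 else (6 * hi * m%:R) ^+ 2)).
  rewrite (@Ep_lin A) => [|t x y xy]; last by rewrite (FA xy).
  rewrite big_bool /= (Ep_cst A); ring.
apply: (Ep_le (A := (A `|` ball)%fset)) => [x y xy|x y xy|x].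
- by rewrite (passage_local (y := y)) // => i ib; apply: xy; rewrite inE ib orbT.
- by rewrite !big_bool (FA (y := y)) // => i ib; apply: xy; rewrite inE ib.
rewrite big_bool /=.
have h1 : (F x - passage x 0 v) ^+ 2 <= (6 * hi * m%:R) ^+ 2.
  rewrite -(real_normK (num_real (F x - passage x 0 v))) lerXn2r ?nnegrE ?F_near //.
  exact: mulr_ge0 (mulr_ge0 (ler0n _ 6) (ltW hi0)) (ler0n _ m).
have h2 : 0 <= ((F x - c) + (F x - passage x 0 v)) ^+ 2 by exact: sqr_ge0.
apply: le_trans (_ : 2 * ((F x - c) ^+ 2 + (F x - passage x 0 v) ^+ 2) <= _); last by lra.
rewrite -subr_ge0; apply: le_trans h2 _.
by rewrite le_eqVlt; apply/orP; left; apply/eqP; ring.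
Qed.

End Endpoint.

(** With [m] of the order of [n^(1/4)], the logarithm of [m] is of the order of [ln n]
    and the error [m^2] of averaging is of lower order than [n / ln n]. *)
Theorem passage_variance : exists C, 0 < C /\ forall v : vertex d, (2 <= l1norm v)%N ->
  ('V_P[fun o => passage (sigma ^~ o) 0%R v] <=
     (C * ((l1norm v)%:R / ln (l1norm v)%:R))%:E)%E.
Proof.
have [y0 _] := config_inhabited P sigma.
have dd : 0 < 1 - D%:R * beta by rewrite subr_gt0.
have K0 : 0 < energy_const.
  rewrite /energy_const ltr_wpDl //.
  have tc0 : 0 <= talagrand_const (W := W) D beta alpha cn by exact: (talagrand_const_ge0 (box_kernelP
    sigma_markov nbrs_sym nbrs_irr nbrs_deg q_minor q_atom alpha_pos beta_nneg beta_small beta_sub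
    fset0 y0)).
  have lC : 0 < lo * (hi * 3 / lo) by rewrite mulr_gt0 // divr_gt0 // mulr_gt0.
  apply: mulr_ge0; last by apply: divr_ge0; [rewrite mulr_ge0 // ltW|exact: ltW].
  apply: mulr_ge0; first by apply: mulr_ge0 => //; exact: sqr_ge0.
  by apply: addr_ge0 => //; apply: divr_ge0; [rewrite mulr_ge0 // ltW|exact: ltW].
pose C : R := 8 * energy_const / (1 - D%:R * beta) + 288 * hi ^+ 2.
exists C; split.
  have C1 : 0 < 8 * energy_const / (1 - D%:R * beta) by rewrite divr_gt0 // mulr_gt0.
  by apply: ltr_wpDr C1; rewrite mulr_ge0 // sqr_ge0.
move=> v n2; set n := l1norm v in n2 *.
have n0 : (0 < n)%N by apply: leq_trans n2.
have [m [m0 mn nm]] := fourth_root n0.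
have i01 : Ordinal (leq_trans (ltn0Sn 1) d_ge2) != Ordinal d_ge2 by [].
have [Y [hV hY]] := endpoint_variance y0 m0 i01 n0.
apply: le_trans hV _; rewrite lee_fin -/n in hY *.
have nr : 0 < n%:R :> R by rewrite ltr0n.
have mr : 1 <= m%:R :> R by rewrite ler1n.
have mr0 : 0 < m%:R :> R by rewrite ltr0n.
pose L : R := ln n%:R.
have L0 : 0 < L by rewrite ln_gt0 // ltr1n.
have lm : ln m%:R <= m%:R - 1 :> R by exact: ln_le_sub1.
have lm0 : 0 <= ln m%:R :> R by exact: ln_ge0.
have Lm : L <= 4 * (1 + ln m%:R).
  have l2 : ln 2 <= 1 :> R by apply: le_trans (ln_le_sub1 _) _ => //; lra.
  have : L <= ln ((2 * m%:R) ^+ 4).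
    rewrite ler_ln ?posrE ?exprn_gt0 ?mulr_gt0 // -natrM -natrX ler_nat; exact: ltnW.
  by rewrite lnXn ?mulr_gt0 // lnM ?posrE // => h4; lra.
have hm : m%:R ^+ 2 <= 4 * (n%:R / L) :> R.
  rewrite mulrA ler_pdivlMr //.
  apply: le_trans (_ : m%:R ^+ 2 * (4 * m%:R) <= _).
    by rewrite ler_wpM2l ?sqr_ge0 //; lra.
  apply: le_trans (_ : 4 * m%:R ^+ 4 <= _); last first.
    by rewrite ler_pM2l // -natrX ler_nat.
  have -> : m%:R ^+ 2 * (4 * m%:R) = 4 * (m%:R ^+ 3) * 1 :> R by ring.
  have -> : 4 * m%:R ^+ 4 = 4 * m%:R ^+ 3 * m%:R :> R by ring.
  by rewrite ler_wpM2l // mulr_ge0 // exprn_ge0.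
have hYL : Y <= 4 * energy_const / (1 - D%:R * beta) * (n%:R / L).
  have -> : 4 * energy_const / (1 - D%:R * beta) * (n%:R / L) =
     4 * (energy_const * n%:R) / ((1 - D%:R * beta) * L).
    by field; rewrite !gt_eqF.
  rewrite ler_pdivlMr ?mulr_gt0 //.
  have [Y0|Y0] := leP Y 0.
    apply: le_trans (_ : 0 <= _); first by rewrite mulr_le0_ge0 // mulr_ge0 // ltW.
    by rewrite !mulr_ge0 // ltW.
  apply: le_trans (_ : 4 * ((1 - D%:R * beta) * ((1 + ln m%:R) * Y)) <= _); last first.
    by rewrite ler_pM2l.
  have := ler_wpM2l (ltW (mulr_gt0 dd Y0)) Lm; lra.
have -> : C * (n%:R / L) = 2 * (4 * energy_const / (1 - D%:R * beta) * (n%:R / L)) +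
   72 * hi ^+ 2 * (4 * (n%:R / L)) by rewrite /C; ring.
apply: lerD; first by rewrite ler_pM2l.
by apply: ler_wpM2l => //; apply: mulr_ge0 => //; exact: sqr_ge0.
Qed.

End Sublinear.

(** * Uniform constants of a translation-invariant specification *)

Section Uniform.
Context {R : realType} {W : finType} {I : choiceType} (nbrs : I -> {fset I}).
Variable q : specification R W nbrs.
Arguments q : clear implicits.
Variables (Z : Type) (shift : Z -> I -> I) (reps : seq I).
Hypothesis q_ge0 : forall i eta w, 0 <= q i eta w.
Hypothesis q_shift : forall z i (x : I -> W) w,
  q (shift z i) (Defs.restrict nbrs (shift z i) x) w = q i (Defs.restrict nbrs i (x \o shift z)) w.
Hypothesis reps_shift : forall i, exists z, exists2 r, r \in reps & i = shift z r.
Hypothesis W_inhabited : exists w : W, True.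

(** Up to translation there are finitely many sites, hence finitely many conditional
    probabilities. *)
Lemma q_rep i eta w : exists r eta', r \in reps /\ q i eta w = q r eta' w.
Proof.
have [w0 _] := W_inhabited.
have [z [r rr e]] := reps_shift i; subst i.
pose x : I -> W := fun j => if insub j is Some s then eta s else w0.
have -> : eta = Defs.restrict nbrs (shift z r) x.
  by apply/ffunP => j; rewrite ffunE /x valK.
by exists r, (Defs.restrict nbrs r (x \o shift z)); rewrite q_shift.
Qed.

Lemma gamma_rep i : exists2 r, r \in reps & gamma q r <= gamma q i.
Proof.
have [w0 _] := W_inhabited.
have [z [r rr e]] := reps_shift i; exists r => //; subst i.
apply: ler_sum => w _; rewrite /gamma_at; apply: le_bigmin => [|eta _].
  by rewrite bigmin_idl ge_min lexx.
pose x : I -> W := fun j => if insub j is Some s then eta s else w0.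
have -> : eta = Defs.restrict nbrs (shift z r) x.
  by apply/ffunP => j; rewrite ffunE /x valK.
by rewrite q_shift; exact: bigmin_le.
Qed.

Lemma uniform_atom : exists alpha, 0 < alpha /\ forall i eta w, q i eta w = 0 \/ alpha <= q i eta w.
Proof.
pose a r := \big[Order.min/1]_(eta : local_config W nbrs r) \big[Order.min/1]_(w : W)
  (if q r eta w == 0 then 1 else q r eta w).
pose alpha := \big[Order.min/1]_(r <- reps) a r.
exists alpha; split.
  apply: lt_bigmin => // r _; apply: lt_bigmin => // eta _; apply: lt_bigmin => // w _.
  by case: eqP => // /eqP h; rewrite lt_def h q_ge0.
move=> i eta w; have [r [eta' [rr ->]]] := q_rep eta w.
have [->|h] := eqVneq (q r eta' w) 0; [by left|right].
apply: le_trans (_ : a r <= _); first exact: ge_bigmin_seq.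
pose b w := if q r eta' w == 0 then 1 else q r eta' w.
apply: le_trans (_ : \big[Order.min/1]_w b w <= _); first exact: bigmin_le.
by apply: le_trans (_ : b w <= _); [exact: bigmin_le|rewrite /b (negbTE h)].
Qed.

Lemma uniform_noise (D : nat) : (0 < D)%N -> (forall i, 1 - D%:R^-1 < gamma q i) ->
  exists beta, [/\ 0 <= beta, beta < 1, D%:R * beta < 1 & forall i, 1 - beta <= gamma q i].
Proof.
move=> D0 hq; pose beta := \big[Order.max/0]_(r <- reps) (1 - gamma q r).
have Dr : 0 < D%:R :> R by rewrite ltr0n.
have bD : beta < D%:R^-1.
  apply: bigmax_lt => [|r _]; first by rewrite invr_gt0.
  by have := hq r; lra.
exists beta; split.
- by rewrite /beta bigmax_idl le_max lexx.
- by apply: lt_le_trans bD _; rewrite invf_le1 // ler1n.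
- by rewrite -ltr_pdivlMl // mulr1.
move=> i; have [r rr h] := gamma_rep i; apply: le_trans h.
have : 1 - gamma q r <= beta by exact: (@bigmax_sup_seq _ _ _ _ 0 r xpredT _ (fun r => 1 - gamma q r) rr isT (lexx _)).
lra.
Qed.

End Uniform.

(** * Paths of the cubic lattice *)

Section Lattice.
Context {d : nat}.
Implicit Types (u v w x y z : vertex d) (e : edge d) (p : seq (edge d * vertex d)).

Definition path_vertices v p := v :: [seq t.2 | t <- p].
Definition path_edges p := [seq t.1 | t <- p].
Definition path_end v p := last v [seq t.2 | t <- p].

Lemma is_path_cat v w p p' : is_path v (p ++ p') w =
  is_path v p (path_end v p) && is_path (path_end v p) p' w.
Proof.
elim: p v => [|[e x] p IH] v /=; first by rewrite eqxx.
by rewrite IH andbA.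
Qed.

Lemma is_path_end v w p : is_path v p w -> path_end v p = w.
Proof. by elim: p v => [v /eqP|[e x] p IH v /= /andP[_ /IH]]. Qed.

Lemma straight_path v w : exists p, is_path v p w /\ size p = l1norm (w - v).
Proof.
move: {2}(l1norm (w - v)) (leqnn (l1norm (w - v))) => n.
elim: n v => [|n IH] v hn.
  exists [::]; move: hn; rewrite leqn0 l1norm_eq0 subr_eq0 => /eqP ->.
  by rewrite /= eqxx subrr l1norm0.
have [/eqP|nz] := eqVneq (l1norm (w - v)) 0%N.
  rewrite l1norm_eq0 subr_eq0 => /eqP ->; exists [::].
  by rewrite /= eqxx subrr l1norm0.
have [i hi] : exists i, (w - v) ord0 i != 0.
  apply/existsP; apply: contraNT nz; rewrite negb_exists => /forallP h.
  rewrite /l1norm big1 // => i _; by move/negPn/eqP: (h i) => ->.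
pose s : int := if 0 < (w - v) ord0 i then 1 else -1.
pose v' := v + s *: unitv i.
have s1 : `|s|%N = 1%N by rewrite /s; case: ifP.
have nv : l1norm (v' - v) = 1%N by rewrite /v' addrC addKr l1norm_scale_unitv s1.
have dec : (l1norm (w - v')%R + 1)%N = l1norm (w - v).
  have -> : w - v' = (w - v) - s *: unitv i by rewrite /v' opprD addrA.
  rewrite /l1norm (bigD1 i) //= [in RHS](bigD1 i) //= addnAC; congr (_ + _)%N; last first.
    by apply: eq_bigr => j ji; rewrite !mxE (negbTE ji) /= mulr0 subr0.
  have -> : ((w - v) - s *: unitv i) ord0 i = (w - v) ord0 i - s.
    by rewrite 3!mxE [in LHS]mxE [in LHS]mxE !mxE !eqxx /= mulr1.
  by move: hi; rewrite /s; move: ((w - v) ord0 i) => a; case: ifP; lia.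
have [e he] := (endpoints_exists v v').1 nv.
have [|p [hp sp]] := IH v'; first by lia.
by exists ((e, v') :: p); rewrite /= he eqxx /= sp -dec addn1.
Qed.

Lemma step_endpoints e v x : endpoints e = [fset v; x]%fset -> x \in vertex_nbrs v.
Proof. by move=> h; apply/vertex_nbrsP; apply/endpoints_exists; exists e. Qed.

Definition shift_path z p := [seq (edge_shift z t.1, vertex_shift z t.2) | t <- p].

Lemma shift_pathP z v w p : is_path v p w -> is_path (v + z) (shift_path z p) (w + z).
Proof.
elim: p v => [|[e x] p IH] v /=; first by move=> /eqP ->.
move=> /andP[/eqP h /IH ->]; rewrite andbT; apply/eqP/fsetP => u.
have /fsetP /(_ (u - z)) := h; rewrite /endpoints !inE /= !subr_eq.
by rewrite [e.1 + _ + z]addrAC.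
Qed.

Lemma path_vertices_box (A : {fset vertex d}) k v w p :
  is_path v p w -> v \in box (@vertex_nbrs d) A k ->
  {subset path_vertices v p <= box (@vertex_nbrs d) A (k + size p)}.
Proof.
elim: p v k => [|[e x] p IH] v k /=.
  by move=> _ vk u; rewrite inE addn0 => /eqP ->.
move=> /andP[/eqP he hp] vk u; rewrite inE => /orP[/eqP ->|].
  by apply: (fsubsetP (box_sub _ _ (leq_addr _ _))).
rewrite addnS -addSn; apply: IH hp _ u.
exact: thicken_nbrs vk (step_endpoints he).
Qed.

Definition site_paths v w s := exists p, is_path v p w /\ s = path_vertices v p.
Definition bond_paths v w s := exists p, is_path v p w /\ s = path_edges p.

Lemma split_vertices v p s1 u s2 : path_vertices v p = s1 ++ u :: s2 ->
  exists p1 p2, [/\ p = p1 ++ p2, path_vertices v p1 = rcons s1 u & [seq t.2 | t <- p2] = s2].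
Proof.
elim: s1 v p => [|a s1 IH] v p /=.
  by move=> [<- <-]; exists [::], p.
case: p => [|t p] [va]; first by case: s1 {IH}.
move=> /IH [p1 [p2 [-> h1 h2]]]; exists (t :: p1), p2; split=> //.
by rewrite va -h1.
Qed.

Lemma site_path_system : path_system (@vertex_shift d) id site_paths.
Proof.
split.
- by move=> z z' i; rewrite /vertex_shift addrA.
- by move=> i; rewrite /vertex_shift addr0.
- by [].
- move=> v w; have [p [hp sp]] := straight_path v w.
  by exists (path_vertices v p); split; [exists p|rewrite /= size_map sp addn1].
- move=> u v w _ _ [p [hp ->]] [p' [hp' ->]].
  exists [:: v], [seq t.2 | t <- p']; split=> //; exists (p ++ p').
  by rewrite is_path_cat (is_path_end hp) hp hp' /path_vertices map_cat.
- move=> z v w _ [p [hp ->]]; exists (shift_path z p); split; first exact: shift_pathP.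
  by rewrite /path_vertices /= -!map_comp.
- move=> v w s1 s2 s3 u u' [p [hp /esym/split_vertices [p1 [p2 [ep h1 h2]]]]]; subst p.
  have eu : path_end v p1 = u.
    by rewrite -[RHS](last_rcons v s1 u) -h1.
  have : path_vertices u p2 = (u :: s2) ++ u' :: s3 by rewrite /path_vertices h2.
  move=> /split_vertices [p3 [p4 [ep h3 h4]]]; subst p2.
  have eu' : path_end u p3 = u'.
    by rewrite -[RHS](last_rcons u (u :: s2) u') -h3.
  move: hp; rewrite !is_path_cat eu eu' => /and3P[hp1 hp3 hp4].
  have [r [hr sr]] := straight_path u u'.
  exists (path_vertices u r); split; first by rewrite /= size_map sr addnC !addSn ltnW.
  exists (p1 ++ r ++ p4); rewrite !is_path_cat eu (is_path_end hr) hp1 hr hp4; split=> //.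
  by rewrite /path_vertices !map_cat h4 -cat_rcons -h1 /path_vertices /= catA.
move=> v M; exists (box (@vertex_nbrs d) [fset v]%fset M) => w s [p [hp ->]] sM u us.
have := path_vertices_box (A := [fset v]%fset) (k := 0%N) hp; rewrite inE eqxx => /(_ isT u us).
rewrite add0n; apply: (fsubsetP (box_sub _ _ _)); apply: leq_trans sM.
by rewrite /= size_map.
Qed.

Lemma map_eq_cat (S T : Type) (f : S -> T) (p : seq S) s1 a s2 : [seq f t | t <- p] = s1 ++ a :: s2 ->
  exists (p1 : seq S) t (p2 : seq S), [/\ p = p1 ++ t :: p2, [seq f t | t <- p1] = s1, f t = a &
    [seq f t | t <- p2] = s2].
Proof.
elim: s1 p => [|b s1 IH] [|t p] //=; first by move=> [<- <-]; exists [::], t, p.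
by move=> [tb /IH [p1 [t' [p2 [-> <- <- <-]]]]]; exists (t :: p1), t', p2; rewrite /= tb.
Qed.

Lemma endpoint_near e v : v \in endpoints e -> (l1norm (v - e.1)%R <= 1)%N.
Proof.
rewrite /endpoints !inE => /orP[]/eqP ->; first by rewrite subrr l1norm0.
by rewrite addrC addKr -[unitv _]scale1r l1norm_scale_unitv.
Qed.

Lemma bond_path_system : path_system (@edge_shift d) (@fst (vertex d) 'I_d) bond_paths.
Proof.
split.
- by move=> z z' i; rewrite /edge_shift /= addrA.
- by move=> [x i]; rewrite /edge_shift addr0.
- by [].
- move=> v w; have [p [hp sp]] := straight_path v w.
  by exists (path_edges p); split; [exists p|rewrite size_map sp leq_addr].
- move=> u v w _ _ [p [hp ->]] [p' [hp' ->]].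
  exists [::], (path_edges p'); split=> //; exists (p ++ p').
  by rewrite is_path_cat (is_path_end hp) hp hp' /path_edges map_cat.
- move=> z v w _ [p [hp ->]]; exists (shift_path z p); split; first exact: shift_pathP.
  by rewrite /path_edges -!map_comp.
- move=> v w s1 s2 s3 e e' [p [hp /esym es]].
  case: (map_eq_cat es) => p1 [[e1 x] [p2 [ep <- /= ee ep2]]].
  case: (map_eq_cat ep2) => p3 [[e2 x'] [p4 [ep' _ /= ee' <-]]].
  subst p p2 e e'; move: hp; rewrite is_path_cat /= is_path_cat /=.
  set y := path_end v p1; set y' := path_end x p3.
  move=> /and4P[hp1 /eqP he _ /andP[/eqP he' hp4]].
  have [r [hr sr]] := straight_path y x'.
  exists (path_edges r); split.
    rewrite size_map sr.
    have -> : x' - y = (x' - e2.1) + (e2.1 - e1.1) + (e1.1 - y) by rewrite subrKA subrKA.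
    apply: leq_trans (l1normD _ _) _; apply: leq_trans (leq_add (l1normD _ _) (leqnn _)) _.
    have a1 : (l1norm (x' - e2.1)%R <= 1)%N by apply: endpoint_near; rewrite he' !inE eqxx orbT.
    have a2 : (l1norm (e1.1 - y)%R <= 1)%N.
      by rewrite l1normB; apply: endpoint_near; rewrite he !inE eqxx.
    by rewrite addnAC addnC leq_add2l -[3%N]/(1 + 2)%N; apply: leq_trans (leq_add a1 a2) _.
  exists (p1 ++ r ++ p4); rewrite !is_path_cat (is_path_end hr) hp1 hr hp4; split=> //.
  by rewrite /path_edges !map_cat.
move=> v M; exists (\bigcup_(u <- box (@vertex_nbrs d) [fset v]%fset M) incident_edges u)%fset.
move=> w s [p [hp ->]] sM e ep.
have hb := path_vertices_box (A := [fset v]%fset) (k := 0%N) hp.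
rewrite inE eqxx add0n in hb.
have [u up ue] : exists2 u, u \in path_vertices v p & u \in endpoints e.
  elim: p v hp ep {sM hb} => [//|[f x] p IH] v /= /andP[/eqP hf hp]; rewrite inE.
  move=> /orP[/eqP ->|/(IH _ hp) [u up ue]]; last by exists u; rewrite // inE up orbT.
  by exists v; rewrite ?mem_head // hf !inE eqxx.
apply/bigfcupP; exists u; last by rewrite incident_edgesP.
rewrite andbT; apply: (fsubsetP (box_sub _ _ _)) (hb isT u up).
by move: sM; rewrite size_map.
Qed.

Lemma odd_abszD (a b : int) : odd `|(a + b)%R|%N = odd `|a|%N (+) odd `|b|%N.
Proof.
have [->|[<-|<-]] : (`|(a + b)%R| = `|a| + `|b| \/
    (`|(a + b)%R| + `|b| = `|a| \/ `|(a + b)%R| + `|a| = `|b|))%N by lia.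
- exact: oddD.
- by rewrite oddD addbK.
- by rewrite oddD addbC addbK.
Qed.

Lemma odd_l1normD u v : odd (l1norm (u + v)) = odd (l1norm u) (+) odd (l1norm v).
Proof.
rewrite /l1norm !(big_morph odd oddD (erefl _)) -big_split; apply: eq_bigr => i _.
by rewrite mxE odd_abszD.
Qed.

Lemma vertex_nbrs_sym u v : (v \in vertex_nbrs u) = (u \in vertex_nbrs v).
Proof. by apply/vertex_nbrsP/vertex_nbrsP; rewrite l1normB. Qed.

Lemma vertex_nbrs_irr u : u \notin vertex_nbrs u.
Proof. by apply/vertex_nbrsP; rewrite subrr l1norm0. Qed.

(** The two sublattices. *)
Definition vertex_colour v : 'I_2 := inord (odd (l1norm v)).

Lemma vertex_colour_nbrs u v : v \in vertex_nbrs u -> vertex_colour u != vertex_colour v.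
Proof.
move=> /vertex_nbrsP h; apply/eqP => /(congr1 val); rewrite /= !inordK; [|by case: odd..].
have -> : v = (v - u) + u by rewrite subrK.
by rewrite odd_l1normD h; case: odd.
Qed.

Lemma edge_nbrs_sym e f : (f \in edge_nbrs e) = (e \in edge_nbrs f).
Proof. by rewrite !edge_nbrsP eq_sym fsetIC. Qed.

Lemma edge_nbrs_irr e : e \notin edge_nbrs e.
Proof. by rewrite edge_nbrsP eqxx. Qed.

(** Direction of the edge and parity of its position along this direction: a proper
    colouring, because adjacent parallel edges are consecutive on a line. *)
Definition edge_colour e : 'I_(2 * d).-1.+1 := inord (2 * e.2 + odd `|e.1 ord0 e.2|).

Lemma edge_colour_nbrs e f : f \in edge_nbrs e -> edge_colour e != edge_colour f.
Proof.
have bnd (g : edge d) : (2 * g.2 + odd `|g.1 ord0 g.2|%N < (2 * d).-1.+1)%N.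
  by have := ltn_ord g.2; case: odd; lia.
rewrite edge_nbrsP => /andP[fe meet]; apply/eqP => /(congr1 val); rewrite /= !inordK //.
case: e f fe meet {bnd} => [x i] [y j] /= fe /fset0Pn[u].
rewrite inE /endpoints !inE /= => /andP[ux uy] h.
have ij : i = j by apply: val_inj => /=; move: h; do 2 case: odd; lia.
subst j; have {}h : odd `|x ord0 i|%N = odd `|y ord0 i|%N by move: h; do 2 case: odd; lia.
have par (a b : vertex d) : a = b + unitv i -> odd `|a ord0 i|%N != odd `|b ord0 i|%N.
  by move=> ->; rewrite !mxE !eqxx odd_abszD; case: odd.
case/orP: ux => /eqP eu; case/orP: uy => /eqP eu'; rewrite eu in eu'.
- by rewrite eu' eqxx in fe.
- by have := par _ _ eu'; rewrite h eqxx.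
- by have := par _ _ (esym eu'); rewrite h eqxx.
- by move/addIr: eu' => e; rewrite e eqxx in fe.
Qed.

End Lattice.

(** * Variance of the passage times of an invariant field *)

Section PassageTimes.
Context {R : realType} {d : nat} {W : finType} (tv : W -> R).

Lemma site_time_passage (x : vertex d -> W) v w :
  site_time (tv \o x) v w = passage tv site_paths x v w.
Proof.
rewrite /site_time /passage; congr (inf _); apply/seteqP; split=> r [].
  move=> p hp <-; exists (path_vertices v p); first by exists p.
  by rewrite /time /site_path_time big_cons big_map.
move=> s [p [hp ->]] <-; exists p => //.
by rewrite /time /site_path_time big_cons big_map.
Qed.

Lemma bond_time_passage (x : edge d -> W) v w :
  bond_time (tv \o x) v w = passage tv bond_paths x v w.
Proof.
rewrite /bond_time /passage; congr (inf _); apply/seteqP; split=> r [].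
  move=> p hp <-; exists (path_edges p); first by exists p.
  by rewrite /time /bond_path_time big_map.
move=> s [p [hp ->]] <-; exists p => //.
by rewrite /time /bond_path_time big_map.
Qed.

End PassageTimes.

Lemma edge_HN_threshold (R : realType) (d : nat) : (2 <= d)%N ->
  ((4 * d)%:R - 3) / ((4 * d)%:R - 2) = 1 - (4 * d - 2)%N%:R^-1 :> R.
Proof.
move=> d2; have h : (2 <= 4 * d)%N by apply: leq_trans d2 _; rewrite leq_pmull.
rewrite natrB //.
have h2 : (2 : R) < (4 * d)%:R by rewrite ltr_nat; lia.
have h3 : (4 * d)%:R - 2 != 0 :> R by rewrite subr_eq0 gt_eqF.
apply: (mulIf h3); rewrite mulfVK // mulrBl mul1r mulVf //.
by move: ((4 * d)%:R : R) => a; ring.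
Qed.

Lemma site_HN_threshold (R : realType) (d : nat) : (2 <= d)%N ->
  ((2 * d)%:R - 1) / (2 * d)%:R = 1 - (2 * d)%N%:R^-1 :> R.
Proof.
move=> d2; have h2 : (0 : R) < (2 * d)%:R by rewrite ltr0n; lia.
by rewrite mulrDl divff ?gt_eqF // mulN1r.
Qed.

Lemma value_bounds (R : realType) (W : finType) (tv : W -> R) : (forall w, 0 < tv w) ->
  exists lo hi, [/\ 0 < lo, lo <= hi & forall w, lo <= tv w <= hi].
Proof.
move=> tv0; exists (\big[Num.min/1]_w tv w), (\big[Num.max/1]_w tv w); split.
- by apply: lt_bigmin.
- apply: (@le_trans _ _ 1); first by rewrite bigmin_idl ge_min lexx.
  by rewrite bigmax_idl le_max lexx.
- by move=> w; rewrite bigmin_le /=; exact: le_bigmax.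
Qed.

Section Invariant.
Context (disp : measure_display) (Omega : measurableType disp) (R : realType).
Variables (P : probability Omega R) (W : finType) (d : nat) (I : choiceType).
Variables (nbrs : I -> {fset I}) (sigma : I -> Omega -> W) (q : specification R W nbrs).
Arguments q : clear implicits.
Variables (shift : vertex d -> I -> I) (pos : I -> vertex d).
Variable Pth : vertex d -> vertex d -> seq I -> Prop.
Variables (D cn : nat) (col : I -> 'I_cn.+1) (reps : seq I) (tv : W -> R).

Theorem invariant_passage_variance :
  (2 <= d)%N -> (forall w, 0 < tv w) ->
  markov_random_field P sigma q -> translation_invariant P shift sigma q ->
  (0 < D)%N -> (forall i, 1 - D%:R^-1 < gamma q i) ->
  (forall i, exists z, exists2 r, r \in reps & i = shift z r) ->
  I ->
  (forall i j, (j \in nbrs i) = (i \in nbrs j)) -> (forall i, i \notin nbrs i) ->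
  (forall i, #|` nbrs i| <= D)%N -> (forall i j, j \in nbrs i -> col i != col j) ->
  path_system shift pos Pth ->
  exists C, 0 < C /\ forall v : vertex d, (2 <= l1norm v)%N ->
    ('V_P[fun o => passage tv Pth (sigma ^~ o) 0%R v] <=
       (C * ((l1norm v)%:R / ln (l1norm v)%:R))%:E)%E.
Proof.
move=> d2 tv0 mk [hs hq] D0 hg reps_shift i0 nsym nirr ndeg ncol ps.
have [x _] := config_inhabited P sigma.
have W1 : exists w : W, True by exists (x i0).
have [_ q0 _ _] := mk.
have [alpha [alpha0 qa]] := uniform_atom q0 hq reps_shift W1.
have [beta [b0 b1 bD bg]] := uniform_noise hq reps_shift W1 D0 hg.
have [lo [hi [lo0 lohi tvb]]] := value_bounds tv0.
exact: (@passage_variance _ _ _ P W I nbrs sigma q mk D cn beta alpha col nsym nirr ndeg bg qa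
  alpha0 b0 b1 bD ncol d tv lo hi lo0 lohi tvb shift pos Pth ps hs d2).
Qed.
End Invariant.

Local Close Scope classical_set_scope.

Theorem theorem1p4 (R : realType) (d : nat) (disp : measure_display)
    (Omega : measurableType disp) (P : probability Omega R) (W : {fset R}) :
  (2 <= d)%N ->
  (forall w : W, 0 < val w) ->
  (forall (sigma : vertex d -> Omega -> W)
      (q : specification R W (@vertex_nbrs d)),
    markov_random_field P sigma q ->
    translation_invariant P (@vertex_shift d) sigma q ->
    site_HN q ->
    exists C : R, 0 < C /\ forall v : vertex d, (2 <= l1norm v)%N ->
      ('V_P[fun x => site_time (fun u => val (sigma u x)) 0%R v] <=
        (C * ((l1norm v)%:R / ln (l1norm v)%:R))%:E)%E)
  /\
  (forall (sigma : edge d -> Omega -> W)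
      (q : specification R W (@edge_nbrs d)),
    markov_random_field P sigma q ->
    translation_invariant P (@edge_shift d) sigma q ->
    edge_HN q ->
    exists C : R, 0 < C /\ forall v : vertex d, (2 <= l1norm v)%N ->
      ('V_P[fun x => bond_time (fun e => val (sigma e x)) 0%R v] <=
        (C * ((l1norm v)%:R / ln (l1norm v)%:R))%:E)%E).
Proof.
move=> d2 W0; split=> sigma q mk ti hn.
- have [| | | | | | | | |C [C0 hC]] := @invariant_passage_variance _ _ _ P W d _ _ sigma q
    (@vertex_shift d) id site_paths (2 * d) 1 vertex_colour [:: 0] val d2 W0 mk ti.
  + by rewrite muln_gt0 /= (ltnW d2).
  + by move=> v; rewrite -site_HN_threshold.
  + by move=> v; exists v, 0; rewrite ?inE // /vertex_shift add0r.
  + exact: 0.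
  + exact: vertex_nbrs_sym.
  + exact: vertex_nbrs_irr.
  + by move=> v; rewrite vertex_nbrs_card.
  + exact: vertex_colour_nbrs.
  + exact: site_path_system.
  exists C; split=> // v v2; have := hC v v2.
  suff -> : (fun x => site_time (fun u => val (sigma u x)) 0%R v) =
    (fun o => passage val site_paths (sigma ^~ o) 0 v) by [].
  by apply/funext => o; rewrite -site_time_passage.
have k0 : 'I_d by exists 0%N; exact: ltnW.
have [| | | | | | | | |C [C0 hC]] := @invariant_passage_variance _ _ _ P W d _ _ sigma q
  (@edge_shift d) fst bond_paths (4 * d - 2) (2 * d).-1 edge_colour
  [seq (0, k) | k <- enum 'I_d] val d2 W0 mk ti.
+ by move: d2; clear; lia.
+ by move=> v; rewrite -edge_HN_threshold.
+ move=> [v k]; exists v, (0, k); last by rewrite /edge_shift add0r.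
  by apply: map_f; rewrite mem_enum.
+ exact: (0, k0).
+ exact: edge_nbrs_sym.
+ exact: edge_nbrs_irr.
+ by move=> v; rewrite edge_nbrs_card.
+ exact: edge_colour_nbrs.
+ exact: bond_path_system.
exists C; split=> // v v2; have := hC v v2.
suff -> : (fun x => bond_time (fun e => val (sigma e x)) 0%R v) =
  (fun o => passage val bond_paths (sigma ^~ o) 0 v) by [].
by apply/funext => o; rewrite -bond_time_passage.
Qed.
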